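(* Let $N\geq3$, $\sigma=1+\frac N2$, $\varepsilon>0$, $A>0$, $a>0$, $\gamma\geq1$, $\bar n>0$, $p(n)=An^\gamma$. Let $\delta_0,\mu_0$ be the constants of the global existence result recalled in the context, let $n_0>0$ and $(n_0-\bar n,\mathbf{u}_0)\in B^{\sigma+\varepsilon}_{2,2}(\mathbb{R}^N)$ satisfy $$\|(n-\bar n,\mathbf{u})(\cdot,0)\|^2_{B^{\sigma+\varepsilon}_{2,2}}+\|(n_t,\mathbf{u}_t)(\cdot,0)\|^2_{B^{\sigma-1+\varepsilon}_{2,2}}\leq\delta_0,$$ and let $(n,\mathbf{u})$ be the corresponding global solution of the Euler equations with damping. Then for every $\varepsilon'<\varepsilon$, with $p=\frac{2N}{N-2}$ as Lebesgue index, $$\|n(\cdot,t)-\bar n\|_{B^{\sigma-1+\varepsilon'}_{p,2}(\mathbb{R}^N)}\to0,\qquad \|\mathbf{u}(\cdot,t)\|_{B^{\sigma+\varepsilon'}_{2,2}(\mathbb{R}^N)}\to0\qquad\text{as } t\to+\infty.$$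
   Context: The Euler equations with damping are $$n_t+\nabla\cdot(n\mathbf{u})=0,\qquad (n\mathbf{u})_t+\nabla\cdot(n\mathbf{u}\otimes\mathbf{u})+\nabla p(n)=-a\,n\mathbf{u},\qquad (n,\mathbf{u})(x,0)=(n_0,\mathbf{u}_0)(x),\quad x\in\mathbb{R}^N.$$ The initial time derivatives $(n_t,\mathbf{u}_t)(\cdot,0)$ are determined from $(n_0,\mathbf{u}_0)$ by the equations at $t=0$: $n_t(\cdot,0)=-\nabla\cdot(n_0\mathbf{u}_0)$, $\mathbf{u}_t(\cdot,0)=-(\mathbf{u}_0\cdot\nabla)\mathbf{u}_0-a\mathbf{u}_0-\frac1{n_0}\nabla p(n_0)$. Global existence result: $\delta_0,\mu_0>0$ are constants depending only on $A,\gamma,a,\bar n$ such that whenever $n_0>0$, $(n_0-\bar n,\mathbf{u}_0)\in B^{\sigma+\varepsilon}_{2,2}(\mathbb{R}^N)$ and $$\|(n-\bar n,\mathbf{u})(\cdot,0)\|^2_{B^{\sigma+\varepsilon}_{2,2}}+\|(n_t,\mathbf{u}_t)(\cdot,0)\|^2_{B^{\sigma-1+\varepsilon}_{2,2}}\leq\delta_0,$$ there is a unique global solution $(n,\mathbf{u})\in C^1([0,\infty)\times\mathbb{R}^N)$ with $(n-\bar n,\mathbf{u})\in C([0,\infty),B^{\sigma+\varepsilon}_{2,2})\cap C^1([0,\infty),B^{\sigma-1+\varepsilon}_{2,2})$, and it satisfies for all $t\geq0$ $$\|(n-\bar n,\mathbf{u})(\cdot,t)\|^2_{B^{\sigma+\varepsilon}_{2,2}}+\|(n_t,\mathbf{u}_t)(\cdot,t)\|^2_{B^{\sigma-1+\varepsilon}_{2,2}}+\mu_0\int_0^t\big(\|\mathbf{u}\|^2_{B^{\sigma+\varepsilon}_{2,2}}+\|(\nabla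 n,n_t,\mathbf{u}_t)\|^2_{B^{\sigma-1+\varepsilon}_{2,2}}\big)d\tau\leq\|(n-\bar n,\mathbf{u})(\cdot,0)\|^2_{B^{\sigma+\varepsilon}_{2,2}}+\|(n_t,\mathbf{u}_t)(\cdot,0)\|^2_{B^{\sigma-1+\varepsilon}_{2,2}}.$$ Besov spaces: fix smooth functions $\chi,\varphi:\mathbb{R}^N\to[0,1]$ with $\chi$ supported in $\{|\xi|\leq 4/3\}$, $\varphi$ supported in $\{3/4\leq|\xi|\leq 8/3\}$ and $\chi(\xi)+\sum_{q\geq0}\varphi(2^{-q}\xi)=1$. Set $\Delta_{-1}f=\chi(D)f$, $\Delta_qf=\varphi(2^{-q}D)f$ for $q\geq 0$, and $\|f\|_{B^s_{p,r}}=\big(\sum_{q\geq-1}(2^{qs}\|\Delta_qf\|_{L^p})^r\big)^{1/r}$. For tuples, the squared $B^s_{2,2}$ norm is the sum of the squared norms of the components. *)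

(* Defs.v *)
From HB Require Import structures.
From mathcomp Require Import all_boot all_order all_algebra.
From mathcomp Require Import all_classical all_reals all_analysis.
From mathcomp Require Import measurable_realfun.

Set Implicit Arguments.
Unset Strict Implicit.
Unset Printing Implicit Defensive.
Import Order.TTheory GRing.Theory Num.Theory.
Import numFieldNormedType.Exports.

Local Open Scope classical_set_scope.
Local Open Scope ring_scope.

Definition borel_rV (R : realType) (N : nat) :=
  g_sigma_algebraType (@open 'rV[R]_N).

Section cons_rV.
Context {R : realType} {N : nat}.

Definition cons_rV (z : R * 'rV[R]_N) : 'rV[R]_N.+1 :=
  \row_i (if unlift ord0 i is Some j then z.2 0 j else z.1).

Definition behead_rV (v : 'rV[R]_N.+1) : 'rV[R]_N := \row_j v 0 (lift ord0 j).

Lemma behead_cons_rV z : behead_rV (cons_rV z) = z.2.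
Proof. by apply/rowP => j; rewrite !mxE liftK. Qed.

Lemma head_cons_rV z : cons_rV z 0 ord0 = z.1.
Proof. by rewrite mxE unlift_none. Qed.

Lemma measurable_behead_rV :
  @measurable_fun _ _ (borel_rV R N.+1) (borel_rV R N) setT behead_rV.
Proof.
apply: (@measurability _ _ (borel_rV R N.+1) (borel_rV R N) setT behead_rV
  (@open 'rV[R]_N) (erefl _)) => _ [U oU <-]; rewrite setTI.
apply: sub_sigma_algebra; move: U oU; apply/continuousP => v.
move=> /= s /nbhs_ballP [e e0 es]; apply/nbhs_ballP; exists e => //= w [_ vw].
by apply: es; split => // i j; rewrite !mxE.
Qed.

Lemma measurable_head_rV :
  @measurable_fun _ _ (borel_rV R N.+1) (measurableTypeR R) setT (fun v => v 0 ord0).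
Proof.
apply: (@measurability _ _ (borel_rV R N.+1) (measurableTypeR R) setT _ _
  (RGenOpens.measurableE R)) => _ [_ [a [b ->]] <-].
rewrite setTI; apply: sub_sigma_algebra.
have /continuousP := @coord_continuous R 1 N.+1 0 ord0.
by apply; exact: interval_open.
Qed.

Lemma measurable_cons_rV :
  @measurable_fun _ _ (measurableTypeR R * borel_rV R N)%type (borel_rV R N.+1) setT cons_rV.
Proof.
apply: (@measurability _ _ (measurableTypeR R * borel_rV R N)%type
  (borel_rV R N.+1) setT cons_rV (@open 'rV[R]_N.+1) (erefl _)) => _ [U oU <-]; rewrite setTI.
pose rect (i : rat * 'rV[rat]_N * nat) : set (R * 'rV[R]_N) :=
  ball (ratr i.1.1 : R) i.2.+1%:R^-1 `*`
  ball (map_mx ratr i.1.2 : 'rV[R]_N) i.2.+1%:R^-1.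
have -> : cons_rV @^-1` U =
    \bigcup_i (if `[< rect i `<=` cons_rV @^-1` U >] then rect i else set0).
  apply/seteqP; split => [z Uz|z [i _]]; last first.
    by case: ifPn => // /asboolP iU /iU.
  have /nbhs_ballP[e e0 eU] : nbhs (cons_rV z) U.
    by rewrite nbhsE; exists U.
  have e20 : 0 < e / 2 by rewrite divr_gt0.
  have [k _ kP] := near_infty_natSinv_lt (PosNum e20).
  have {kP}/= ke := kP k (leqnn k).
  pose d : R := k.+1%:R^-1.
  have d0 : 0 < d by rewrite invr_gt0.
  have appr (x : R) : exists q : rat, ball (ratr q : R) d x.
    have /rat_in_itvoo[q] : x - d < x + d.
      by rewrite ltrD2l (lt_trans _ d0)// oppr_lt0.
    rewrite in_itv/= => /andP[q1 q2]; exists q.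
    by rewrite /ball/= ltr_distl q1 q2.
  have [q qz] := appr z.1.
  have [r rz] := choice (fun j => appr (z.2 0 j)).
  exists (q, \row_j r j, k) => //.
  case: ifPn => [_|/asboolP[]].
    by split => //=; split => // i j; rewrite !mxE ord1.
  move=> w [/= qw [_ rw]]; apply: eU; split => // i j.
  have trans (a b c : R) : ball c d a -> ball c d b -> ball a e b.
    move=> ca cb; rewrite (splitr e).
    apply: (le_ball (e1 := d + d)); first by rewrite lerD// ltW.
    exact: (ball_triangle (ball_sym ca)).
  rewrite !mxE; case: unliftP => [j' _|_]; last exact: (trans _ _ (ratr q)).
  apply: (trans _ _ (ratr (r j'))) => //.
  by have := rw 0 j'; rewrite !mxE.
apply: countable_bigcupT_measurable => // i; case: ifPn => // _.
apply: measurableX; first exact: measurable_ball.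
by apply: sub_sigma_algebra; exact: ball_open.
Qed.

Variable m : {sigma_finite_measure set (borel_rV R N) -> \bar R}.

Definition cons_measure : set (borel_rV R N.+1) -> \bar R :=
  pushforward ((@lebesgue_measure R) \x m)%E
    (cons_rV : measurableTypeR R * borel_rV R N -> borel_rV R N.+1).

Let mcons A : measurable A ->
  measurable
    ((cons_rV : measurableTypeR R * borel_rV R N -> borel_rV R N.+1) @^-1` A).
Proof.
by move=> mA; rewrite -[X in measurable X]setTI; exact: measurable_cons_rV.
Qed.

Let cons_measure0 : cons_measure set0 = 0%E.
Proof. by rewrite /cons_measure /pushforward preimage_set0 measure0. Qed.

Let cons_measure_ge0 A : (0 <= cons_measure A)%E.
Proof. exact: (@measure_ge0 _ _ _ ((@lebesgue_measure R) \x m)%E). Qed.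

Let cons_measure_sigma_additive : semi_sigma_additive cons_measure.
Proof.
move=> F mF tF mUF; rewrite /cons_measure /pushforward preimage_bigcup.
apply: (@measure_semi_sigma_additive _ _ _ ((@lebesgue_measure R) \x m)%E).
- by move=> n; exact: mcons.
- apply/trivIsetP => /= i j _ _ ij; rewrite -preimage_setI.
  by move/trivIsetP : tF => /(_ _ _ _ _ ij) ->//; rewrite preimage_set0.
- by rewrite -preimage_bigcup; exact: mcons.
Qed.

HB.instance Definition _ := isMeasure.Build _ _ _ cons_measure
  cons_measure0 cons_measure_ge0 cons_measure_sigma_additive.

Let cons_measure_sigma_finite : sigma_finite setT cons_measure.
Proof.
have /sigma_finiteP[F [TF ndF Foo]] := sigma_finiteT (@lebesgue_measure R).
have /sigma_finiteP[G [TG ndG Goo]] := sigma_finiteT m.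
pose S k : set (borel_rV R N.+1) :=
  ((fun v : 'rV[R]_N.+1 => v 0 ord0) @^-1` F k) `&` (behead_rV @^-1` G k).
exists S.
  apply/esym/seteqP; split => // v _.
  have [i _ Fi] : (\bigcup_k F k) (v 0 ord0) by rewrite -TF.
  have [j _ Gj] : (\bigcup_k G k) (behead_rV v) by rewrite -TG.
  exists (maxn i j) => //; split => /=.
    by move: Fi; exact/subsetPset/ndF/leq_maxl.
  by move: Gj; exact/subsetPset/ndG/leq_maxr.
move=> k; have [mF Fk] := Foo k; have [mG Gk] := Goo k; split.
  apply: measurableI; rewrite -[X in measurable X]setTI.
    exact: measurable_head_rV.
  exact: measurable_behead_rV.
rewrite /cons_measure /pushforward (_ : _ @^-1` _ = F k `*` G k).
  by rewrite product_measure1E// lte_mul_pinfty// ge0_fin_numE.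
by apply/seteqP; split => -[x y]; rewrite /S/= head_cons_rV behead_cons_rV.
Qed.

HB.instance Definition _ := Measure_isSigmaFinite.Build _ _ _ cons_measure
  cons_measure_sigma_finite.

End cons_rV.

(* Lebesgue measure on R^N, as the image of the iterated product of the
   one-dimensional Lebesgue measures. *)
Fixpoint lebesgue_rV (R : realType) (N : nat) :
    {sigma_finite_measure set (borel_rV R N) -> \bar R} :=
  match N with
  | 0 => [the {sigma_finite_measure set (borel_rV R 0) -> \bar R} of
            @dirac _ (borel_rV R 0) (0 : 'rV[R]_0) R]
  | N'.+1 => [the {sigma_finite_measure set (borel_rV R N'.+1) -> \bar R} of
            cons_measure (lebesgue_rV R N')]
  end.

Section besov.
Context {R : realType} {N : nat}.
Local Notation E := 'rV[R]_N.
Local Notation leb := (lebesgue_rV R N).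
Implicit Types (f m : E -> R) (x y xi : E).

Definition dotE x y : R := \sum_(i < N) x 0 i * y 0 i.

(* The library norm of ['rV[R]_N] is the sup norm. *)
Definition enorm x : R := Num.sqrt (dotE x x).

Definition partial (i : 'I_N) f : E -> R := 'D_(delta_mx 0 i) f.

Definition smooth f : Prop := forall (l : seq 'I_N) (i : 'I_N),
  let g := foldr partial f l in
  continuous g /\ forall x, derivable g x (delta_mx 0 i).

Record LP_pair (chi phi : E -> R) : Prop := {
  LP_chi_smooth : smooth chi;
  LP_phi_smooth : smooth phi;
  LP_chi01 : forall xi, 0 <= chi xi <= 1;
  LP_phi01 : forall xi, 0 <= phi xi <= 1;
  LP_chi_supp : forall xi, chi xi != 0 -> enorm xi <= 4 / 3;
  LP_phi_supp : forall xi, phi xi != 0 -> 3 / 4 <= enorm xi <= 8 / 3;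
  LP_unity : forall xi,
    chi xi + \sum_(0 <= q < n) phi ((2 ^+ q)^-1 *: xi) @[n --> \oo] --> (1 : R)
}.

(* Real and imaginary parts of the inverse Fourier transform
   (2 pi)^(-N) int e^(i x.xi) m(xi) dxi; [m] need not be even. *)
Definition ifourier_re m x : R :=
  (2 * pi) ^- N * \int[leb]_xi (cos (dotE x xi) * m xi).
Definition ifourier_im m x : R :=
  (2 * pi) ^- N * \int[leb]_xi (sin (dotE x xi) * m xi).

(* Modulus of m(D) f, where m(D) f is the convolution of f with the inverse
   Fourier transform of m. *)
Definition multiplier_abs m f x : R :=
  Num.sqrt ((\int[leb]_y (ifourier_re m y * f (x - y))) ^+ 2 +
            (\int[leb]_y (ifourier_im m y * f (x - y))) ^+ 2).

(* Measurable functions that are at most polynomially large in the mean: their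
   convolution with a Schwartz function is an absolutely convergent integral.
   Every function of every L^p, 1 <= p <= oo, is of this kind. *)
Definition tempered f : Prop := exists k : nat,
  leb.-integrable setT (fun x => (f x / (1 + enorm x ^+ 2) ^+ k)%:E).

Variables chi phi : E -> R.

(* [LP_symbol j] is the symbol of Delta_(j - 1). *)
Definition LP_symbol (j : nat) : E -> R :=
  if j is q.+1 then fun xi => phi ((2 ^+ q)^-1 *: xi) else chi.

Definition besov_norm (s : R) (p : \bar R) (r : R) f : \bar R :=
  ((\sum_(0 <= j <oo)
     ((2 `^ ((j%:R - 1) * s))%:E *
      Lnorm leb p (fun x => (multiplier_abs (LP_symbol j) f x)%:E)) `^ r)
   `^ r^-1)%E.

Definition in_besov (s : R) (p : \bar R) (r : R) f : Prop :=
  tempered f /\ (besov_norm s p r f < +oo)%E.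

Definition sqnorm (s : R) f : \bar R := (besov_norm s 2%:E 2 f `^ 2)%E.

Definition comp (v : E -> E) (i : 'I_N) : E -> R := fun x => v x 0 i.

Definition sqnorm_vec (s : R) (v : E -> E) : \bar R :=
  (\sum_(i < N) sqnorm s (comp v i))%E.

Definition besov22_norm_vec (s : R) (v : E -> E) : \bar R :=
  (sqnorm_vec s v `^ 2^-1)%E.

(* The classes C([0, oo), B^s_{2,2}) and C^1([0, oo), B^s_{2,2}); the values
   at negative times are irrelevant. *)
Definition C0_besov (s : R) (f : R -> E -> R) : Prop :=
  forall t, 0 <= t ->
    in_besov s 2%:E 2 (f t) /\
    besov_norm s 2%:E 2 (fun x => f tau x - f t x)
      @[tau --> within [set tau | 0 <= tau] (nbhs t)] --> (0 : \bar R)%E.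

Definition C1_besov (s : R) (f : R -> E -> R) : Prop :=
  C0_besov s f /\
  exists g, C0_besov s g /\
    forall t, 0 <= t ->
      besov_norm s 2%:E 2 (fun x => (f tau x - f t x) / (tau - t) - g t x)
        @[tau --> within [set tau | 0 <= tau] t^'] --> (0 : \bar R)%E.

End besov.

Section euler.
Context {R : realType} {N : nat}.
Local Notation E := 'rV[R]_N.

(* Time derivative on [0, oo), one-sided at t = 0. *)
Definition dt_quot (f : R -> E -> R) (t : R) (x : E) (tau : R) : R :=
  (f tau x - f t x) / (tau - t).

Definition dt (f : R -> E -> R) (t : R) (x : E) : R :=
  lim (dt_quot f t x @ within [set tau | 0 <= tau] t^').

Definition dt_derivable (f : R -> E -> R) (t : R) (x : E) : Prop :=
  cvg (dt_quot f t x @ within [set tau | 0 <= tau] t^').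

Definition dt_vec (u : R -> E -> E) (t : R) (x : E) : E :=
  \row_j dt (fun s => comp (u s) j) t x.

Definition continuous_tx (f : R -> E -> R) : Prop :=
  {within [set z : R * E | 0 <= z.1], continuous (fun z => f z.1 z.2)}.

Definition C1_tx (f : R -> E -> R) : Prop :=
  [/\ continuous_tx f,
      forall t x, 0 <= t -> dt_derivable f t x,
      continuous_tx (dt f) &
      forall i : 'I_N,
        (forall t x, 0 <= t -> derivable (f t) x (delta_mx 0 i)) /\
        continuous_tx (fun t => partial i (f t))].

Definition pressure (A gam : R) (n : E -> R) (x : E) : R := A * n x `^ gam.

Definition div (v : E -> E) (x : E) : R := \sum_(i < N) partial i (comp v i) x.

Variables (chi phi : E -> R) (eps A a gam nbar : R).

Definition sigma : R := 1 + N%:R / 2.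

Definition euler_eqs (n : R -> E -> R) (u : R -> E -> E) : Prop :=
  forall t x, 0 <= t ->
    dt n t x + div (fun y => n t y *: u t y) x = 0 /\
    forall j : 'I_N,
      dt (fun s y => n s y * u s y 0 j) t x
      + div (fun y => (n t y * u t y 0 j) *: u t y) x
      + partial j (pressure A gam (n t)) x
      = - a * (n t x * u t x 0 j).

(* Elements of B^{sigma + eps}_{2,2} have a (unique) continuous, indeed C^1,
   representative; the initial data are meant as such. *)
Definition initial_data (n0 : E -> R) (u0 : E -> E) : Prop :=
  [/\ forall x, 0 < n0 x,
      continuous n0,
      continuous u0,
      in_besov chi phi (sigma + eps) 2%:E 2 (fun x => n0 x - nbar) &
      forall j, in_besov chi phi (sigma + eps) 2%:E 2 (comp u0 j)].

Definition init_nt (n0 : E -> R) (u0 : E -> E) (x : E) : R :=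
  - div (fun y => n0 y *: u0 y) x.

Definition init_ut (n0 : E -> R) (u0 : E -> E) (x : E) : E :=
  \row_j (- (\sum_(i < N) u0 x 0 i * partial i (comp u0 j) x) - a * u0 x 0 j
          - (n0 x)^-1 * partial j (pressure A gam n0) x).

Definition initial_energy (n0 : E -> R) (u0 : E -> E) : \bar R :=
  (sqnorm chi phi (sigma + eps) (fun x => n0 x - nbar)%R
   + sqnorm_vec chi phi (sigma + eps) u0
   + (sqnorm chi phi (sigma - 1 + eps) (init_nt n0 u0)
      + sqnorm_vec chi phi (sigma - 1 + eps) (init_ut n0 u0)))%E.

Definition energy (n : R -> E -> R) (u : R -> E -> E) (t : R) : \bar R :=
  (sqnorm chi phi (sigma + eps) (fun x => n t x - nbar)%R
   + sqnorm_vec chi phi (sigma + eps) (u t)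
   + (sqnorm chi phi (sigma - 1 + eps) (dt n t)
      + sqnorm_vec chi phi (sigma - 1 + eps) (dt_vec u t)))%E.

Definition dissipation (n : R -> E -> R) (u : R -> E -> E) (t : R) : \bar R :=
  (sqnorm_vec chi phi (sigma + eps) (u t)
   + (\sum_(i < N) sqnorm chi phi (sigma - 1 + eps) (partial i (n t))
      + sqnorm chi phi (sigma - 1 + eps) (dt n t)
      + sqnorm_vec chi phi (sigma - 1 + eps) (dt_vec u t)))%E.

Record global_solution (n0 : E -> R) (u0 : E -> E)
    (n : R -> E -> R) (u : R -> E -> E) : Prop := {
  gs_C1_n : C1_tx n;
  gs_C1_u : forall j, C1_tx (fun t => comp (u t) j);
  gs_C0B_n : C0_besov chi phi (sigma + eps) (fun t x => n t x - nbar);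
  gs_C0B_u : forall j, C0_besov chi phi (sigma + eps) (fun t => comp (u t) j);
  gs_C1B_n : C1_besov chi phi (sigma - 1 + eps) (fun t x => n t x - nbar);
  gs_C1B_u : forall j,
    C1_besov chi phi (sigma - 1 + eps) (fun t => comp (u t) j);
  gs_eqs : euler_eqs n u;
  gs_init_n : forall x, n 0 x = n0 x;
  gs_init_u : forall x, u 0 x = u0 x
}.

Definition small_data (delta0 : R) (n0 : E -> R) (u0 : E -> E) : Prop :=
  initial_data n0 u0 /\ (initial_energy n0 u0 <= delta0%:E)%E.

Definition global_existence_constants (delta0 mu0 : R) : Prop :=
  [/\ 0 < delta0, 0 < mu0 &
      forall n0 u0, small_data delta0 n0 u0 ->
        exists n u,
          [/\ global_solution n0 u0 n u,
              forall t, 0 <= t ->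
                (energy n u t
                 + mu0%:E * \int[lebesgue_measure]_(tau in `[0%R, t])
                     dissipation n u tau
                 <= initial_energy n0 u0)%E &
              forall n' u', global_solution n0 u0 n' u' ->
                forall t x, 0 <= t -> n' t x = n t x /\ u' t x = u t x]].

End euler.

Arguments sigma R N : clear implicits.

(* Main.v *)
(* The energy bound makes the dissipation integrable over [0, oo).  The numbers
   |Delta_j u|_2 and sup |Delta_j (n - nbar)| are Lipschitz in t, because the time
   derivatives are bounded in L2 by the energy.  Hence, if one of them reached a
   fixed level at arbitrarily large times, it would stay above half of it on
   infinitely many disjoint intervals of equal length, and it suffices that the
   dissipation is bounded below there.  For u it dominates |Delta_j u|_2.  For n it
   sees only grad n: if |Delta_j (n - nbar)(x0)| is at least eta while
   Delta_j d_1 n is small, then |Delta_j (n - nbar)| is at least eta / 2 on many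
   disjoint balls centred along the direction e_1, which contradicts the L2 bound.
   So each frequency block tends to 0; since eps' < eps the high frequencies are
   uniformly negligible.  The L^p norm of a block is interpolated between L2 and
   L^oo, and Bernstein's inequality gives the loss N / 2 - N / p = 1. *)

Require Import Defs.
From HB Require Import structures.
From mathcomp Require Import all_boot all_order all_algebra.
From mathcomp Require Import all_classical all_reals all_analysis.
From mathcomp Require Import measurable_realfun ring lra.
Import Order.TTheory GRing.Theory Num.Theory.
Import numFieldNormedType.Exports.
Local Open Scope classical_set_scope.
Local Open Scope ring_scope.
Set Implicit Arguments.
Unset Strict Implicit.
Unset Printing Implicit Defensive.

(** * Integration over row vectors *)

Section measurability_rV.
Context {R : realType}.

(** The dissipation contains only grad n, so near frequency 0 it gives no lower bound for the L2
    norm of a block of n - nbar: a slowly varying profile may keep its L2 mass while it spreads out.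
    Its height cannot persist, and height is what an L^p norm with p > 2 sees; hence the different
    spaces for n and u. The dissipation is not known to be measurable in time, so its integral is
    bounded from below by simple functions only. The pointwise derivative [dt] and the Besov-valued
    derivative of [C1_besov] are introduced independently; instead of identifying them, Fatou's
    lemma compares difference quotients with the pointwise one. The symbols need not be even, so
    their kernels are complex and are carried as pairs of real and imaginary parts. Plancherel's
    theorem is avoided. L2 bounds come from Young's inequality, from reproducing a block by a wider
    symbol, and from Cauchy-Schwarz on the series of blocks, whose inverse weights are summable for
    positive order. *)

Lemma cons_behead_rV N (v : 'rV[R]_N.+1) : cons_rV (v 0 ord0, behead_rV v) = v.
Proof.
by apply/rowP => i; rewrite !mxE; case: unliftP => [j ->|->]; rewrite ?mxE.
Qed.

Lemma continuous_measurable_rV N (f : 'rV[R]_N -> R) : continuous f ->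
  measurable_fun setT (f : borel_rV R N -> R).
Proof.
move=> /continuousP cf.
apply: (@measurability _ _ (borel_rV R N) (measurableTypeR R) setT f
  _ (RGenOpens.measurableE R)) => _ [_ [a [b ->]] <-].
rewrite setTI; apply: sub_sigma_algebra; apply: cf; exact: interval_open.
Qed.

Lemma measurable_coord N (i : 'I_N) :
  measurable_fun setT (fun x : borel_rV R N => x 0 i).
Proof. by apply: continuous_measurable_rV; exact: coord_continuous. Qed.

(** By induction on N: [g] is recomposed from its head and its tail by [cons_rV], which is
    measurable from the product sigma-algebra. *)
Lemma measurable_fun_rV N d (T : measurableType d) (g : T -> borel_rV R N) :
  (forall i, measurable_fun setT (fun t => g t 0 i)) -> measurable_fun setT g.
Proof.
elim: N g => [|N IH] g mg.
  rewrite (_ : g = fun=> 0); first exact: measurable_cst.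
  by apply/funext => t; apply/rowP => -[].
rewrite (_ : g = @cons_rV R N \o (fun t => (g t 0 ord0, behead_rV (g t)))).
  apply: (measurableT_comp (@measurable_cons_rV R N)).
  apply: measurable_fun_pair; first exact: mg.
  by apply: IH => i; under eq_fun do rewrite mxE; exact: mg.
by apply/funext => t /=; rewrite cons_behead_rV.
Qed.

Lemma measurable_affine_rV N (c : R) (v : 'rV[R]_N) :
  measurable_fun setT (fun x : borel_rV R N => (c *: x + v : borel_rV R N)).
Proof.
apply: measurable_fun_rV => i; under eq_fun do rewrite !mxE.
apply: measurable_funD => //; apply: measurable_funM => //.
exact: measurable_coord.
Qed.

Lemma measurable_sub_rV N : measurable_fun setT
  (fun z : borel_rV R N * borel_rV R N => (z.1 - z.2 : borel_rV R N)).
Proof.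
apply: measurable_fun_rV => i; under eq_fun do rewrite !mxE.
apply: measurable_funB.
  exact: (measurableT_comp (measurable_coord i) measurable_fst).
exact: (measurableT_comp (measurable_coord i) measurable_snd).
Qed.

Lemma measurable_dotE N : measurable_fun setT
  (fun z : borel_rV R N * borel_rV R N => dotE z.1 z.2).
Proof.
apply: measurable_sum => i.
apply: measurable_funM.
  exact: (measurableT_comp (measurable_coord i) measurable_fst).
exact: (measurableT_comp (measurable_coord i) measurable_snd).
Qed.

End measurability_rV.

Section affine_line.
Context {R : realType}.
Local Notation mu := (@lebesgue_measure R).

Let affine (c w : R) : measurableTypeR R -> measurableTypeR R := fun s => c * s + w.

Let measurable_affine c w : measurable_fun setT (affine c w).
Proof. by apply: measurable_funD => //; apply: measurable_funM. Qed.

(** The scaled pushforward agrees with Lebesgue measure on the intervals []a, b]], which determine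
    it. For negative [c] the preimage is closed on the left instead of the right, with the same
    length. *)
Lemma lebesgue_measure_affine (c w : R) (A : set (measurableTypeR R)) :
  c != 0 -> measurable A ->
  (`|c|%:E * mu (affine c w @^-1` A) = mu A)%E.
Proof.
move=> c0 mA; have m := measurable_affine c w.
suff U :
    mu A = mscale (NngNum (normr_ge0 c)) (pushforward mu (affine c w)) A.
  by rewrite (U m).
move=> m'; apply: lebesgue_measure_unique => //= _ [[a b]] _ <-.
change (mu `]a, b] = `|c|%:E * mu (affine c w @^-1` `]a, b]))%E.
have [c_gt0|c_lt0|cE] := ltgtP 0 c; last by rewrite cE eqxx in c0.
- have -> : affine c w @^-1` `]a, b] = `](a - w) / c, (b - w) / c]%classic.
    apply/seteqP; split => s; rewrite /affine /= !in_itv /=;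
    by rewrite ltr_pdivrMr// ler_pdivlMr// ltrBlDr lerBrDr (mulrC s).
  rewrite !lebesgue_measure_itv /= !lte_fin ltr_pM2r ?invr_gt0// ltrD2r.
  case: ifPn => ab; rewrite ?mule0// -!EFinB -EFinM; congr EFin.
  by rewrite gtr0_norm//; field.
- have -> : affine c w @^-1` `]a, b] = `[(b - w) / c, (a - w) / c[%classic.
    apply/seteqP; split => s; rewrite /affine /= !in_itv /=;
    by rewrite ltr_ndivlMr// ler_ndivrMr// ltrBlDr lerBrDr (mulrC s) andbC.
  rewrite !lebesgue_measure_itv /= !lte_fin ltr_nM2r ?invr_lt0// ltrD2r.
  case: ifPn => ab; rewrite ?mule0// -!EFinB -EFinM; congr EFin.
  by rewrite ltr0_norm//; field.
Qed.

Lemma ge0_integral_affine (c w : R) (f : R -> \bar R) : c != 0 ->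
  measurable_fun setT f -> (forall x, 0 <= f x)%E ->
  (\int[mu]_x f (c * x + w)%R = (`|c|^-1)%:E * \int[mu]_x f x)%E.
Proof.
move=> c0 mf f0.
have E0 : (\int[mu]_x f x =
    \int[mscale (NngNum (normr_ge0 c)) (pushforward mu (affine c w))]_x f x)%E.
  move=> m; apply: eq_measure_integral => A mA _.
  by rewrite -[LHS](lebesgue_measure_affine w c0 mA).
rewrite (E0 (measurable_affine c w)) ge0_integral_mscale//.
rewrite ge0_integral_pushforward//.
rewrite preimage_setT muleA -EFinM mulVf ?mul1e//.
by rewrite normr_eq0.
Qed.

End affine_line.

Section integrals_rV.
Context {R : realType}.
Local Notation leb := (lebesgue_rV R).
Local Open Scope ereal_scope.

Lemma ge0_integral_cons N (f : borel_rV R N.+1 -> \bar R) :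
  measurable_fun setT f -> (forall x, 0 <= f x) ->
  \int[leb N.+1]_x f x =
  \int[@lebesgue_measure R]_s \int[leb N]_v f (cons_rV (s, v)).
Proof.
move=> mf f0; have mc := @measurable_cons_rV R N.
have E : \int[leb N.+1]_x f x = \int[pushforward ((@lebesgue_measure R) \x leb N)
    (cons_rV : measurableTypeR R * borel_rV R N -> borel_rV R N.+1)]_x f x.
  by apply: eq_measure_integral.
rewrite E ge0_integral_pushforward// preimage_setT.
rewrite fubini_tonelli1//; first exact: measurableT_comp.
by move=> z; exact: f0.
Qed.

Lemma measurable_cons_section N (f : borel_rV R N.+1 -> \bar R) :
  measurable_fun setT f -> (forall x, 0 <= f x) ->
  measurable_fun setT (fun s => \int[leb N]_v f (cons_rV (s, v))).
Proof.
move=> mf f0.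
apply: (measurable_fun_fubini_tonelli_F (f \o (cons_rV :
   measurableTypeR R * borel_rV R N -> borel_rV R N.+1))) => [|z]; last exact: f0.
by apply: measurableT_comp => //; exact: measurable_cons_rV.
Qed.

Lemma measurable_cons_l N (f : borel_rV R N.+1 -> \bar R) (s : R) :
  measurable_fun setT f ->
  measurable_fun setT (fun v : borel_rV R N => f (cons_rV (s, v))).
Proof.
move=> mf; apply: (measurableT_comp mf).
apply: (measurableT_comp (@measurable_cons_rV R N)).
exact: measurable_fun_pair.
Qed.

(** One coordinate at a time: the induction hypothesis rescales the tail inside the integral over
    the head, then the one-dimensional formula rescales the head. *)
Lemma ge0_integral_affine_rV N (c : R) (w : 'rV[R]_N) (f : borel_rV R N -> \bar R) :
  (c != 0)%R -> measurable_fun setT f -> (forall x, 0 <= f x) ->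
  \int[leb N]_x f (c *: x + w)%R = ((`|c| ^- N)%:E * \int[leb N]_x f x).
Proof.
move=> c0; elim: N w f => [|N IH] w f mf f0.
  rewrite expr0 invr1 mul1e; apply: eq_integral => x _.
  by congr f; apply/rowP => -[].
rewrite !ge0_integral_cons//; last first.
  by apply: (measurableT_comp mf); exact: measurable_affine_rV.
have E s v : (c *: cons_rV (s, v) + w =
    cons_rV (c * s + w 0 ord0, c *: v + behead_rV w))%R.
  by apply/rowP => i; rewrite !mxE; case: unliftP => [j ->|->]; rewrite ?mxE.
under eq_integral => s _.
  under eq_integral => v _ do rewrite E.
  rewrite (IH _ (fun v => f (cons_rV (c * s + w 0 ord0, v)%R)))//; last exact: measurable_cons_l.
  over.
rewrite ge0_integralZl; [|exact: measurableT| | |]; first last.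
- by rewrite lee_fin invr_ge0 exprn_ge0.
- by move=> s _; apply: integral_ge0.
- apply: (measurableT_comp (measurable_cons_section mf f0)).
  by apply: measurable_funD => //; apply: measurable_funM.
rewrite (@ge0_integral_affine R c _ (fun s => \int[leb N]_v f (cons_rV (s, v))))//; last 2 first.
- exact: measurable_cons_section.
- by move=> s; apply: integral_ge0.
by rewrite muleA -EFinM exprS invfM mulrC.
Qed.

Lemma integral_rV_prod N (h : R -> R) : measurable_fun setT h -> (forall s, 0 <= h s)%R ->
  \int[leb N]_x (\prod_(i < N) h (x 0 i))%:E = (\int[@lebesgue_measure R]_s (h s)%:E) ^+ N.
Proof.
move=> mh h0; elim: N => [|N IH].
  under eq_integral do rewrite big_ord0.
  by rewrite integral_cst// mul1e /= diracT.
have mp M : measurable_fun setT (fun x : borel_rV R M => (\prod_(i < M) h (x 0 i))%:E).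
  apply/measurable_EFinP; apply: measurable_prod => i _.
  exact: (measurableT_comp mh (measurable_coord i)).
rewrite ge0_integral_cons//; last first.
  by move=> x; rewrite lee_fin; apply: prodr_ge0.
transitivity (\int[@lebesgue_measure R]_s
    ((h s)%:E * (\int[@lebesgue_measure R]_s (h s)%:E) ^+ N)).
  apply: eq_integral => s _; rewrite -IH -ge0_integralZl//=.
  - apply: eq_integral => v _; rewrite big_ord_recl head_cons_rV EFinM.
    by congr (_ * _%:E); apply: eq_bigr => i _; rewrite mxE liftK.
  - exact: mp.
  - by move=> x _; rewrite lee_fin; apply: prodr_ge0.
  - by rewrite lee_fin.
rewrite ge0_integralZr//.
- by rewrite expeS.
- exact: (measurableT_comp _ mh).
- by move=> s _; rewrite lee_fin.
- by rewrite expe_ge0//; apply: integral_ge0 => s _; rewrite lee_fin.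
Qed.

Local Close Scope ereal_scope.

(** Balls of row vectors are those of the sup norm, that is open cubes, so their volume is a product
    of lengths. *)
Lemma ball_rVE N (r : R) (x : 'rV[R]_N) : 0 < r ->
  \prod_(i < N) \1_(`]-r, r[%classic : set R) (x 0 i) =
  \1_(ball (0 : 'rV[R]_N) r) x :> R.
Proof.
move=> r0; rewrite [RHS]indicE.
have [xB|xB] := boolP (x \in (ball (0 : 'rV[R]_N) r : set 'rV[R]_N)).
  rewrite big1// => i _; rewrite indicE mem_set//= in_itv /=.
  move: xB; rewrite inE => -[_] /(_ 0 i); rewrite /ball /= mxE sub0r normrN.
  by rewrite ltr_norml.
have [i xi] : exists i, ~~ (`|x 0 i| < r).
  apply: contrapT => /forallNP H; move/negP: xB; apply; rewrite inE; split => // i j.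
  rewrite (ord1 i) /ball /= mxE sub0r normrN; have := H j.
  by move=> /negP; rewrite negbK.
rewrite (bigD1 i)//= indicE memNset ?mul0r//= in_itv /=.
by rewrite -ltr_norml; exact/negP.
Qed.

Lemma lebesgue_ball_rV N (r : R) : 0 < r ->
  leb N (ball (0 : 'rV[R]_N) r) = ((2 * r) ^+ N)%:E.
Proof.
move=> r0.
have mb : measurable (ball (0 : 'rV[R]_N) r : set (borel_rV R N)).
  by apply: sub_sigma_algebra; exact: ball_open.
have I1 : (\int[@lebesgue_measure R]_s (\1_(`]-r, r[%classic : set R) s)%:E = (2 * r)%:E)%E.
  rewrite integral_indic// setIT [LHS]lebesgue_measure_itv/= lte_fin gtrN//.
  by rewrite -EFinD opprK -mulr2n -(mulr_natl r).
have := @integral_rV_prod N (\1_(`]-r, r[%classic : set R)).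
rewrite I1 -EFin_expe => <-//.
transitivity (\int[leb N]_x (\1_(ball (0 : 'rV[R]_N) r : set (borel_rV R N)) x)%:E)%E.
  by rewrite integral_indic// setIT.
by apply: eq_integral => x _; rewrite -(ball_rVE x r0).
Qed.

(** [Rintegral] is [fine] of the extended integral. Integrability of every section, rather than of
    almost every one, allows [fine] to be removed from the inner integral at each point. *)
Lemma Rintegral_cons N (f : borel_rV R N.+1 -> R) :
  (leb N.+1).-integrable setT (EFin \o f) ->
  (forall s : R, (leb N).-integrable setT (fun v => (f (cons_rV (s, v)))%:E)) ->
  \int[leb N.+1]_x f x =
  \int[@lebesgue_measure R]_s \int[leb N]_v f (cons_rV (s, v)).
Proof.
move=> fi fs; have mc := @measurable_cons_rV R N.
have mf := measurable_int _ fi.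
have pint : ((@lebesgue_measure R) \x leb N)%E.-integrable setT
    (EFin \o f \o (cons_rV : measurableTypeR R * borel_rV R N -> borel_rV R N.+1)).
  apply/integrableP; split; first exact: measurableT_comp.
  move/integrableP : fi => [_]; rewrite ge0_integral_cons//; last exact: measurableT_comp.
  by rewrite fubini_tonelli1//; apply: measurableT_comp => //; exact: measurableT_comp.
have mc' : measurable_fun setT (cons_rV : measurableTypeR R * borel_rV R N -> borel_rV R N.+1) by [].
transitivity (fine (\int[pushforward ((@lebesgue_measure R) \x leb N)
    (cons_rV : measurableTypeR R * borel_rV R N -> borel_rV R N.+1)]_x (f x)%:E)%E).
  by congr fine; apply: eq_measure_integral.
rewrite integral_pushforward// preimage_setT.
rewrite -integral12_prod_meas1//; congr fine.
apply: eq_integral => s _; rewrite /fubini_F /Rintegral fineK//.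
exact/integrable_fin_num/fs.
Qed.

Lemma integrable_affine_rV N (c : R) (w : 'rV[R]_N) (f : borel_rV R N -> R) :
  c != 0 -> (leb N).-integrable setT (EFin \o f) ->
  (leb N).-integrable setT (EFin \o (fun x => f (c *: x + w))).
Proof.
move=> c0 /integrableP[mf fi]; apply/integrableP; split.
  exact: (measurableT_comp mf (measurable_affine_rV _ _)).
rewrite (@ge0_integral_affine_rV N c w (fun x => `|(f x)%:E|)%E)//.
  by rewrite lte_mul_pinfty// lee_fin invr_ge0.
exact: measurableT_comp.
Qed.

Lemma Rintegral_affine_rV N (c : R) (w : 'rV[R]_N) (f : borel_rV R N -> R) :
  c != 0 -> (leb N).-integrable setT (EFin \o f) ->
  \int[leb N]_x f (c *: x + w) = `|c| ^- N * \int[leb N]_x f x.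
Proof.
move=> c0 fi; have mf := measurable_int _ fi.
rewrite /Rintegral.
have F := integrable_pos_fin_num measurableT fi.
have G := integrable_neg_fin_num measurableT fi.
have P : (\int[leb N]_x (EFin \o f)^\+ (c *: x + w)%R =
    (`|c| ^- N)%:E * \int[leb N]_x (EFin \o f)^\+ x)%E.
  by apply: ge0_integral_affine_rV => //; exact: measurable_funepos.
have Q : (\int[leb N]_x (EFin \o f)^\- (c *: x + w)%R =
    (`|c| ^- N)%:E * \int[leb N]_x (EFin \o f)^\- x)%E.
  by apply: ge0_integral_affine_rV => //; exact: measurable_funeneg.
have -> : (\int[leb N]_x (f (c *: x + w))%:E = \int[leb N]_x (EFin \o f)^\+ (c *: x + w)%R
    - \int[leb N]_x (EFin \o f)^\- (c *: x + w)%R)%E.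
  rewrite integralE; congr (_ - _)%E; apply: eq_integral => x _.
    exact: (congr1 (@^~ x) (funepos_comp (EFin \o f) (fun x => c *: x + w))).
  exact: (congr1 (@^~ x) (funeneg_comp (EFin \o f) (fun x => c *: x + w))).
have -> : (\int[leb N]_x (f x)%:E =
    \int[leb N]_x (EFin \o f)^\+ x - \int[leb N]_x (EFin \o f)^\- x)%E by rewrite integralE.
by rewrite P Q -(fineK F) -(fineK G) -!EFinM -!EFinB /= mulrBr.
Qed.

End integrals_rV.

(** * One-dimensional integrals and the exponential kernel *)

Section line_integrals.
Context {R : realType}.
Local Notation mu := (@lebesgue_measure R).

Lemma nonneg_set_itv : [set x : R | 0 <= x] = `[0, +oo[%classic.
Proof. by apply/seteqP; split => x/=; rewrite in_itv/= andbT. Qed.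

Lemma continuous_inv_1sqr : continuous (fun x : R => (1 + x ^+ 2)^-1).
Proof.
move=> x; apply: cvgV; first by rewrite gt_eqF// ltr_pwDl// sqr_ge0.
apply: cvgD; first exact: cvg_cst.
exact: exprn_continuous.
Qed.

Lemma integral_inv_1sqr : (\int[mu]_x ((1 + x ^+ 2)^-1)%:E = pi%:E)%E.
Proof.
rewrite ge0_symfun_integralT; last 3 first.
- by move=> x; rewrite invr_ge0 addr_ge0// sqr_ge0.
- exact: continuous_inv_1sqr.
- by move=> x /=; rewrite sqrrN.
rewrite nonneg_set_itv (@ge0_continuous_FTC2y _ _ atan _ (pi / 2)).
- by rewrite atan0 -EFinB -EFinM subr0 mulrC divfK.
- by move=> x _; rewrite invr_ge0 addr_ge0// sqr_ge0.
- by apply: continuous_subspaceT => x; exact: continuous_inv_1sqr.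
- exact: cvgy_atan.
- by move=> x _; have := is_derive1_atan x => -[].
- by apply: cvg_at_right_filter; exact: continuous_atan.
- by move=> x _; rewrite derive1E; apply: derive_val.
Qed.

Lemma cvgy_expRN_bounded (g : R -> R) (M : R) : (forall x, `|g x| <= M) ->
  expR (- x) * g x @[x --> +oo] --> 0.
Proof.
move=> gM; apply: norm_cvg0.
apply: (@squeeze_cvgr _ _ _ _ (cst 0) (fun x => expR (- x) * M)).
- apply: nearW => x; rewrite normr_ge0/= normrM (gtr0_norm (expR_gt0 _)).
  by rewrite ler_wpM2l// expR_ge0.
- exact: cvg_cst.
- by rewrite -(mul0r M); apply: cvgM; [exact: cvgr_expR|exact: cvg_cst].
Qed.

(* expR (- x) * (1 + cos) is nonnegative, so that the FTC on a half-line, which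
   the library has for functions of constant sign, applies. *)
Lemma integral0y_expRN_1cos (b : R) :
  (\int[mu]_(x in `[0%R, +oo[) (expR (- x) * (1 + cos (b * x)))%:E =
   (1 + (1 + b ^+ 2)^-1)%:E)%E.
Proof.
have b0 : 1 + b ^+ 2 != 0 by rewrite gt_eqF// ltr_pwDl// sqr_ge0.
(* An antiderivative is [expR (- x) * G x], the trigonometric part coming from two integrations by
   parts. As [G] is bounded, it vanishes at infinity. *)
pose G x : R := - 1 + (1 + b ^+ 2)^-1 * (b * sin (b * x) - cos (b * x)).
have dF (x : R) : is_derive x 1 (fun x => expR (- x) * G x) (expR (- x) * (1 + cos (b * x))).
  rewrite /G; apply: is_derive_eq.
  rewrite /GRing.scale /=.
  by field; rewrite b0.
have Gb x : `|G x| <= 1 + (1 + b ^+ 2)^-1 * (`|b| + 1).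
  rewrite /G (le_trans (ler_normD _ _))// normrN normr1 lerD2l normrM ger0_norm; last first.
    by rewrite invr_ge0 addr_ge0// sqr_ge0.
  rewrite ler_wpM2l// ?invr_ge0 ?addr_ge0// ?sqr_ge0//.
  rewrite (le_trans (ler_normB _ _))// lerD// ?normrM ?ler_piMr// ler_norml.
    by rewrite sin_geN1 sin_le1.
  by rewrite cos_geN1 cos_le1.
have cF : continuous (fun x => expR (- x) * G x).
  by move=> x; apply/differentiable_continuous/derivable1_diffP; have [] := dF x.
rewrite (@ge0_continuous_FTC2y _ _ (fun x => expR (- x) * G x) _ 0).
- rewrite /G oppr0 expR0 mulr0 cos0 sin0 -EFinB; congr EFin; by ring.
- move=> x _; rewrite mulr_ge0 ?expR_ge0// -lerBlDl sub0r; exact: cos_geN1.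
- apply: continuous_subspaceT => x.
  have d : derivable (fun x => expR (- x) * (1 + cos (b * x)) : R) x 1 by [].
  exact/differentiable_continuous/derivable1_diffP.
- exact: cvgy_expRN_bounded Gb.
- by move=> x _; have [] := dF x.
- by apply: cvg_at_right_filter; exact: cF.
- by move=> x _; rewrite derive1E; apply: derive_val.
Qed.

Lemma continuous_expRN_norm : continuous (fun x : R => expR (- `|x|)).
Proof.
move=> x; apply: (@continuous_comp _ _ _ (fun x : R => - `|x|) expR).
  by apply: cvgN; exact: norm_continuous.
exact: continuous_expR.
Qed.

Lemma integral_expRN_norm_1cos (b : R) :
  (\int[mu]_x (expR (- `|x|) * (1 + cos (b * x)))%:E =
   (2 * (1 + (1 + b ^+ 2)^-1))%:E)%E.
Proof.
rewrite ge0_symfun_integralT; last 3 first.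
- by move=> x; rewrite mulr_ge0 ?expR_ge0// -lerBlDl sub0r; exact: cos_geN1.
- move=> x; apply: cvgM; first exact: continuous_expRN_norm.
  apply: cvgD; first exact: cvg_cst.
  apply: (@continuous_comp _ _ _ (fun x : R => b * x) cos).
    by apply: cvgM; [exact: cvg_cst|exact: cvg_id].
  exact: continuous_cos.
- by move=> x /=; rewrite normrN mulrN cosN.
rewrite EFinM -integral0y_expRN_1cos nonneg_set_itv; congr (_ * _)%E.
by apply: eq_integral => x; rewrite inE /= in_itv /= andbT => x0; rewrite ger0_norm.
Qed.

Lemma integral_expRN_norm : (\int[mu]_x (expR (- `|x|))%:E = 2%:E)%E.
Proof.
have m : measurable_fun setT (EFin \o (fun x : R => expR (- `|x|))).
  apply/measurable_EFinP; apply: continuous_measurable_fun; exact: continuous_expRN_norm.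
(* At frequency 0 the integrand is twice e^(-|x|) and the value is 4. *)
have := integral_expRN_norm_1cos 0.
rewrite expr0n addr0 invr1.
under eq_integral do rewrite mul0r cos0 EFinM.
rewrite ge0_integralZr//=.
move=> /(congr1 (fun z => z * (2^-1)%:E)%E); rewrite -muleA -!EFinM.
rewrite divff// mule1 => ->; congr EFin; by field.
Qed.

Lemma integrable_expRN_norm : mu.-integrable setT (EFin \o (fun x => expR (- `|x|))).
Proof.
apply/integrableP; split.
  apply/measurable_EFinP; apply: continuous_measurable_fun; exact: continuous_expRN_norm.
under eq_integral => x _ do rewrite /= gtr0_norm ?expR_gt0//.
by rewrite integral_expRN_norm ltry.
Qed.

Lemma integrable_expRN_normM (g : R -> R) : continuous g -> (forall x, `|g x| <= 1) ->
  mu.-integrable setT (EFin \o (fun x => expR (- `|x|) * g x)).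
Proof.
move=> cg g1; apply: (le_integrable measurableT _ _ integrable_expRN_norm).
  apply/measurable_EFinP; apply: measurable_funM;
  apply: continuous_measurable_fun => //; exact: continuous_expRN_norm.
move=> x _ /=; rewrite lee_fin normrM ler_piMr//.
Qed.

Let continuous_cosM b : continuous (fun x : R => cos (b * x)).
Proof.
move=> x; apply: (@continuous_comp _ _ _ (fun x : R => b * x) cos).
  by apply: cvgM; [exact: cvg_cst|exact: cvg_id].
exact: continuous_cos.
Qed.

Let continuous_sinM b : continuous (fun x : R => sin (b * x)).
Proof.
move=> x; apply: (@continuous_comp _ _ _ (fun x : R => b * x) sin).
  by apply: cvgM; [exact: cvg_cst|exact: cvg_id].
exact: continuous_sin.
Qed.

Let cos_norm (x : R) : `|cos x| <= 1.
Proof. by rewrite ler_norml cos_geN1 cos_le1. Qed.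

Let sin_norm (x : R) : `|sin x| <= 1.
Proof. by rewrite ler_norml sin_geN1 sin_le1. Qed.

Lemma Rintegral_expRN_norm_cos (b : R) :
  \int[mu]_x (expR (- `|x|) * cos (b * x)) = 2 / (1 + b ^+ 2).
Proof.
have ic := integrable_expRN_normM (@continuous_cosM b) (fun x => cos_norm _).
have := congr1 fine (integral_expRN_norm_1cos b).
rewrite -[LHS]/(\int[mu]_x (expR (- `|x|) * (1 + cos (b * x)))).
under eq_Rintegral do rewrite mulrDr mulr1.
rewrite RintegralD//; last exact: integrable_expRN_norm.
rewrite [X in X + _](_ : _ = 2); last by rewrite /Rintegral integral_expRN_norm.
by rewrite /= mulrDr mulr1 => /addrI.
Qed.

(** Oddness. The reflection of the line is applied to the nonnegative integrand with [1 + sin], as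
    [ge0_integral_affine] requires, and the summand without sine then cancels. *)
Lemma Rintegral_expRN_norm_sin (b : R) : \int[mu]_x (expR (- `|x|) * sin (b * x)) = 0.
Proof.
have is_ := integrable_expRN_normM (@continuous_sinM b) (fun x => sin_norm _).
have m1 : measurable_fun setT (fun x : R => (expR (- `|x|) * (1 + sin (b * x)))%:E).
  apply/measurable_EFinP; apply: measurable_funM.
    apply: continuous_measurable_fun; exact: continuous_expRN_norm.
  by apply: measurable_funD => //; apply: continuous_measurable_fun; exact: continuous_sinM.
have N1 : -1 != 0 :> R by rewrite oppr_eq0 oner_eq0.
have := ge0_integral_affine 0 N1 m1 _.
have h (x : R) : (0 <= (expR (- `|x|) * (1 + sin (b * x)))%:E)%E.
  by rewrite lee_fin mulr_ge0 ?expR_ge0// -lerBlDl sub0r; exact: sin_geN1.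
move=> /(_ h); rewrite normrN1 invr1 mul1e.
under eq_integral do rewrite mulN1r addr0 normrN mulrN sinN.
move=> /(congr1 fine); rewrite -![fine _]/(Rintegral _ _ _).
have ie := integrable_expRN_norm.
rewrite (_ : \int[mu]_x (expR (- `|x|) * (1 - sin (b * x))) =
  \int[mu]_x (expR (- `|x|)) - \int[mu]_x (expR (- `|x|) * sin (b * x))); last first.
  by rewrite -RintegralB//; apply: eq_Rintegral => x _; rewrite mulrBr mulr1.
rewrite (_ : \int[mu]_x (expR (- `|x|) * (1 + sin (b * x))) =
  \int[mu]_x (expR (- `|x|)) + \int[mu]_x (expR (- `|x|) * sin (b * x))); last first.
  by rewrite -RintegralD//; apply: eq_Rintegral => x _; rewrite mulrDr mulr1.
by move=> /addrI; lra.
Qed.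

End line_integrals.

Section exp_kernel.
Context {R : realType}.
Local Notation leb := (lebesgue_rV R).

(** A summability kernel of product form: its Fourier transform is the product of the 2 / (1 +
    x_i^2), obtained from one-dimensional integrals, and is again positive and integrable. *)
Definition exp_kernel N (x : borel_rV R N) : R := \prod_(i < N) expR (- `|x 0 i|).

Lemma exp_kernel_gt0 N (x : borel_rV R N) : 0 < exp_kernel x.
Proof. by apply: prodr_gt0 => i _; exact: expR_gt0. Qed.

Lemma exp_kernel_le1 N (x : borel_rV R N) : exp_kernel x <= 1.
Proof.
by apply: prodr_ile1 => i; rewrite expR_ge0/= -[leRHS]expR0 ler_expR oppr_le0.
Qed.

Lemma measurable_exp_kernel N : measurable_fun setT (@exp_kernel N).
Proof.
apply: measurable_prod => i _.
have m : measurable_fun setT (fun x : R => expR (- `|x|)).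
  by apply: continuous_measurable_fun; exact: continuous_expRN_norm.
exact: (measurableT_comp m (measurable_coord i)).
Qed.

Lemma integrable_exp_kernel N : (leb N).-integrable setT (EFin \o @exp_kernel N).
Proof.
apply/integrableP; split; first by apply/measurable_EFinP; exact: measurable_exp_kernel.
under eq_integral => x _ do rewrite /= gtr0_norm ?exp_kernel_gt0// /exp_kernel.
rewrite (@integral_rV_prod _ _ (fun s => expR (- `|s|))) ?integral_expRN_norm.
- by rewrite -EFin_expe ltry.
- apply: continuous_measurable_fun; exact: continuous_expRN_norm.
- by move=> s; rewrite expR_ge0.
Qed.

Lemma continuous_sumf (V : topologicalType) (I : Type) (s : seq I) (F : I -> V -> R) :
  (forall i, continuous (F i)) -> continuous (fun v => \sum_(i <- s) F i v).
Proof.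
move=> cF; elim: s => [|a s IH].
  by under eq_fun do rewrite big_nil; move=> x; exact: cvg_cst.
by under eq_fun do rewrite big_cons; move=> x; apply: cvgD; [exact: cF|exact: IH].
Qed.

Lemma continuous_dotEl N (x : 'rV[R]_N) : continuous (fun y => dotE y x).
Proof.
apply: continuous_sumf => i y.
by apply: continuousM; [exact: (@coord_continuous R 1 N)|exact: cst_continuous].
Qed.

Lemma dotEC N (x y : 'rV[R]_N) : dotE x y = dotE y x.
Proof. by apply: eq_bigr => i _; rewrite mulrC. Qed.

Lemma continuous_dotEr N (x : 'rV[R]_N) : continuous (dotE x).
Proof.
have -> : dotE x = fun y => dotE y x by apply/funext => y; rewrite dotEC.
exact: continuous_dotEl.
Qed.

Lemma dotE_cons N (s : R) (v : 'rV[R]_N) x :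
  dotE (cons_rV (s, v)) x = s * x 0 ord0 + dotE v (behead_rV x).
Proof.
rewrite /dotE big_ord_recl head_cons_rV; congr (_ + _).
by apply: eq_bigr => i _; rewrite !mxE liftK.
Qed.

Lemma exp_kernel_cons N (s : R) (v : 'rV[R]_N) :
  exp_kernel (cons_rV (s, v) : borel_rV R N.+1) = expR (- `|s|) * exp_kernel v.
Proof.
rewrite /exp_kernel big_ord_recl head_cons_rV; congr (_ * _).
by apply: eq_bigr => i _; rewrite !mxE liftK.
Qed.

Lemma integrable_exp_kernelM N (g : borel_rV R N -> R) :
  measurable_fun setT g -> (forall x, `|g x| <= 1) ->
  (leb N).-integrable setT (EFin \o (fun x => exp_kernel x * g x)).
Proof.
move=> mg g1; apply: (le_integrable measurableT _ _ (integrable_exp_kernel N)).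
  by apply/measurable_EFinP; apply: measurable_funM => //; exact: measurable_exp_kernel.
by move=> x _ /=; rewrite lee_fin normrM ler_piMr.
Qed.

Lemma normr_cos_le1 (x : R) : `|cos x| <= 1.
Proof. by rewrite ler_norml cos_geN1 cos_le1. Qed.

Lemma normr_sin_le1 (x : R) : `|sin x| <= 1.
Proof. by rewrite ler_norml sin_geN1 sin_le1. Qed.

Lemma measurable_cos_dotE N (x : 'rV[R]_N) :
  measurable_fun setT (fun y : borel_rV R N => cos (dotE y x)).
Proof.
apply: continuous_measurable_rV => y.
apply: (@continuous_comp _ _ _ (fun y => dotE y x) cos).
  exact: continuous_dotEl.
exact: continuous_cos.
Qed.

Lemma measurable_sin_dotE N (x : 'rV[R]_N) :
  measurable_fun setT (fun y : borel_rV R N => sin (dotE y x)).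
Proof.
apply: continuous_measurable_rV => y.
apply: (@continuous_comp _ _ _ (fun y => dotE y x) sin).
  exact: continuous_dotEl.
exact: continuous_sin.
Qed.

(** The two parts are proved together because the addition formulas, which split off the first
    coordinate, mix cosine and sine. *)
Lemma fourier_exp_kernel N (x : 'rV[R]_N) :
  \int[leb N]_y (exp_kernel y * cos (dotE y x)) = \prod_(i < N) (2 / (1 + x 0 i ^+ 2)) /\
  \int[leb N]_y (exp_kernel y * sin (dotE y x)) = 0.
Proof.
elim: N x => [|N IH] x.
  have E (h : R -> R) : \int[leb 0]_y (exp_kernel y * h (dotE y x)) = h 0.
    under eq_Rintegral do rewrite /exp_kernel /dotE !big_ord0 mul1r.
    rewrite /Rintegral integral_cst//.
    by rewrite -[X in fine (_ * X)%E]/(@dirac _ (borel_rV R 0) 0 R setT) diracT mule1.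
  by rewrite (E cos) (E sin) cos0 sin0 big_ord0.
have [IHc IHs] := IH (behead_rV x).
have ic := integrable_exp_kernelM (measurable_cos_dotE (behead_rV x)) (fun _ => normr_cos_le1 _).
have is_ := integrable_exp_kernelM (measurable_sin_dotE (behead_rV x)) (fun _ => normr_sin_le1 _).
have sec (h : R -> R) (s : R) : measurable_fun setT (fun y : borel_rV R N.+1 => h (dotE y x)) ->
    (forall y, `|h y| <= 1) -> (leb N).-integrable setT (fun v =>
      (exp_kernel (cons_rV (s, v) : borel_rV R N.+1) * h (dotE (cons_rV (s, v)) x))%:E).
  move=> mh h1.
  under [X in _.-integrable _ X]funext => v do rewrite exp_kernel_cons -mulrA EFinM.
  apply: integrableZl => //; apply: integrable_exp_kernelM => //.
  apply: (measurableT_comp mh); apply: (measurableT_comp (@measurable_cons_rV R N)).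
  exact: measurable_fun_pair.
have icl : (@lebesgue_measure R).-integrable setT
    (EFin \o (fun s => expR (- `|s|) * cos (x 0 ord0 * s))).
  apply: integrable_expRN_normM => [|y]; last exact: normr_cos_le1.
  move=> y; apply: (@continuous_comp _ _ _ (fun y : R => x 0 ord0 * y) cos).
    by apply: cvgM; [exact: cvg_cst|exact: cvg_id].
  exact: continuous_cos.
have isl : (@lebesgue_measure R).-integrable setT
    (EFin \o (fun s => expR (- `|s|) * sin (x 0 ord0 * s))).
  apply: integrable_expRN_normM => [|y]; last exact: normr_sin_le1.
  move=> y; apply: (@continuous_comp _ _ _ (fun y : R => x 0 ord0 * y) sin).
    by apply: cvgM; [exact: cvg_cst|exact: cvg_id].
  exact: continuous_sin.
split.
  rewrite Rintegral_cons; last 2 first.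
  - by apply: integrable_exp_kernelM => [|y]; [exact: measurable_cos_dotE|exact: normr_cos_le1].
  - by move=> s; apply: sec => [|y]; [exact: measurable_cos_dotE|exact: normr_cos_le1].
  transitivity (\int[@lebesgue_measure R]_s (expR (- `|s|) * cos (x 0 ord0 * s) *
      \prod_(i < N) (2 / (1 + behead_rV x 0 i ^+ 2)))).
    apply: eq_Rintegral => s _.
    transitivity (\int[leb N]_v (expR (- `|s|) * cos (x 0 ord0 * s) * (exp_kernel v * cos (dotE v (behead_rV x)))
       - expR (- `|s|) * sin (x 0 ord0 * s) * (exp_kernel v * sin (dotE v (behead_rV x))))).
      by apply: eq_Rintegral => v _; rewrite exp_kernel_cons dotE_cons cosD (mulrC s); ring.
    rewrite RintegralB//; last 2 first.
    - exact: (integrableZl _ _ ic).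
    - exact: (integrableZl _ _ is_).
    by rewrite !RintegralZl// IHc IHs mulr0 subr0.
  rewrite RintegralZr// Rintegral_expRN_norm_cos big_ord_recl; congr (_ * _).
  by apply: eq_bigr => i _; rewrite mxE.
rewrite Rintegral_cons; last 2 first.
- by apply: integrable_exp_kernelM => [|y]; [exact: measurable_sin_dotE|exact: normr_sin_le1].
- by move=> s; apply: sec => [|y]; [exact: measurable_sin_dotE|exact: normr_sin_le1].
transitivity (\int[@lebesgue_measure R]_s (expR (- `|s|) * sin (x 0 ord0 * s) *
    \prod_(i < N) (2 / (1 + behead_rV x 0 i ^+ 2)))).
  apply: eq_Rintegral => s _.
  transitivity (\int[leb N]_v (expR (- `|s|) * sin (x 0 ord0 * s) * (exp_kernel v * cos (dotE v (behead_rV x)))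
     + expR (- `|s|) * cos (x 0 ord0 * s) * (exp_kernel v * sin (dotE v (behead_rV x))))).
    by apply: eq_Rintegral => v _; rewrite exp_kernel_cons dotE_cons sinD (mulrC s); ring.
  rewrite RintegralD//; last 2 first.
  - exact: (integrableZl _ _ ic).
  - exact: (integrableZl _ _ is_).
  by rewrite !RintegralZl// IHc IHs mulr0 addr0.
by rewrite RintegralZr// Rintegral_expRN_norm_sin mul0r.
Qed.

End exp_kernel.

(** * Polynomial weights and directional derivatives *)

Section weight.
Context {R : realType} {N : nat}.
Local Notation leb := (lebesgue_rV R N).
Implicit Types x y : 'rV[R]_N.

(** The square of the Japanese bracket, the expression occurring in [tempered]; its negative powers
    measure decay. *)
Definition weight x : R := 1 + enorm x ^+ 2.

Lemma dotE_ge0 x : 0 <= dotE x x.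
Proof. by apply: sumr_ge0 => i _; rewrite -expr2 sqr_ge0. Qed.

Lemma weightE x : weight x = 1 + \sum_(i < N) x 0 i ^+ 2.
Proof.
rewrite /weight /enorm sqr_sqrtr ?dotE_ge0//.
Qed.

Lemma weight_ge1 x : 1 <= weight x.
Proof. by rewrite /weight lerDl sqr_ge0. Qed.

Lemma weight_gt0 x : 0 < weight x.
Proof. exact: lt_le_trans (weight_ge1 x). Qed.

Lemma sqr_coord_le_weight x i : 1 + x 0 i ^+ 2 <= weight x.
Proof.
rewrite weightE lerD2l (bigD1 i)//= lerDl.
by apply: sumr_ge0 => j _; exact: sqr_ge0.
Qed.

Lemma continuous_weight : continuous weight.
Proof.
rewrite (_ : weight = fun x => 1 + \sum_(i < N) x 0 i ^+ 2); last first.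
  by apply/funext => x; rewrite weightE.
move=> x; apply: continuousD; first exact: cst_continuous.
apply: continuous_sumf => i y.
apply: (@continuous_comp _ _ _ (fun x : 'rV[R]_N => x 0 i) (fun r : R => r ^+ 2)).
  exact: (@coord_continuous R 1 N).
exact: exprn_continuous.
Qed.

Lemma measurable_weightVX k :
  measurable_fun setT (fun x : borel_rV R N => weight x ^- k).
Proof.
apply: continuous_measurable_rV => x.
apply: (@continuous_comp _ _ _ weight (fun r : R => r ^- k)).
  exact: continuous_weight.
apply: cvgV; first by rewrite gt_eqF// exprn_gt0// weight_gt0.
exact: exprn_continuous.
Qed.

(** Each factor 1 + x_i^2 is at most [weight x], so [weight x ^- N] is below the product of their
    inverses, whose integral is pi^N. *)
Lemma integrable_weightVN : leb.-integrable setT (EFin \o (fun x : borel_rV R N => weight x ^- N)).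
Proof.
have m0 : measurable_fun setT (fun s : R => (1 + s ^+ 2)^-1).
  by apply: continuous_measurable_fun; exact: continuous_inv_1sqr.
have h0 (s : R) : 0 <= (1 + s ^+ 2)^-1 by rewrite invr_ge0 addr_ge0// sqr_ge0.
apply: (@le_integrable _ _ _ _ _ measurableT _
    (fun x : borel_rV R N => (\prod_(i < N) (1 + x 0 i ^+ 2)^-1)%:E)).
- by apply/measurable_EFinP; exact: measurable_weightVX.
- move=> x _ /=; rewrite lee_fin !ger0_norm.
  + have -> : \prod_(i < N) (1 + x 0 i ^+ 2)^-1 = (\prod_(i < N) (1 + x 0 i ^+ 2))^-1.
      by rewrite prodfV.
    rewrite lef_pV2 ?posrE ?exprn_gt0 ?weight_gt0//; last first.
      by apply: prodr_gt0 => i _; rewrite ltr_pwDl// sqr_ge0.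
    rewrite -[X in _ <= weight x ^+ X](card_ord N) -prodr_const.
    by apply: ler_prod => i _; rewrite addr_ge0 ?sqr_ge0//= sqr_coord_le_weight.
  + by apply: prodr_ge0.
  + by rewrite invr_ge0 exprn_ge0// ltW// weight_gt0.
- apply/integrableP; split.
    apply/measurable_EFinP; apply: measurable_prod => i _.
    exact: (measurableT_comp m0 (measurable_coord i)).
  under eq_integral => x _ do rewrite /= ger0_norm ?prodr_ge0//.
  rewrite (@integral_rV_prod _ _ (fun s => (1 + s ^+ 2)^-1))// integral_inv_1sqr.
  by rewrite -EFin_expe ltry.
Qed.

Lemma integrable_weightVX k : (N <= k)%N -> leb.-integrable setT (EFin \o (fun x : borel_rV R N => weight x ^- k)).
Proof.
move=> Nk; apply: (le_integrable measurableT _ _ integrable_weightVN).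
  by apply/measurable_EFinP; exact: measurable_weightVX.
move=> x _ /=; rewrite lee_fin !ger0_norm ?invr_ge0 ?exprn_ge0 ?(ltW (weight_gt0 _))//.
by rewrite lef_pV2 ?posrE ?exprn_gt0 ?weight_gt0// ler_weXn2l// weight_ge1.
Qed.

(** Peetre's inequality, the device by which a weight at one point is exchanged for a weight at
    another. *)
Lemma weight_sub_le x y : weight (x - y) <= 2 * weight x * weight y.
Proof.
have h : weight (x - y) <= 1 + 2 * (\sum_(i < N) x 0 i ^+ 2) + 2 * (\sum_(i < N) y 0 i ^+ 2).
  rewrite weightE -addrA lerD2l !mulr_sumr -big_split /=; apply: ler_sum => i _.
  rewrite !mxE; have := sqr_ge0 (x 0 i + y 0 i); lra.
apply: (le_trans h); rewrite !weightE.
have a0 : 0 <= \sum_(i < N) x 0 i ^+ 2 by apply: sumr_ge0 => i _; exact: sqr_ge0.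
have b0 : 0 <= \sum_(i < N) y 0 i ^+ 2 by apply: sumr_ge0 => i _; exact: sqr_ge0.
by nra.
Qed.

End weight.

Section directional_derivative.
Context {R : realType} {V : normedModType R}.
Implicit Types f : V -> R.

(** Restriction to a line turns directional derivatives into derivatives of functions of one real
    variable, to which the chain rule and the mean value theorem apply. *)
Lemma is_derive_lineP f (x v : V) (s d : R) :
  is_derive s 1 (fun h => f (x + h *: v)) d <-> is_derive (x + s *: v) v f d.
Proof.
have E : (fun h : R => h^-1 *: (((fun h => f (x + h *: v)) \o shift s) (h *: 1)
      - f (x + s *: v))) =
    (fun h : R => h^-1 *: ((f \o shift (x + s *: v)) (h *: v) - f (x + s *: v))).
  apply/funext => h /=; congr (_ *: (f _ - _)).
  by rewrite [h *: 1]mulr1 scalerDl addrCA.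
by split => -[D1 D2]; split; rewrite /derivable/derive ?E// -?E// in D1 D2 *.
Qed.

Lemma is_derive_affine f (x v w : V) (c d : R) :
  is_derive (c *: x + w) v f d -> is_derive x v (fun y => f (c *: y + w)) (c * d).
Proof.
move=> fd.
rewrite -[x in is_derive x](addr0 x) -(scale0r v); apply/is_derive_lineP.
have -> : (fun h : R => f (c *: (x + h *: v) + w)) =
    (fun h => f ((c *: x + w) + h *: v)) \o (fun h => c * h).
  apply/funext => h /=; congr f.
  by rewrite scalerDr scalerA addrAC.
rewrite mulrC; apply: is_derive1_comp.
  by apply/is_derive_lineP; rewrite mulr0 scale0r addr0.
apply: is_derive_eq; by rewrite /GRing.scale /= mulr1 ?mulr0 ?addr0.
Qed.

Lemma segment_increment f (df : R -> R) (x z : V) (M : R) :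
  (forall s : R, is_derive s 1 (fun h => f (x + h *: z)) (df s)) ->
  (forall s, 0 <= s <= 1 -> `|df s| <= M) -> `|f (x + z) - f x| <= M.
Proof.
move=> fd dfM.
have cf : {within `[0, 1], continuous (fun h => f (x + h *: z))}.
  apply: continuous_subspaceT => s; have [? _] := fd s.
  exact/differentiable_continuous/derivable1_diffP.
have [s] := MVT_segment ler01 (fun s _ => fd s) cf.
rewrite in_itv /= => s01; rewrite scale1r scale0r addr0 subr0 mulr1 => ->.
exact: dfM.
Qed.

End directional_derivative.

Section continuity.
Context {R : realType} {T : topologicalType}.
Implicit Types f g : T -> R.

Lemma continuous_add f g : continuous f -> continuous g -> continuous (fun x => f x + g x).
Proof. by move=> cf cg x; apply: cvgD; [exact: cf|exact: cg]. Qed.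

Lemma continuous_mul f g : continuous f -> continuous g -> continuous (fun x => f x * g x).
Proof. by move=> cf cg x; apply: cvgM; [exact: cf|exact: cg]. Qed.

End continuity.

(** * Fourier kernels of bump functions *)

Section bump.
Context {R : realType} {N : nat}.
Local Notation E := 'rV[R]_N.
Local Notation leb := (lebesgue_rV R N).
Implicit Types (f g m : E -> R) (x y z xi : E).
Local Notation e_ i := (delta_mx 0 i : E).

(** A coinduction principle: [smooth] quantifies over all iterated partial derivatives, and they all
    stay inside a class that is closed under differentiation. *)
Lemma smooth_class (P : (E -> R) -> Prop) :
  (forall f, P f -> continuous f /\
     forall i, (forall x, derivable f x (e_ i)) /\ P (partial i f)) ->
  forall f, P f -> smooth f.
Proof.
move=> H f Pf l i /=.
have Pg : P (foldr partial f l).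
  by elim: l => //= j l IH; have [_ /(_ j)[]] := H _ IH.
by have [? /(_ i)[]] := H _ Pg.
Qed.

Lemma smooth_partial f i : smooth f -> smooth (partial i f).
Proof.
move=> sf l j; have := sf (rcons l i) j.
by rewrite -cats1 foldr_cat.
Qed.

Lemma smooth_continuous f : smooth f -> continuous f.
Proof.
move=> sf.
(* In dimension 0 there is no index at which to read [smooth], but the space is a point. *)
have [n0|] := posnP N; last by move=> N0; have [] := sf [::] (Ordinal N0).
rewrite (_ : f = cst (f 0)); first exact: cst_continuous.
apply/funext => x; congr f; apply/rowP => -[j jN]; exfalso; move: jN.
by rewrite n0.
Qed.

Lemma smooth_derivable f i x : smooth f -> derivable f x (e_ i).
Proof. by move=> sf; have [_] := sf [::] i; apply. Qed.

Lemma smoothP f : smooth f -> continuous f /\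
     forall i, (forall x, derivable f x (e_ i)) /\ smooth (partial i f).
Proof.
move=> sf; split; first exact: smooth_continuous.
by move=> i; split => [x|]; [exact: smooth_derivable|exact: smooth_partial].
Qed.

Lemma continuous_affine (c : R) y : continuous (fun x : E => c *: x + y).
Proof.
move=> x; apply: continuousD; last exact: cst_continuous.
exact: scaler_continuous.
Qed.

Lemma smooth_affine f (c : R) y : smooth f -> smooth (fun x => f (c *: x + y)).
Proof.
(* The scalar factor makes the class stable under the chain rule. *)
move=> sf; apply: (@smooth_class
  (fun g => exists (a : R) f, smooth f /\ g = fun x => a * f (c *: x + y))); last first.
  by exists 1, f; split => //; apply/funext => x; rewrite mul1r.
move=> _ {f sf} [a [f [sf ->]]]; have [cf pf] := smoothP sf; split.
  apply: continuous_mul; first by move=> x; exact: cst_continuous.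
  by move=> x; apply: continuous_comp; [exact: continuous_affine|exact: cf].
move=> i; have [df spf] := pf i.
have H x : is_derive x (e_ i) (fun x => a * f (c *: x + y))
    ((a * c) * partial i f (c *: x + y)).
  rewrite -mulrA; apply: is_deriveZ.
  by apply: is_derive_affine; exact: derivableP.
split; first by move=> x; have [] := H x.
exists (a * c), (partial i f); split => //.
by apply/funext => x; have [_] := H x.
Qed.

Lemma is_derive_coord x (i k : 'I_N) : is_derive x (e_ i) (fun x => x 0 k) ((k == i)%:R : R).
Proof.
rewrite -[x in is_derive x](addr0 x) -(scale0r (e_ i)); apply/is_derive_lineP.
have -> : (fun h : R => (x + h *: e_ i) 0 k) = (fun h => x 0 k + h * (k == i)%:R).
  by apply/funext => h; rewrite !mxE eqxx.
apply: is_derive_eq; rewrite /GRing.scale /=; ring.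
Qed.

Lemma smooth_coordM f (k : 'I_N) : smooth f -> smooth (fun x => x 0 k * f x).
Proof.
(* The second summand [h] collects the terms that the product rule produces by differentiating the
   coordinate. *)
move=> sf; apply: (@smooth_class (fun g => exists f h, [/\ smooth f, smooth h &
    g = fun x => x 0 k * f x + h x])); last first.
  exists f, (fun=> 0); split; [exact: sf| |by apply/funext => x; rewrite addr0].
  apply: (@smooth_class (fun g => g = fun=> 0)) => // _ ->; split.
    exact: cst_continuous.
  move=> i; split; first by move=> x; exact: derivable_cst.
  by apply/funext => x; exact: derive_cst.
move=> _ {f sf} [f [h [sf sh ->]]].
have [cf pf] := smoothP sf; have [ch ph] := smoothP sh; split.
  apply: continuous_add => //.
  by apply: continuous_mul => // x; exact: coord_continuous.
move=> i; have [df spf] := pf i; have [dh sph] := ph i.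
have H x : is_derive x (e_ i) (fun x => x 0 k * f x + h x)
    (x 0 k * partial i f x + (partial i h x + (k == i)%:R * f x)).
  rewrite [_ + (k == i)%:R * _]addrC addrA; apply: is_deriveD; last exact: derivableP.
  apply: is_derive_eq.
    by apply: is_deriveM; [exact: is_derive_coord|exact: derivableP].
  by rewrite /GRing.scale /= (mulrC (f x)).
split; first by move=> x; have [] := H x.
exists (partial i f), (fun x => partial i h x + (k == i)%:R * f x); split.
- exact: spf.
- apply: (@smooth_class (fun g => exists (a : R) f h, [/\ smooth f, smooth h &
     g = fun x => h x + a * f x])); last by exists (k == i)%:R, f, (partial i h).
  move=> _ [a [f1 [h1 [sf1 sh1 ->]]]].
  have [cf1 pf1] := smoothP sf1; have [ch1 ph1] := smoothP sh1; split.
    apply: continuous_add => //.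
    by apply: continuous_mul => // x; exact: cst_continuous.
  move=> j; have [df1 spf1] := pf1 j; have [dh1 sph1] := ph1 j.
  have H1 x : is_derive x (e_ j) (fun x => h1 x + a * f1 x)
      (partial j h1 x + a * partial j f1 x).
    apply: is_deriveD; first exact: derivableP.
    by apply: is_deriveZ; exact: derivableP.
  split; first by move=> x; have [] := H1 x.
  exists a, (partial j f1), (partial j h1); split => //.
  by apply/funext => x; have [_] := H1 x.
- by apply/funext => x; have [_] := H x.
Qed.

(** Test functions; the boundedness of the support is expressed through [weight], which is
    continuous and fits the decay estimates. *)
Definition is_bump m := smooth m /\ exists C : R, forall x, m x != 0 -> weight x <= C.

(** Where [weight] exceeds the bound, [m] vanishes in a whole neighbourhood, so its derivatives
    vanish as well. *)
Lemma bump_partial m i : is_bump m -> is_bump (partial i m).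
Proof.
move=> [sm [C mC]]; split; first exact: smooth_partial.
exists C => x; apply: contraNle => Cx.
have : \forall y \near x, C < weight y.
  exact: (cvgr_gt (weight x) (@continuous_weight R N x)).
move=> nC; rewrite /partial.
have nm : \forall y \near x, m y = cst 0 y.
  near=> y; apply/eqP; apply: contraTT isT => my.
  have /mC : m y != 0 by [].
  move=> h; have : C < weight y by near: y.
  by rewrite ltNge h.
rewrite (near_eq_derive _ nm) ?derive_cst//.
Unshelve. all: end_near. Qed.

Lemma weight_scale (c : R) x : weight (c *: x) <= (1 + c ^+ 2) * weight x.
Proof.
rewrite !weightE.
have -> : \sum_(i < N) (c *: x) 0 i ^+ 2 = c ^+ 2 * \sum_(i < N) x 0 i ^+ 2.
  by rewrite mulr_sumr; apply: eq_bigr => i _; rewrite mxE exprMn.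
have a0 : 0 <= \sum_(i < N) x 0 i ^+ 2 by apply: sumr_ge0 => i _; exact: sqr_ge0.
have := sqr_ge0 c; nra.
Qed.

Lemma bump_affine m (c : R) y : c != 0 -> is_bump m -> is_bump (fun x => m (c *: x + y)).
Proof.
move=> c0 [sm [C mC]]; split; first exact: smooth_affine.
exists ((1 + c^-1 ^+ 2) * (2 * C * weight y)) => x /mC h.
have -> : x = c^-1 *: ((c *: x + y) - y) by rewrite addrK scalerA mulVf// scale1r.
apply: (le_trans (weight_scale _ _)); rewrite ler_pM2l ?ltr_pwDl ?sqr_ge0//.
apply: (le_trans (weight_sub_le _ _)).
by rewrite ler_pM2r ?weight_gt0// ler_pM2l.
Qed.

Lemma bump_coordM m k : is_bump m -> is_bump (fun x => x 0 k * m x).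
Proof.
move=> [sm [C mC]]; split; first exact: smooth_coordM.
by exists C => x; rewrite mulf_eq0 negb_or => /andP[_ /mC].
Qed.

Lemma bump_bounded m : is_bump m -> exists B : R, forall x, `|m x| <= B.
Proof.
move=> [sm [C mC]].
pose A := [set x : E | weight x <= C].
have cA : compact A.
  apply: (@subclosed_compact _ _ [set v : E | forall i, v ord0 i \in `[- `|C|, `|C|]]).
  - have cl : closed [set r : R | r <= C] by exact: closed_le.
    by apply: closed_comp cl => x _; exact: continuous_weight.
  - apply: (@rV_compact _ _ (fun=> `[- `|C|, `|C|]%classic)) => _.
    exact: segment_compact.
  - move=> x Ax i; rewrite in_itv /= -ler_norml.
    have := le_trans (sqr_coord_le_weight x i) Ax; rewrite -[x 0 i ^+ 2]real_normK ?num_real// => h.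
    have := ler_norm C; have := sqr_ge0 (`|x 0 i| - 1).
    have := normr_ge0 (x 0 i); nra.
have [M0 [_ MA]] := compact_bounded (continuous_compact
  (continuous_subspaceT (smooth_continuous sm)) cA).
exists (`|M0| + 1) => x; have [->|mx] := eqVneq (m x) 0.
  by rewrite normr0 addr_ge0.
apply: MA; first by rewrite (le_lt_trans (ler_norm _))// ltrDl.
by exists x => //; exact: mC.
Qed.

Lemma bump_le_weight m k : is_bump m -> exists B : R, forall x, `|m x| <= B * weight x ^- k.
Proof.
move=> bm; have [B mB] := bump_bounded bm; have [_ [C mC]] := bm.
have B0 : 0 <= B by exact: le_trans (mB 0).
exists (B * `|C| ^+ k) => x; have [->|mx] := eqVneq (m x) 0.
  by rewrite normr0 !mulr_ge0 ?invr_ge0 ?exprn_ge0 ?(ltW (weight_gt0 _)).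
apply: (le_trans (mB x)); rewrite -mulrA ler_peMr// ler_pdivlMr ?exprn_gt0 ?weight_gt0//.
rewrite mul1r lerXn2r ?nnegrE ?(ltW (weight_gt0 _))//.
by rewrite (le_trans (mC _ mx))// ler_norm.
Qed.

Lemma bump_measurable m : is_bump m -> measurable_fun setT (m : borel_rV R N -> R).
Proof. by move=> [/smooth_continuous/continuous_measurable_rV]. Qed.

Lemma integrable_le_weight (f : borel_rV R N -> R) B k : (N <= k)%N ->
  measurable_fun setT f -> (forall x, `|f x| <= B * weight x ^- k) ->
  leb.-integrable setT (EFin \o f).
Proof.
move=> Nk mf fB.
apply: (@le_integrable _ _ _ _ _ measurableT _
    (fun x : borel_rV R N => B%:E * (EFin \o (fun x : borel_rV R N => weight x ^- k)) x)%E).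
- exact/measurable_EFinP.
- by move=> x _ /=; rewrite lee_fin (le_trans (fB x))// ler_norm.
- by apply: integrableZl => //; exact: integrable_weightVX.
Qed.

Lemma bump_integrable m : is_bump m -> leb.-integrable setT (EFin \o (m : borel_rV R N -> R)).
Proof.
move=> bm; have [B mB] := bump_le_weight N bm.
exact: (integrable_le_weight (leqnn N) (bump_measurable bm) mB).
Qed.

Lemma measurable_cos_dotEr x :
  measurable_fun setT (fun y : borel_rV R N => cos (dotE x y)).
Proof. by under eq_fun do rewrite dotEC; exact: measurable_cos_dotE. Qed.

Lemma measurable_sin_dotEr x :
  measurable_fun setT (fun y : borel_rV R N => sin (dotE x y)).
Proof. by under eq_fun do rewrite dotEC; exact: measurable_sin_dotE. Qed.

Lemma integrable_cosM x f : leb.-integrable setT (EFin \o (f : borel_rV R N -> R)) ->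
  leb.-integrable setT (EFin \o (fun y : borel_rV R N => cos (dotE x y) * f y)).
Proof.
move=> fi; apply: (le_integrable measurableT _ _ fi).
  apply/measurable_EFinP; apply: measurable_funM; first exact: measurable_cos_dotEr.
  by apply/measurable_EFinP; exact: measurable_int fi.
by move=> y _ /=; rewrite lee_fin normrM ler_piMl// normr_cos_le1.
Qed.

Lemma integrable_sinM x f : leb.-integrable setT (EFin \o (f : borel_rV R N -> R)) ->
  leb.-integrable setT (EFin \o (fun y : borel_rV R N => sin (dotE x y) * f y)).
Proof.
move=> fi; apply: (le_integrable measurableT _ _ fi).
  apply/measurable_EFinP; apply: measurable_funM; first exact: measurable_sin_dotEr.
  by apply/measurable_EFinP; exact: measurable_int fi.
by move=> y _ /=; rewrite lee_fin normrM ler_piMl// normr_sin_le1.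
Qed.

Lemma dotEDr x y z : dotE x (y + z) = dotE x y + dotE x z.
Proof. by rewrite /dotE -big_split; apply: eq_bigr => i _; rewrite mxE mulrDr. Qed.

Lemma dotEDl x y z : dotE (x + y) z = dotE x z + dotE y z.
Proof. by rewrite !(dotEC _ z) dotEDr. Qed.

Lemma dotEZr (c : R) x y : dotE x (c *: y) = c * dotE x y.
Proof. by rewrite /dotE mulr_sumr; apply: eq_bigr => i _; rewrite mxE mulrCA. Qed.

Lemma dotEZl (c : R) x y : dotE (c *: x) y = c * dotE x y.
Proof. by rewrite !(dotEC _ y) dotEZr. Qed.

Lemma dotE_delta x i : dotE x (e_ i) = x 0 i.
Proof.
rewrite /dotE (bigD1 i)//= mxE !eqxx mulr1 big1 ?addr0// => j ji.
by rewrite mxE eqxx (negbTE ji) mulr0.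
Qed.

Lemma weight_delta i (s : R) : `|s| <= 1 -> weight (s *: e_ i) <= 2.
Proof.
move=> s1; rewrite weightE (bigD1 i)//= !mxE !eqxx mulr1 big1 ?addr0 => [|j ji].
  by have := ler_norml s 1; rewrite s1 => /esym/andP[]; nra.
by rewrite !mxE eqxx (negbTE ji) mulr0 expr0n.
Qed.

(* Translating in the direction e_i does not change an integral: differentiate
   at 0 under the integral. *)
Lemma integral_partial_eq0 f df i B C :
  (forall x, is_derive x (e_ i) f (df x)) -> continuous f -> continuous df ->
  (forall x, `|f x| <= B * weight x ^- N) ->
  (forall x, `|df x| <= C * weight x ^- N) ->
  \int[leb]_x df x = 0.
Proof.
move=> fd cf cdf fB dfC.
have fi : leb.-integrable setT (EFin \o (f : borel_rV R N -> R)).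
  exact: (integrable_le_weight (leqnn N) (continuous_measurable_rV cf) fB).
pose F (h : R) (x : borel_rV R N) : R := f (x + h *: e_ i).
have FE h x : F h x = f (1 *: x + h *: e_ i) by rewrite scale1r.
have Fi h : leb.-integrable setT (EFin \o F h).
  rewrite (_ : F h = fun x => f (1 *: x + h *: e_ i)); last by apply/funext => x; rewrite FE.
  exact: (integrable_affine_rV _ (oner_neq0 _) fi).
have Fint h : \int[leb]_x F h x = \int[leb]_x f x.
  under eq_Rintegral do rewrite FE.
  by rewrite (Rintegral_affine_rV _ (oner_neq0 _) fi) normr1 expr1n invr1 mul1r.
have dF (h : R) x : is_derive h 1 (F ^~ x) (df (x + h *: e_ i)).
  by apply/is_derive_lineP; exact: fd.
have C0 : 0 <= C.
  by have := le_trans (normr_ge0 _) (dfC 0); rewrite pmulr_lge0// invr_gt0 exprn_gt0// weight_gt0.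
(* For |h| <= 1, Peetre's inequality and [weight (h *: e_ i) <= 2] compare the weights at x and at
   the translated point, with a factor 4 for each power. *)
have G_ub (h : R) x : `]-1, 1[%classic h -> setT x ->
    `|partial1of2 F h x| <= C * 4 ^+ N * weight x ^- N.
  rewrite /= in_itv /= => h1 _; rewrite partial1of2E (@derive_val _ _ _ _ _ _ _ (dF h x)).
  apply: (le_trans (dfC _)); rewrite -mulrA ler_wpM2l//.
  rewrite ler_pdivlMr ?exprn_gt0 ?weight_gt0// mulrC ler_pdivrMr ?exprn_gt0 ?weight_gt0//.
  rewrite -exprMn lerXn2r ?nnegrE ?mulr_ge0 ?(ltW (weight_gt0 _))//.
  rewrite -[x in leLHS](addrK (h *: e_ i)) (le_trans (weight_sub_le _ _))//.
  have w2 : weight (h *: e_ i) <= 2.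
    by apply: weight_delta; case/andP: h1 => h1 h2; rewrite ler_norml !ltW.
  have := weight_gt0 (x + h *: e_ i); nra.
have I0 : `]-1, 1[%classic (0 : R) by rewrite /= in_itv /= ltrN10 ltr01.
have G0 x : 0 <= C * 4 ^+ N * weight x ^- N.
  by rewrite !mulr_ge0// invr_ge0 exprn_ge0// ltW// weight_gt0.
have Gi : leb.-integrable setT (EFin \o (fun x => C * 4 ^+ N * weight x ^- N)).
  apply: (@integrable_le_weight _ (C * 4 ^+ N) N) => // [|x]; last by rewrite ger0_norm.
  by apply: measurable_funM => //; exact: measurable_weightVX.
have D := @differentiation_under_integral R _ _ leb F setT measurableT 0 (-1) 1 I0
  (fun h _ => Fi h) (fun h x _ _ => @ex_derive _ _ _ _ _ _ _ (dF h x)) _ G0 Gi G_ub.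
transitivity (\int[leb]_y partial1of2 F 0 y).
  apply: eq_Rintegral => x _; rewrite partial1of2E (@derive_val _ _ _ _ _ _ _ (dF 0 x)).
  by rewrite scale0r addr0.
rewrite -D; suff -> : (fun x' : R => \int[leb]_y F x' y) = cst (\int[leb]_x f x).
  by rewrite derive1_cst.
by apply/funext => h; exact: Fint.
Qed.

End bump.

Lemma continuous_opp {R : realType} {T : topologicalType} (f : T -> R) :
  continuous f -> continuous (fun x => - f x).
Proof. by move=> cf x; apply: cvgN; exact: cf. Qed.

Section kernel.
Context {R : realType} {N : nat}.
Local Notation E := 'rV[R]_N.
Local Notation leb := (lebesgue_rV R N).
Implicit Types (f g m : E -> R) (x y z xi : E).
Local Notation e_ i := (delta_mx 0 i : E).
Local Notation kre := (@ifourier_re R N).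
Local Notation kim := (@ifourier_im R N).

Lemma continuous_cos_dotE x : continuous (fun y : E => cos (dotE x y)).
Proof.
move=> y; apply: (@continuous_comp _ _ _ (dotE x) cos); first exact: continuous_dotEr.
exact: continuous_cos.
Qed.

Lemma continuous_sin_dotE x : continuous (fun y : E => sin (dotE x y)).
Proof.
move=> y; apply: (@continuous_comp _ _ _ (dotE x) sin); first exact: continuous_dotEr.
exact: continuous_sin.
Qed.

Lemma is_derive_dotE x i y : is_derive y (e_ i) (dotE x) (x 0 i).
Proof.
rewrite -[y in is_derive y](addr0 y) -(scale0r (e_ i)); apply/is_derive_lineP.
have -> : (fun h : R => dotE x (y + h *: e_ i)) = (fun h => dotE x y + h * x 0 i).
  by apply/funext => h; rewrite dotEDr dotEZr dotE_delta.
by apply: is_derive_eq; rewrite /GRing.scale /=; ring.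
Qed.

Lemma is_derive_comp_rV (phi : R -> R) f (d : R) x v (df : R) :
  is_derive (f x) 1 phi d -> is_derive x v f df -> is_derive x v (phi \o f) (d * df).
Proof.
move=> dphi df'.
have L : is_derive (0 : R) 1 (fun h => f (x + h *: v)) df.
  by apply/is_derive_lineP; rewrite scale0r addr0.
have : is_derive (0 : R) 1 (phi \o (fun h => f (x + h *: v))) (d * df).
  by apply: is_derive1_comp; rewrite scale0r addr0.
by move=> /(is_derive_lineP (phi \o f)); rewrite scale0r addr0.
Qed.

(** Real and imaginary parts of x_i k = i k', where k and k' are the inverse Fourier transforms of
    [m] and of its i-th derivative. This is integration by parts: the derivative of e^(i x.y) m(y)
    in y_i has integral 0. *)
Lemma coordM_kre_kim m i x : is_bump m ->
  x 0 i * kre m x = - kim (partial i m) x /\ x 0 i * kim m x = kre (partial i m) x.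
Proof.
move=> bm; have bdm := bump_partial i bm; have [sm _] := bm; have [sdm _] := bdm.
have mi := bump_integrable bm; have dmi := bump_integrable bdm.
have [B mB] := bump_le_weight N bm; have [C mC] := bump_le_weight N bdm.
have dm y : is_derive y (e_ i) m (partial i m y).
  exact/derivableP/smooth_derivable.
have bnd (c s : R) y : `|c| <= 1 -> `|s| <= 1 ->
    `|x 0 i * c * m y + s * partial i m y| <= (`|x 0 i| * B + C) * weight y ^- N.
  move=> c1 s1; rewrite (le_trans (ler_normD _ _))// mulrDl lerD//.
    rewrite -mulrA normrM -mulrA ler_wpM2l// normrM (le_trans _ (mB y))// ler_piMl//.
  by rewrite normrM (le_trans _ (mC y))// ler_piMl.
split.
  have : \int[leb]_y (x 0 i * cos (dotE x y) * m y + sin (dotE x y) * partial i m y) = 0.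
    apply: (@integral_partial_eq0 _ _ (fun y => sin (dotE x y) * m y) _ i B
       (`|x 0 i| * B + C)).
    - move=> y.
      have ds := is_derive_comp_rV (is_derive_sin (dotE x y)) (is_derive_dotE x i y).
      apply: (is_derive_eq (is_deriveM ds (dm y))).
      by rewrite /GRing.scale /=; ring.
    - by apply: continuous_mul; [exact: continuous_sin_dotE|exact: smooth_continuous].
    - apply: continuous_add; apply: continuous_mul.
      + apply: continuous_mul; [exact: cst_continuous|exact: continuous_cos_dotE].
      + exact: smooth_continuous.
      + exact: continuous_sin_dotE.
      + exact: smooth_continuous.
    - by move=> y; rewrite normrM (le_trans _ (mB y))// ler_piMl// normr_sin_le1.
    - by move=> y; apply: bnd; rewrite ?normr_sin_le1 ?normr_cos_le1.
  under eq_Rintegral do rewrite -mulrA.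
  rewrite RintegralD//; last 2 first.
  - by apply: (integrableZl _ _ (integrable_cosM x mi)).
  - exact: integrable_sinM.
  rewrite RintegralZl//; last exact: integrable_cosM.
  rewrite /kre /kim mulrCA => /eqP; rewrite addr_eq0 => /eqP ->.
  by rewrite mulrN.
have : \int[leb]_y (x 0 i * - sin (dotE x y) * m y + cos (dotE x y) * partial i m y) = 0.
  apply: (@integral_partial_eq0 _ _ (fun y => cos (dotE x y) * m y) _ i B
     (`|x 0 i| * B + C)).
  - move=> y.
    have ds := is_derive_comp_rV (is_derive_cos (dotE x y)) (is_derive_dotE x i y).
    apply: (is_derive_eq (is_deriveM ds (dm y))).
    by rewrite /GRing.scale /=; ring.
  - by apply: continuous_mul; [exact: continuous_cos_dotE|exact: smooth_continuous].
  - apply: continuous_add; apply: continuous_mul.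
    + apply: continuous_mul; first exact: cst_continuous.
      by apply: continuous_opp; exact: continuous_sin_dotE.
    + exact: smooth_continuous.
    + exact: continuous_cos_dotE.
    + exact: smooth_continuous.
  - by move=> y; rewrite normrM (le_trans _ (mB y))// ler_piMl// normr_cos_le1.
  - by move=> y; apply: bnd; rewrite ?normrN ?normr_sin_le1 ?normr_cos_le1.
under eq_Rintegral do rewrite mulrN mulNr -mulrA -mulNr.
rewrite RintegralD//; last 2 first.
- by apply: (integrableZl _ _ (integrable_sinM x mi)).
- exact: integrable_cosM.
rewrite RintegralZl//; last exact: integrable_sinM.
rewrite /kre /kim mulrCA mulNr addrC => /eqP; rewrite subr_eq0 => /eqP ->.
by [].
Qed.

Lemma kernel_bounded m : is_bump m -> exists C : R, forall x, `|kre m x| <= C /\ `|kim m x| <= C.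
Proof.
move=> bm; have mi := bump_integrable bm.
have c0 : 0 <= (2 * pi : R) ^- N by rewrite invr_ge0 exprn_ge0// mulr_ge0// pi_ge0.
exists ((2 * pi) ^- N * \int[leb]_y `|m y|) => x.
have mi' : leb.-integrable setT (EFin \o (fun y : borel_rV R N => `|m y|)).
  exact: integrable_norm.
split; rewrite normrM ger0_norm// ler_wpM2l//.
  rewrite (le_trans (le_normr_Rintegral _ (integrable_cosM x mi)))//.
  apply: le_Rintegral => //.
    by apply: integrable_norm => //; exact: integrable_cosM.
  by move=> y _; rewrite normrM ler_piMl// normr_cos_le1.
rewrite (le_trans (le_normr_Rintegral _ (integrable_sinM x mi)))//.
apply: le_Rintegral => //.
  by apply: integrable_norm => //; exact: integrable_sinM.
by move=> y _; rewrite normrM ler_piMl// normr_sin_le1.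
Qed.

Lemma weightM_kre_kim m x : is_bump m ->
  weight x * kre m x = kre m x - \sum_(i < N) kre (partial i (partial i m)) x /\
  weight x * kim m x = kim m x - \sum_(i < N) kim (partial i (partial i m)) x.
Proof.
move=> bm; rewrite weightE !mulrDl !mul1r !mulr_suml -!sumrN.
split; congr (_ + _); apply: eq_bigr => i _; rewrite expr2 -mulrA.
  have [-> _] := coordM_kre_kim i x bm; rewrite mulrN.
  by have [_ ->] := coordM_kre_kim i x (bump_partial i bm).
have [_ ->] := coordM_kre_kim i x bm.
by have [-> _] := coordM_kre_kim i x (bump_partial i bm).
Qed.

(** Each power of the weight is traded for the identity minus the Laplacian on the side of the
    symbol, which produces bumps again, and kernels of bumps are bounded. *)
Lemma kernel_decay m k : is_bump m -> exists C : R, forall x,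
  `|kre m x| <= C * weight x ^- k /\ `|kim m x| <= C * weight x ^- k.
Proof.
elim: k m => [|k IH] m bm.
  have [C mC] := kernel_bounded bm; exists C => x.
  by rewrite expr0 invr1 mulr1.
have [C0 mC0] := IH m bm.
have /choice[C mC] := fun i => IH _ (bump_partial i (bump_partial i bm)).
exists (C0 + \sum_(i < N) C i) => x; have w0 := weight_gt0 x.
have [h1 h2] := weightM_kre_kim x bm.
have -> : (C0 + \sum_(i < N) C i) / weight x ^+ k.+1 =
    (weight x)^-1 * (C0 * weight x ^- k + \sum_(i < N) C i * weight x ^- k).
  by rewrite -mulr_suml -mulrDl exprSr invfM; ring.
rewrite !(mulrC (weight x)^-1) !ler_pdivlMr// -!(mulrC (weight x)).
rewrite -[X in X * `|kre m x|](gtr0_norm w0) -[X in X * `|kim m x|](gtr0_norm w0).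
rewrite -!normrM h1 h2; split; rewrite (le_trans (ler_normB _ _))// lerD//.
- by have [] := mC0 x.
- by rewrite (le_trans (ler_norm_sum _ _ _))//; apply: ler_sum => i _; have [] := mC i x.
- by have [] := mC0 x.
- by rewrite (le_trans (ler_norm_sum _ _ _))//; apply: ler_sum => i _; have [] := mC i x.
Qed.

Lemma Rintegral_sum (I : Type) (r : seq I) (F : I -> borel_rV R N -> R) :
  (forall i, leb.-integrable setT (EFin \o F i)) ->
  leb.-integrable setT (EFin \o (fun y => \sum_(i <- r) F i y)) /\
  \int[leb]_y (\sum_(i <- r) F i y) = \sum_(i <- r) \int[leb]_y F i y.
Proof.
move=> Fi; elim: r => [|a r [IH1 IH2]].
  rewrite big_nil; split.
    rewrite (_ : _ \o _ = cst 0%E); first exact: integrable0.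
    by apply/funext => y /=; rewrite big_nil.
  under eq_Rintegral do rewrite big_nil.
  by rewrite /Rintegral integral0.
have E : (EFin \o (fun y => \sum_(i <- a :: r) F i y)) =
    (fun y => ((EFin \o F a) y + (EFin \o (fun y => \sum_(i <- r) F i y)%R) y)%E).
  by apply/funext => y /=; rewrite big_cons EFinD.
split; first by rewrite E; exact: integrableD.
under eq_Rintegral do rewrite big_cons.
by rewrite RintegralD// IH2 big_cons.
Qed.

(** Differentiation under the integral brings down the factor [dotE z y]; the derivative is again a
    combination of kernels of bumps, those with the symbols y_i m(y). *)
Lemma is_derive_kernel m x z (s : R) : is_bump m ->
  is_derive s 1 (fun h => kre m (x + h *: z))
    (- \sum_(i < N) z 0 i * kim (fun y => y 0 i * m y) (x + s *: z)) /\
  is_derive s 1 (fun h => kim m (x + h *: z))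
    (\sum_(i < N) z 0 i * kre (fun y => y 0 i * m y) (x + s *: z)).
Proof.
move=> bm; have mi := bump_integrable bm; have mm := bump_measurable bm.
have bi i := bump_coordM i bm.
have E : (fun y : borel_rV R N => dotE z y * m y) =
    (fun y => \sum_(i < N) z 0 i * (y 0 i * m y)).
  by apply/funext => y; rewrite /dotE mulr_suml; apply: eq_bigr => i _; rewrite mulrA.
have zi : leb.-integrable setT (EFin \o (fun y : borel_rV R N => dotE z y * m y)).
  rewrite E; apply: (Rintegral_sum _ _).1 => i.
  by apply: (integrableZl _ _ (bump_integrable (bi i))).
have zi' := integrable_norm zi.
have Is : `]s - 1, s + 1[%classic s by rewrite /= in_itv /= ltrBlDr ltrDl ltr01.
have dl (h : R) y : is_derive h 1 (fun h : R => dotE (x + h *: z) y) (dotE z y).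
  under [X in is_derive _ _ X]funext => h' do rewrite dotEDl dotEZl.
  by apply: is_derive_eq; rewrite /GRing.scale /=; ring.
(* Both parts at once: [t] is [cos] or [sin], and [dt] its derivative. The majorant does not depend
   on the parameter h. *)
have key (t dt : R -> R) : (forall a : R, is_derive a 1 t (dt a)) ->
    (forall a, `|dt a| <= 1) ->
    (forall x f, leb.-integrable setT (EFin \o (f : borel_rV R N -> R)) ->
      leb.-integrable setT (EFin \o (fun y : borel_rV R N => t (dotE x y) * f y))) ->
    is_derive s 1 (fun h => (2 * pi) ^- N * \int[leb]_y (t (dotE (x + h *: z) y) * m y))
     ((2 * pi) ^- N * \int[leb]_y (dt (dotE (x + s *: z) y) * (dotE z y * m y))).
  move=> td dt1 ti.
  pose F (h : R) (y : borel_rV R N) := t (dotE (x + h *: z) y) * m y.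
  have dF (h : R) y : is_derive h 1 (F ^~ y) (dt (dotE (x + h *: z) y) * (dotE z y * m y)).
    have d1 := is_derive1_comp (td _) (dl h y).
    have := is_deriveM d1 (is_derive_cst (m y) h 1).
    by move=> H; apply: (is_derive_eq H); rewrite /GRing.scale /=; ring.
  have G_ub (h : R) y : `]s - 1, s + 1[%classic h -> setT y ->
      `|partial1of2 F h y| <= `|dotE z y * m y|.
    by move=> _ _; rewrite partial1of2E (@derive_val _ _ _ _ _ _ _ (dF h y)) normrM ler_piMl.
  have D := @differentiation_under_integral R _ _ leb F setT measurableT s _ _ Is
    (fun h _ => ti _ _ mi) (fun h x _ _ => @ex_derive _ _ _ _ _ _ _ (dF h x)) _
    (fun y => normr_ge0 _) zi' G_ub.
  have D' := @derivable_under_integral R _ _ leb F setT measurableT s _ _ Is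
    (fun h _ => ti _ _ mi) (fun h x _ _ => @ex_derive _ _ _ _ _ _ _ (dF h x)) _
    (fun y => normr_ge0 _) zi' G_ub.
  rewrite derive1E in D.
  have H : is_derive s 1 (fun h => \int[leb]_y F h y)
      (\int[leb]_y (dt (dotE (x + s *: z) y) * (dotE z y * m y))).
    split; first exact: D'.
    rewrite D; apply: eq_Rintegral => y _.
    by rewrite partial1of2E (@derive_val _ _ _ _ _ _ _ (dF s y)).
  exact: is_deriveZ.
have val (t : R -> R) :
    (forall x f, leb.-integrable setT (EFin \o (f : borel_rV R N -> R)) ->
      leb.-integrable setT (EFin \o (fun y : borel_rV R N => t (dotE x y) * f y))) ->
    \int[leb]_y (t (dotE (x + s *: z) y) * (dotE z y * m y)) =
    \sum_(i < N) z 0 i * \int[leb]_y (t (dotE (x + s *: z) y) * (y 0 i * m y)).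
  move=> ti; have tmi i := ti (x + s *: z) _ (bump_integrable (bi i)).
  transitivity (\int[leb]_y (\sum_(i < N) z 0 i * (t (dotE (x + s *: z) y) * (y 0 i * m y)))).
    apply: eq_Rintegral => y _; rewrite /dotE -/(dotE _ y) mulr_suml mulr_sumr.
    by apply: eq_bigr => i _; ring.
  rewrite (Rintegral_sum _ _).2; last by move=> i; apply: (integrableZl _ _ (tmi i)).
  by apply: eq_bigr => i _; rewrite RintegralZl//; exact: tmi.
split.
  have H := key cos (fun a => - sin a) (fun a => is_derive_cos a) _ integrable_cosM.
  apply: (is_derive_eq (H _)); first by move=> a; rewrite normrN normr_sin_le1.
  transitivity (- ((2 * pi) ^- N * \int[leb]_y (sin (dotE (x + s *: z) y) * (dotE z y * m y)))).
    rewrite -mulrN; congr (_ * _); rewrite -mulN1r -RintegralZl//; last exact: (integrable_sinM _ zi).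
    by apply: eq_Rintegral => y _; rewrite mulNr mulN1r.
  rewrite (val sin integrable_sinM) mulr_sumr; congr (- _).
  by apply: eq_bigr => i _; rewrite mulrCA.
have H := key sin cos (fun a => is_derive_sin a) _ integrable_sinM.
apply: (is_derive_eq (H _)); first by move=> a; rewrite normr_cos_le1.
rewrite (val cos integrable_cosM) mulr_sumr.
by apply: eq_bigr => i _; rewrite mulrCA.
Qed.

(** The norm that goes with the increment formula: a directional derivative along z is the sum of
    the z_i times partial derivatives. *)
Definition l1 z : R := \sum_(i < N) `|z 0 i|.

Lemma l1_ge0 z : 0 <= l1 z.
Proof. exact: sumr_ge0. Qed.

Lemma l1Z (c : R) z : l1 (c *: z) = `|c| * l1 z.
Proof. by rewrite /l1 mulr_sumr; apply: eq_bigr => i _; rewrite mxE normrM. Qed.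

Lemma weight_le_l1 z : weight z <= (1 + l1 z) ^+ 2.
Proof.
have c0 i : `|z 0 i| <= l1 z by rewrite /l1 (bigD1 i)//= lerDl sumr_ge0.
have h : \sum_(i < N) z 0 i ^+ 2 <= l1 z * l1 z.
  rewrite [in leRHS]/l1 mulr_suml; apply: ler_sum => i _.
  by rewrite -real_normK ?num_real// expr2 ler_wpM2l.
by rewrite weightE; have := l1_ge0 z; nra.
Qed.

(** Mean value theorem on the segment from x to x + z. Since [weight (s *: z) <= 4], Peetre's
    inequality compares the weights along the segment up to the factor 8. *)
Lemma kernel_increment m k : is_bump m -> exists C : R, 0 <= C /\ forall x z, l1 z <= 1 ->
  `|kre m (x + z) - kre m x| <= C * l1 z * weight x ^- k /\
  `|kim m (x + z) - kim m x| <= C * l1 z * weight x ^- k.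
Proof.
move=> bm; have /choice[D mD] := fun i => kernel_decay k (bump_coordM i bm).
have D0 i : 0 <= D i.
  have [h _] := mD i 0; have := le_trans (normr_ge0 _) h.
  by rewrite pmulr_lge0// invr_gt0 exprn_gt0// weight_gt0.
pose C := (\sum_(i < N) D i) * 8 ^+ k.
have C0 : 0 <= C by rewrite mulr_ge0// sumr_ge0.
exists C; split => // x z z1.
have wx (s : R) : 0 <= s <= 1 -> weight (x + s *: z) ^- k <= 8 ^+ k * weight x ^- k.
  move=> /andP[s0 s1]; rewrite ler_pdivlMr ?exprn_gt0 ?weight_gt0// mulrC.
  rewrite ler_pdivrMr ?exprn_gt0 ?weight_gt0// -exprMn lerXn2r ?nnegrE ?mulr_ge0 ?(ltW (weight_gt0 _))//.
  rewrite -[x in leLHS](addrK (s *: z)) (le_trans (weight_sub_le _ _))//.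
  have h : l1 (s *: z) <= 1 by rewrite l1Z ger0_norm// mulr_ile1// l1_ge0.
  have w4 : weight (s *: z) <= 4.
    apply: (le_trans (weight_le_l1 _)); have := l1_ge0 (s *: z); nra.
  have := weight_gt0 (x + s *: z); nra.
have bnd (K : 'I_N -> E -> R) (s : R) : 0 <= s <= 1 ->
    (forall i y, `|K i y| <= D i * weight y ^- k) ->
    `|\sum_(i < N) z 0 i * K i (x + s *: z)| <= C * l1 z * weight x ^- k.
  move=> s01 KD; apply: (le_trans (ler_norm_sum _ _ _)).
  apply: (@le_trans _ _ (\sum_(i < N) `|z 0 i| * (C * weight x ^- k))); last first.
    by rewrite -mulr_suml -/(l1 z) mulrCA mulrA.
  apply: ler_sum => i _; rewrite normrM ler_wpM2l// (le_trans (KD i _))// /C -mulrA.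
  apply: ler_pM => //; last exact: wx.
    by rewrite invr_ge0 exprn_ge0// ltW// weight_gt0.
  by rewrite (bigD1 i)//= lerDl sumr_ge0.
split.
  apply: (@segment_increment _ _ (kre m) _ x z _ (fun s => (is_derive_kernel x z s bm).1)).
  move=> s s01; rewrite normrN; apply: (bnd (fun i => kim (fun y => y 0 i * m y))) => // i y.
  by have [] := mD i y.
apply: (@segment_increment _ _ (kim m) _ x z _ (fun s => (is_derive_kernel x z s bm).2)).
move=> s s01; apply: (bnd (fun i => kre (fun y => y 0 i * m y))) => // i y.
by have [] := mD i y.
Qed.

Lemma continuous_of_increment f (C : R) :
  (forall x z, l1 z <= 1 -> `|f (x + z) - f x| <= C * l1 z) -> continuous f.
Proof.
move=> fC x A /nbhs_ballP[e /= e0 eA]; apply/nbhs_ballP.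
(* Balls are those of the sup norm and [l1] is at most N times that norm; N + 1 also avoids a
   division by 0 in dimension 0. *)
pose d : R := Num.min 1 (e / (`|C| + 1)) / N.+1%:R.
have C1 : 0 < `|C| + 1 by rewrite ltr_pwDr.
have d0 : 0 < d by rewrite divr_gt0// lt_min ltr01 divr_gt0.
exists d => //= y [_ xy]; apply: eA; rewrite /ball /= distrC.
have h : l1 (y - x) <= Num.min 1 (e / (`|C| + 1)).
  apply: (@le_trans _ _ (\sum_(i < N) d)).
    by apply: ler_sum => i _; rewrite !mxE distrC ltW//; exact: xy.
  rewrite sumr_const card_ord -[d *+ N]mulr_natr /d -mulrA ler_piMr//.
    by rewrite le_min ler01 divr_ge0// ltW.
  by rewrite ler_pdivrMl// mulr1 ler_nat.
move: h; rewrite le_min => /andP[h1 h2].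
have -> : f y - f x = f (x + (y - x)) - f x by rewrite (addrC x) subrK.
rewrite (le_lt_trans (fC _ _ h1))// (@le_lt_trans _ _ (`|C| * (e / (`|C| + 1))))//.
  by rewrite (@le_trans _ _ (`|C| * l1 (y - x)))// ?ler_wpM2r ?ler_norm ?l1_ge0// ler_wpM2l.
by rewrite mulrA ltr_pdivrMr// mulrC ltr_pM2l// ltrDl.
Qed.

Lemma continuous_kernel m : is_bump m -> continuous (kre m) /\ continuous (kim m).
Proof.
move=> bm; have [C [_ mC]] := kernel_increment 0 bm.
split; apply: (@continuous_of_increment _ C) => x z /(mC x z)[]; rewrite expr0 invr1 mulr1//.
Qed.

End kernel.

Lemma dominated_cvg_Rintegral d (T : measurableType d) (R : realType)
    (mu : {measure set T -> \bar R}) (f_ : nat -> T -> R) (f g : T -> R) :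
  (forall n, measurable_fun setT (f_ n)) ->
  (forall x, f_ n x @[n --> \oo] --> f x) ->
  mu.-integrable setT (EFin \o g) -> (forall n x, `|f_ n x| <= g x) ->
  mu.-integrable setT (EFin \o f) /\
  \int[mu]_x f_ n x @[n --> \oo] --> \int[mu]_x f x.
Proof.
move=> mf_ f_f ig fg.
have mF n : measurable_fun setT (EFin \o f_ n) by exact/measurable_EFinP.
have cF x : setT x -> (fun n => (EFin \o f_ n) x) @ \oo --> (EFin \o f) x.
  by move=> _; apply: cvg_EFin; [exact: nearW|exact: f_f].
have fg' n x : setT x -> (`|(EFin \o f_ n) x| <= (EFin \o g) x)%E.
  by move=> _; rewrite /= lee_fin.
have mf : measurable_fun setT (EFin \o f) := emeasurable_fun_cvg _ _ mF cF.
have fi n : mu.-integrable setT (EFin \o f_ n).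
  apply: (le_integrable measurableT (mF n) _ ig) => x _.
  by rewrite (le_trans (fg' n x I))//= lee_fin ler_norm.
have [i _ c] := @dominated_convergence _ _ _ mu _ measurableT _ _ _ mF mf
  (aeW _ cF) ig (aeW _ (fun x n => fg' n x)).
split => //; have E : (\int[mu]_x (EFin \o f) x = (\int[mu]_x f x)%:E)%E.
  by rewrite /Rintegral fineK//; exact: integrable_fin_num i.
by rewrite E in c; exact: (fine_cvg c).
Qed.

Section fubini_rV.
Context {R : realType} {N : nat}.
Local Notation leb := (lebesgue_rV R N).

(** All sections, in both directions, are assumed integrable so that [fine] can be removed from both
    inner integrals. *)
Lemma fubini_Rintegral (F : borel_rV R N -> borel_rV R N -> R) :
  measurable_fun setT (fun z => F z.1 z.2) ->
  (\int[leb]_x \int[leb]_y `|F x y|%:E < +oo)%E ->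
  (forall x, leb.-integrable setT (EFin \o F x)) ->
  (forall y, leb.-integrable setT (EFin \o (F ^~ y))) ->
  \int[leb]_x \int[leb]_y F x y = \int[leb]_y \int[leb]_x F x y.
Proof.
move=> mF iF iFx iFy.
have pF : (leb \x leb)%E.-integrable setT (fun z => (F z.1 z.2)%:E).
  by apply/integrable12ltyP => //; exact/measurable_EFinP.
have := Fubini pF.
rewrite /Rintegral => H; congr fine.
transitivity (\int[leb]_x \int[leb]_y (F x y)%:E)%E.
  by apply: eq_integral => x _; rewrite fineK//; exact: integrable_fin_num (iFx x).
rewrite H; apply: eq_integral => y _; rewrite fineK//; exact: integrable_fin_num (iFy y).
Qed.

Lemma fubini_Rintegral_dom (F : borel_rV R N -> borel_rV R N -> R) (G H : borel_rV R N -> R) :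
  measurable_fun setT (fun z => F z.1 z.2) ->
  leb.-integrable setT (EFin \o G) -> leb.-integrable setT (EFin \o H) ->
  (forall x, 0 <= G x) -> (forall y, 0 <= H y) ->
  (forall x y, `|F x y| <= G x * H y) ->
  \int[leb]_x \int[leb]_y F x y = \int[leb]_y \int[leb]_x F x y.
Proof.
move=> mF iG iH G0 H0 FGH.
have mG : measurable_fun setT (fun x => (G x)%:E) := measurable_int _ iG.
have mH : measurable_fun setT (fun x => (H x)%:E) := measurable_int _ iH.
have m1 x : measurable_fun setT (F x).
  exact: (measurableT_comp mF (measurable_pair1 x)).
have m2 y : measurable_fun setT (F ^~ y).
  exact: (measurableT_comp mF (pair2_measurable y)).
apply: fubini_Rintegral => //.
- apply: (@le_lt_trans _ _ (\int[leb]_x ((G x)%:E * \int[leb]_y (H y)%:E))%E).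
    apply: ge0_le_integral => //.
    + by move=> x _; apply: integral_ge0 => y _; rewrite lee_fin.
    + apply: (measurable_fun_fubini_tonelli_F (fun z => `|F z.1 z.2|%:E)) => //.
      by apply/measurable_EFinP; exact: measurableT_comp.
    + exact: emeasurable_funM.
    + move=> x _; rewrite -ge0_integralZl//; [|by move=> y _; rewrite lee_fin|by rewrite lee_fin].
      apply: ge0_le_integral => //.
      * by apply/measurable_EFinP; exact: measurableT_comp.
      * exact: emeasurable_funM.
      * by move=> y _; rewrite -EFinM lee_fin.
  rewrite ge0_integralZr//; last 2 first.
  - by move=> x _; rewrite lee_fin.
  - by apply: integral_ge0 => y _; rewrite lee_fin.
  have [gG gH] := (integrable_fin_num measurableT iG, integrable_fin_num measurableT iH).
  by rewrite -(fineK gG) -(fineK gH) -EFinM ltry.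
- move=> x; apply: (le_integrable measurableT _ _ (integrableZl measurableT (G x) iH)).
    exact/measurable_EFinP.
  by move=> y _ /=; rewrite lee_fin (le_trans (FGH x y))// ler_norm.
- move=> y; apply: (le_integrable measurableT _ _ (integrableZr measurableT (H y) iG)).
    exact/measurable_EFinP.
  by move=> x _ /=; rewrite lee_fin (le_trans (FGH x y))// ler_norm.
Qed.

End fubini_rV.

(** * Fourier inversion and convolution of kernels *)

Section inversion.
Context {R : realType} {N : nat}.
Local Notation E := 'rV[R]_N.
Local Notation leb := (lebesgue_rV R N).
Implicit Types (f g m : E -> R) (x y z xi : E).
Local Notation kre := (@ifourier_re R N).
Local Notation kim := (@ifourier_im R N).

(* The total integral of the kernel is computed by exp_kernel summability: both
   sides are limits, as c tends to 0, of the integral of kre m y * exp_kernel (c y),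
   the right-hand one after exchanging integrals and rescaling. *)
Lemma fourier_inversion0 m : is_bump m ->
  \int[leb]_y kre m y = m 0 /\ \int[leb]_y kim m y = 0.
Proof.
move=> bm; have mi := bump_integrable bm; have mm := bump_measurable bm.
have [cr ci] := continuous_kernel bm.
have [C mC] := kernel_decay N bm.
have ri : leb.-integrable setT (EFin \o (kre m : borel_rV R N -> R)).
  apply: (@integrable_le_weight _ _ _ C _ (leqnn N) (continuous_measurable_rV cr)) => x.
  by have [] := mC x.
have ii : leb.-integrable setT (EFin \o (kim m : borel_rV R N -> R)).
  apply: (@integrable_le_weight _ _ _ C _ (leqnn N) (continuous_measurable_rV ci)) => x.
  by have [] := mC x.
split; last first.
  (* The imaginary part of the kernel is an odd function. *)
  have N1 : -1 != 0 :> R by rewrite oppr_eq0 oner_eq0.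
  have := Rintegral_affine_rV 0 N1 ii; rewrite normrN1 expr1n invr1 mul1r.
  have kN y : kim m (-1 *: y + 0) = -1 * kim m y.
    rewrite /kim [RHS]mulrCA; congr (_ * _); rewrite -RintegralZl//; last exact: (integrable_sinM _ mi).
    by apply: eq_Rintegral => x _; rewrite addr0 dotEZl mulN1r sinN mulN1r mulNr.
  under eq_Rintegral do rewrite kN.
  by rewrite RintegralZl//; lra.
pose c n : R := n.+1%:R^-1.
have c0 n : 0 < c n by rewrite invr_gt0.
have P1 (y : borel_rV R N) : `|exp_kernel y| <= 1.
  by rewrite ger0_norm ?exp_kernel_le1// ltW// exp_kernel_gt0.
have mP n : measurable_fun setT (fun y : borel_rV R N => exp_kernel (c n *: y : borel_rV R N)).
  have := measurableT_comp (@measurable_exp_kernel R N) (measurable_affine_rV (c n) 0).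
  by under [X in measurable_fun _ X -> _]funext => y do rewrite /= addr0.
have iP n : leb.-integrable setT (EFin \o (fun y : borel_rV R N => exp_kernel (c n *: y : borel_rV R N))).
  have := integrable_affine_rV 0 (lt0r_neq0 (c0 n)) (integrable_exp_kernel N).
  by under [X in _.-integrable _ X -> _]funext => y do rewrite /= addr0.
have c_cvg : c @ \oo --> 0 by exact: cvg_harmonic.
have cvgc (f : R -> R) : continuous f -> (fun n => f (c n)) @ \oo --> f 0.
  by move=> cf; apply: (cvg_comp _ _ c_cvg); exact: cf.
have L1 : (fun n => \int[leb]_y (kre m y * exp_kernel (c n *: y))) @ \oo -->
    \int[leb]_y kre m y.
  refine (proj2 (@dominated_cvg_Rintegral _ _ R leb
    (fun k (y : borel_rV R N) => kre m y * exp_kernel (c k *: y : borel_rV R N))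
    (kre m) (fun y => `|kre m y|) _ _ _ _)).
  - by move=> n; apply: measurable_funM => //; exact: continuous_measurable_rV.
  - move=> y; rewrite -[X in _ --> X]mulr1; apply: cvgM; first exact: cvg_cst.
    have := cvgc (fun s => exp_kernel (s *: y : borel_rV R N)).
    rewrite scale0r (_ : exp_kernel (0 : borel_rV R N) = 1); last first.
      by rewrite /exp_kernel big1// => i _; rewrite mxE normr0 oppr0 expR0.
    apply; rewrite /exp_kernel; elim: (index_enum _) => [|i s IH].
      by under eq_fun do rewrite big_nil; move=> t; exact: cvg_cst.
    under eq_fun do rewrite big_cons; apply: continuous_mul => // t.
    under eq_fun do rewrite mxE.
    apply: (@continuous_comp _ _ _ (fun s : R => s * y 0 i) (fun u : R => expR (- `|u|))).
      by apply: cvgM; [exact: cvg_id|exact: cvg_cst].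
    exact: continuous_expRN_norm.
  - exact: (integrable_norm ri).
  - by move=> n y; rewrite normrM ler_piMr.
(* The Fourier transform of [exp_kernel]. Its integral (2 pi)^N cancels the normalisation of the
   inverse transform. *)
pose h (x : borel_rV R N) : R := \prod_(i < N) (2 / (1 + x 0 i ^+ 2)).
have h0 x : 0 <= h x.
  by apply: prodr_ge0 => i _; rewrite divr_ge0// addr_ge0// sqr_ge0.
have mh1 : measurable_fun setT (fun s : R => 2 / (1 + s ^+ 2)).
  apply: measurable_funM => //.
  by apply: continuous_measurable_fun; exact: continuous_inv_1sqr.
have mh : measurable_fun setT h.
  apply: measurable_prod => i _.
  exact: (measurableT_comp mh1 (measurable_coord i)).
have hint : (\int[leb]_x (h x)%:E = ((2 * pi) ^+ N)%:E)%E.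
  rewrite (@integral_rV_prod R N (fun s => 2 / (1 + s ^+ 2)))//; last first.
    by move=> s; rewrite divr_ge0// addr_ge0// sqr_ge0.
  rewrite EFin_expe; congr (_ ^+ _)%E.
  under eq_integral do rewrite EFinM.
  rewrite ge0_integralZl//; first by rewrite integral_inv_1sqr -EFinM.
    by apply/measurable_EFinP; apply: continuous_measurable_fun; exact: continuous_inv_1sqr.
  by move=> s _; rewrite lee_fin invr_ge0 addr_ge0// sqr_ge0.
have hi : leb.-integrable setT (EFin \o h).
  apply/integrableP; split; first exact/measurable_EFinP.
  by under eq_integral => x _ do rewrite /= ger0_norm//; rewrite hint ltry.
have [B mB] := bump_bounded bm.
have B0 : 0 <= B by exact: le_trans (mB 0).
have pi0 : (2 * pi) ^+ N != 0 :> R by rewrite expf_neq0// mulf_neq0// gt_eqF// pi_gt0.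
have mscale (t : R) : continuous (fun x : E => m (t *: x)).
  move=> x; apply: (@continuous_comp _ _ _ (fun x : E => t *: x) m).
    exact: scaler_continuous.
  by apply: smooth_continuous; case: bm.
have gi t : leb.-integrable setT (EFin \o (fun x : borel_rV R N => m (t *: x) * h x)).
  apply: (le_integrable measurableT _ _ (integrableZl measurableT B hi)).
    apply/measurable_EFinP; apply: measurable_funM => //.
    exact: continuous_measurable_rV.
  by move=> x _ /=; rewrite lee_fin normrM (le_trans _ (ler_norm _))// (ger0_norm (h0 x)) ler_wpM2r.
have L2 k : \int[leb]_y (kre m y * exp_kernel (c k *: y)) =
    (2 * pi) ^- N * \int[leb]_x (m (c k *: x) * h x).
  pose F (y x : borel_rV R N) := exp_kernel (c k *: y : borel_rV R N) * (cos (dotE y x) * m x).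
  have KE y : \int[leb]_x F y x = (2 * pi) ^+ N * (kre m y * exp_kernel (c k *: y)).
    rewrite /F RintegralZl//; last exact: integrable_cosM.
    by rewrite /ifourier_re; set D := (2 * pi) ^+ N; field.
  have iKP : leb.-integrable setT (EFin \o (fun y => kre m y * exp_kernel (c k *: y))).
    apply: (le_integrable measurableT _ _ ri).
      apply/measurable_EFinP; apply: measurable_funM => //.
      exact: continuous_measurable_rV.
    by move=> y _ /=; rewrite lee_fin normrM ler_piMr.
  transitivity ((2 * pi) ^- N * \int[leb]_y \int[leb]_x F y x).
    under [in RHS]eq_Rintegral do rewrite KE.
    by rewrite RintegralZl// mulrA mulVf// mul1r.
  congr (_ * _).
  rewrite (@fubini_Rintegral_dom _ _ F (fun y => exp_kernel (c k *: y : borel_rV R N)) (fun x => `|m x|))//; first last.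
  - move=> y x; rewrite /F normrM gtr0_norm ?exp_kernel_gt0// ler_wpM2l ?(ltW (exp_kernel_gt0 _))//.
    by rewrite normrM ler_piMl// normr_cos_le1.
  - by move=> y; rewrite ltW// exp_kernel_gt0.
  - exact: (integrable_norm mi).
  - apply: measurable_funM; first exact: (measurableT_comp (mP k) measurable_fst).
    apply: measurable_funM; last exact: (measurableT_comp mm measurable_snd).
    apply: (measurableT_comp _ (@measurable_dotE R N)).
    by apply: continuous_measurable_fun; exact: continuous_cos.
  transitivity (\int[leb]_x (c k ^- N * (m (c k *: ((c k)^-1 *: x + 0)) * h ((c k)^-1 *: x + 0)))).
    apply: eq_Rintegral => x _.
    have -> : c k *: ((c k)^-1 *: x + 0) = x.
      by rewrite addr0 scalerA mulfV ?scale1r// lt0r_neq0.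
    have ic : leb.-integrable setT (EFin \o (fun y : borel_rV R N => exp_kernel y * cos (dotE y ((c k)^-1 *: x)))).
      apply: integrable_exp_kernelM; [exact: measurable_cos_dotE|by move=> y; exact: normr_cos_le1].
    transitivity (\int[leb]_y (m x * (exp_kernel (c k *: y + 0 : borel_rV R N) *
        cos (dotE (c k *: y + 0) ((c k)^-1 *: x))))).
      apply: eq_Rintegral => y _; rewrite /F addr0 dotEZl dotEZr (mulrA (c k)) mulfV ?mul1r ?lt0r_neq0//.
      by ring.
    rewrite RintegralZl//; last exact: (integrable_affine_rV 0 (lt0r_neq0 (c0 k)) ic).
    rewrite (Rintegral_affine_rV 0 (lt0r_neq0 (c0 k)) ic) (fourier_exp_kernel _).1 gtr0_norm//.
    by rewrite mulrCA /h addr0.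
  have ck0 : (c k)^-1 != 0 by rewrite invr_eq0 lt0r_neq0.
  rewrite RintegralZl//; last exact: (integrable_affine_rV 0 ck0 (gi (c k))).
  rewrite (Rintegral_affine_rV 0 ck0 (gi (c k))) gtr0_norm ?invr_gt0//.
  have A0 : c k ^+ N != 0 by rewrite expf_neq0// lt0r_neq0.
  have -> : ((c k)^-1 ^+ N)^-1 = c k ^+ N by rewrite exprVn invrK.
  by rewrite mulKf.
have L3 : (fun n => \int[leb]_y (kre m y * exp_kernel (c n *: y))) @ \oo --> m 0.
  under eq_fun do rewrite L2.
  have -> : m 0 = (2 * pi) ^- N * \int[leb]_x (m 0 * h x).
    by rewrite RintegralZl// [X in _ * (_ * X)]/Rintegral hint /= mulrCA mulVf// mulr1.
  apply: cvgM; first exact: cvg_cst.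
  refine (proj2 (@dominated_cvg_Rintegral _ _ R leb
    (fun k (x : borel_rV R N) => m (c k *: x) * h x) (fun x => m 0 * h x) (fun x => B * h x) _ _ _ _)).
  - by move=> k; apply: measurable_funM => //; exact: continuous_measurable_rV.
  - move=> x; apply: cvgM; last exact: cvg_cst.
    have := cvgc (fun t => m (t *: x)); rewrite scale0r; apply => t.
    apply: (@continuous_comp _ _ _ (fun t : R => t *: x) m).
      exact: scalel_continuous.
    by apply: smooth_continuous; case: bm.
  - exact: (integrableZl measurableT B hi).
  - by move=> k x; rewrite normrM (ger0_norm (h0 x)) ler_wpM2r.
by apply: (cvg_unique _ L1 L3).
Qed.

End inversion.

Section convolution_theorem.
Context {R : realType} {N : nat}.
Local Notation E := 'rV[R]_N.
Local Notation leb := (lebesgue_rV R N).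
Implicit Types (f g m : E -> R) (x y z xi : E).
Local Notation kre := (@ifourier_re R N).
Local Notation kim := (@ifourier_im R N).

Definition convolve (K f : E -> R) x : R := \int[leb]_y (K y * f (x - y)).

(** What a Schwartz kernel contributes to convolution estimates: continuity and decay faster than
    every power. *)
Definition rapid (K : E -> R) := continuous K /\
  forall k, exists C : R, forall x, `|K x| <= C * weight x ^- k.

Lemma rapid_kernel m : is_bump m -> rapid (kre m) /\ rapid (kim m).
Proof.
move=> bm; have [cr ci] := continuous_kernel bm.
split; split => // k; have [C mC] := kernel_decay k bm; exists C => x; by have [] := mC x.
Qed.

Lemma rapid_measurable (K : E -> R) : rapid K -> measurable_fun setT (K : borel_rV R N -> R).
Proof. by move=> [/continuous_measurable_rV]. Qed.

Lemma rapid_integrable (K : E -> R) : rapid K -> leb.-integrable setT (EFin \o (K : borel_rV R N -> R)).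
Proof.
move=> rK; have [_ /(_ N)[C KC]] := rK.
exact: (integrable_le_weight (leqnn N) (rapid_measurable rK) KC).
Qed.

Lemma rapid_bounded (K : E -> R) : rapid K -> exists C : R, forall x, `|K x| <= C.
Proof.
by move=> [_ /(_ 0)[C KC]]; exists C => x; have := KC x; rewrite expr0 invr1 mulr1.
Qed.

Lemma integrable_shift x f : leb.-integrable setT (EFin \o (f : borel_rV R N -> R)) ->
  leb.-integrable setT (EFin \o (fun y : borel_rV R N => f (x - y))).
Proof.
have N1 : -1 != 0 :> R by rewrite oppr_eq0 oner_eq0.
move=> /(integrable_affine_rV x N1).
by under [X in _.-integrable _ X -> _]funext => y do rewrite /= scaleN1r addrC.
Qed.

Lemma ge0_integral_shift x (f : borel_rV R N -> \bar R) :
  measurable_fun setT f -> (forall y, 0 <= f y)%E ->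
  (\int[leb]_y f (x - y)%R = \int[leb]_y f y)%E.
Proof.
have N1 : -1 != 0 :> R by rewrite oppr_eq0 oner_eq0.
move=> mf f0; have := ge0_integral_affine_rV x N1 mf f0.
rewrite normrN1 expr1n invr1 mul1e => <-.
by apply: eq_integral => y _; rewrite scaleN1r addrC.
Qed.

Lemma measurable_shift x f : measurable_fun setT (f : borel_rV R N -> R) ->
  measurable_fun setT (fun y : borel_rV R N => f (x - y)).
Proof.
move=> mf; have := measurableT_comp mf (measurable_affine_rV (-1) x).
by under [X in measurable_fun _ X -> _]funext => y do rewrite /= scaleN1r addrC.
Qed.

Lemma measurable_cosb : measurable_fun setT (@cos R).
Proof. by apply: continuous_measurable_fun; exact: continuous_cos. Qed.

Lemma measurable_sinb : measurable_fun setT (@sin R).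
Proof. by apply: continuous_measurable_fun; exact: continuous_sin. Qed.

(** Shifting the symbol by xi multiplies the kernel by e^(-i y.xi); the two equations are the real
    and imaginary parts of this. *)
Lemma kernel_translate m xi y : is_bump m ->
  kre (fun eta => m (eta + xi)) y = cos (dotE y xi) * kre m y + sin (dotE y xi) * kim m y /\
  kim (fun eta => m (eta + xi)) y = cos (dotE y xi) * kim m y - sin (dotE y xi) * kre m y.
Proof.
move=> bm; have mi := bump_integrable bm.
have N1 := oner_neq0 R.
have ic := integrable_cosM y mi; have is_ := integrable_sinM y mi.
rewrite /ifourier_re /ifourier_im; split.
  transitivity ((2 * pi) ^- N * \int[leb]_eta (cos (dotE y xi) * (cos (dotE y eta) * m eta) +
      sin (dotE y xi) * (sin (dotE y eta) * m eta))).
    congr (_ * _).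
    have ig := integrableD measurableT (integrableZl measurableT (cos (dotE y xi)) ic)
      (integrableZl measurableT (sin (dotE y xi)) is_).
    have := Rintegral_affine_rV xi N1 ig; rewrite normr1 expr1n invr1 mul1r => <-.
    apply: eq_Rintegral => eta _; rewrite scale1r dotEDr.
    have -> : cos (dotE y eta) = cos (dotE y eta + dotE y xi - dotE y xi) by rewrite addrK.
    by rewrite cosB; ring.
  rewrite RintegralD//; last 2 first.
  - exact: (integrableZl _ _ ic).
  - exact: (integrableZl _ _ is_).
  by rewrite !RintegralZl//; ring.
transitivity ((2 * pi) ^- N * \int[leb]_eta (cos (dotE y xi) * (sin (dotE y eta) * m eta) -
    sin (dotE y xi) * (cos (dotE y eta) * m eta))).
  congr (_ * _).
  have ig := integrableB measurableT (integrableZl measurableT (cos (dotE y xi)) is_)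
    (integrableZl measurableT (sin (dotE y xi)) ic).
  have := Rintegral_affine_rV xi N1 ig; rewrite normr1 expr1n invr1 mul1r => <-.
  apply: eq_Rintegral => eta _; rewrite scale1r dotEDr.
  have -> : sin (dotE y eta) = sin (dotE y eta + dotE y xi - dotE y xi) by rewrite addrK.
  by rewrite sinB; ring.
rewrite RintegralB//; last 2 first.
- exact: (integrableZl _ _ is_).
- exact: (integrableZl _ _ ic).
by rewrite !RintegralZl//; ring.
Qed.

(** Inversion at the origin, applied to the symbol shifted by xi. *)
Lemma fourier_inversion m xi : is_bump m ->
  \int[leb]_y (cos (dotE y xi) * kre m y + sin (dotE y xi) * kim m y) = m xi /\
  \int[leb]_y (cos (dotE y xi) * kim m y - sin (dotE y xi) * kre m y) = 0.
Proof.
move=> bm; have bt := bump_affine xi (oner_neq0 R) bm.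
have E0 : (fun x => m (1 *: x + xi)) = (fun x => m (x + xi)).
  by apply/funext => x; rewrite scale1r.
rewrite E0 in bt; have [h1 h2] := fourier_inversion0 bt.
rewrite add0r in h1; rewrite -h1 -h2; split; apply: eq_Rintegral => y _.
  by rewrite (kernel_translate xi y bm).1.
by rewrite (kernel_translate xi y bm).2.
Qed.

(* Complex multiplication written out on real and imaginary parts. *)
Lemma kernel_conv m1 m2 x : is_bump m1 -> is_bump m2 -> (forall xi, m1 xi * m2 xi = m2 xi) ->
  kre m2 x = convolve (kre m1) (kre m2) x - convolve (kim m1) (kim m2) x /\
  kim m2 x = convolve (kre m1) (kim m2) x + convolve (kim m1) (kre m2) x.
Proof.
move=> b1 b2 m12.
have [rr ri] := rapid_kernel b1.
have ir := rapid_integrable rr; have ii := rapid_integrable ri.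
have [r2 i2] := rapid_kernel b2.
have m2i := bump_integrable b2; have mm2 := bump_measurable b2.
(* The real part uses (u, v, p) = (cos, - sin, cos) and the imaginary part (sin, cos, sin). After
   Fubini the integral over y is the inversion formula of [m1] at xi, and [m1 xi * m2 xi = m2 xi]
   removes [m1]. *)
have key (u v p : R -> R) :
    (forall xi, \int[leb]_y (kre m1 y * u (dotE (x - y) xi) + kim m1 y * v (dotE (x - y) xi))
      = p (dotE x xi) * m1 xi) -> measurable_fun setT u -> measurable_fun setT v ->
    (forall t, `|u t| <= 1) -> (forall t, `|v t| <= 1) ->
    \int[leb]_y (kre m1 y * \int[leb]_xi (u (dotE (x - y) xi) * m2 xi) +
                 kim m1 y * \int[leb]_xi (v (dotE (x - y) xi) * m2 xi)) =
    \int[leb]_xi (p (dotE x xi) * m2 xi).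
  move=> H mu mv u1 v1.
  have iM (t : R -> R) y : measurable_fun setT t -> (forall s, `|t s| <= 1) ->
      leb.-integrable setT (EFin \o (fun xi : borel_rV R N => t (dotE (x - y) xi) * m2 xi)).
    move=> mt t1; apply: (le_integrable measurableT _ _ m2i).
      apply/measurable_EFinP; apply: measurable_funM => //.
      apply: (measurableT_comp mt); apply: continuous_measurable_rV; exact: continuous_dotEr.
    by move=> s _ /=; rewrite lee_fin normrM ler_piMl.
  pose F (y xi : borel_rV R N) := (kre m1 y * u (dotE (x - y) xi) + kim m1 y * v (dotE (x - y) xi)) * m2 xi.
  transitivity (\int[leb]_y \int[leb]_xi F y xi).
    apply: eq_Rintegral => y _; rewrite -!RintegralZl//; [|exact: iM|exact: iM].
    rewrite -RintegralD//; [|exact: (integrableZl _ _ (iM _ _ mu u1))|exact: (integrableZl _ _ (iM _ _ mv v1))].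
    by apply: eq_Rintegral => xi _; rewrite /F; ring.
  have iG : leb.-integrable setT (EFin \o (fun y => `|kre m1 y| + `|kim m1 y|)).
    exact: (integrableD measurableT (integrable_norm ir) (integrable_norm ii)).
  have FG y xi : `|kre m1 y * u (dotE (x - y) xi) + kim m1 y * v (dotE (x - y) xi)| <=
      `|kre m1 y| + `|kim m1 y|.
    by rewrite (le_trans (ler_normD _ _))// !normrM lerD// ler_piMr.
  have mshift (t : R -> R) xi : measurable_fun setT t ->
      measurable_fun setT (fun y : borel_rV R N => t (dotE (x - y) xi)).
    move=> mt; apply: (measurableT_comp mt).
    apply: (@measurable_shift x (fun y => dotE y xi)).
    apply: continuous_measurable_rV; exact: continuous_dotEl.
  rewrite (@fubini_Rintegral_dom _ _ F (fun y => `|kre m1 y| + `|kim m1 y|) (fun xi => `|m2 xi|)).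
  - apply: eq_Rintegral => xi _; rewrite -[in RHS]m12 mulrA -H mulrC -RintegralZl//.
      by apply: eq_Rintegral => y _; rewrite mulrC.
    apply: (le_integrable measurableT _ _ iG).
      apply/measurable_EFinP; apply: measurable_funD; apply: measurable_funM.
      + exact: rapid_measurable rr.
      + exact: mshift.
      + exact: rapid_measurable ri.
      + exact: mshift.
    by move=> y _ /=; rewrite lee_fin (le_trans (FG y xi))// ler_norm.
  - apply: measurable_funM; last exact: (measurableT_comp mm2 measurable_snd).
    have md : measurable_fun setT (fun z : borel_rV R N * borel_rV R N => dotE (x - z.1) z.2).
      have mz : measurable_fun setT (fun z : borel_rV R N * borel_rV R N => (x - z.1, z.2) : borel_rV R N * borel_rV R N).
        apply: measurable_fun_pair; last exact: measurable_snd.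
        apply: measurable_fun_rV => i; under eq_fun do rewrite !mxE.
        by apply: measurable_funB => //; exact: (measurableT_comp (measurable_coord i) measurable_fst).
      exact: (measurableT_comp (@measurable_dotE R N) mz).
    apply: measurable_funD; apply: measurable_funM.
    + exact: (measurableT_comp (rapid_measurable rr) measurable_fst).
    + exact: (measurableT_comp mu md).
    + exact: (measurableT_comp (rapid_measurable ri) measurable_fst).
    + exact: (measurableT_comp mv md).
  - exact: iG.
  - exact: (integrable_norm m2i).
  - by move=> y; rewrite addr_ge0.
  - by move=> y.
  - by move=> y xi; rewrite normrM ler_wpM2r.
have inv xi := fourier_inversion xi b1.
have icr xi : leb.-integrable setT (EFin \o (fun y => cos (dotE y xi) * kre m1 y)).
  by have := integrable_cosM xi ir; under [X in _.-integrable _ X -> _]funext => y do rewrite /= dotEC.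
have ici xi : leb.-integrable setT (EFin \o (fun y => cos (dotE y xi) * kim m1 y)).
  by have := integrable_cosM xi ii; under [X in _.-integrable _ X -> _]funext => y do rewrite /= dotEC.
have isr xi : leb.-integrable setT (EFin \o (fun y => sin (dotE y xi) * kre m1 y)).
  by have := integrable_sinM xi ir; under [X in _.-integrable _ X -> _]funext => y do rewrite /= dotEC.
have isi xi : leb.-integrable setT (EFin \o (fun y => sin (dotE y xi) * kim m1 y)).
  by have := integrable_sinM xi ii; under [X in _.-integrable _ X -> _]funext => y do rewrite /= dotEC.
have iM1 xi : leb.-integrable setT (EFin \o (fun y => cos (dotE y xi) * kre m1 y + sin (dotE y xi) * kim m1 y)).
  exact: (integrableD measurableT (icr xi) (isi xi)).
have iM2 xi : leb.-integrable setT (EFin \o (fun y => cos (dotE y xi) * kim m1 y - sin (dotE y xi) * kre m1 y)).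
  exact: (integrableB measurableT (ici xi) (isr xi)).
(* The two inversion formulas for [m1], rotated by a phase; the second contributes 0. *)
have comb (a b : R) xi : \int[leb]_y (a * (cos (dotE y xi) * kre m1 y + sin (dotE y xi) * kim m1 y)
    + b * (cos (dotE y xi) * kim m1 y - sin (dotE y xi) * kre m1 y)) = a * m1 xi.
  rewrite RintegralD//; last 2 first.
  - exact: (integrableZl _ _ (iM1 xi)).
  - exact: (integrableZl _ _ (iM2 xi)).
  by rewrite !RintegralZl// (inv xi).1 (inv xi).2 mulr0 addr0.
have dB y xi : dotE (x - y) xi = dotE x xi - dotE y xi by rewrite dotEDl -scaleN1r dotEZl mulN1r.
have bK (g K : E -> R) : leb.-integrable setT (EFin \o (K : borel_rV R N -> R)) ->
    rapid g -> leb.-integrable setT (EFin \o (fun y : borel_rV R N => K y * g (x - y))).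
  move=> iK rg; have [C gC] := rapid_bounded rg.
  apply: (le_integrable measurableT _ _ (integrableZr measurableT C iK)).
    apply/measurable_EFinP; apply: measurable_funM; last by apply: measurable_shift; exact: rapid_measurable.
    by apply/measurable_EFinP; exact: measurable_int iK.
  by move=> y _ /=; rewrite lee_fin !normrM ler_wpM2l// (le_trans (gC _))// ler_norm.
have c0 : (2 * pi) ^- N * ((2 * pi) ^+ N) = 1 :> R.
  by rewrite mulVf// expf_neq0// mulf_neq0// gt_eqF// pi_gt0.
have D0 : (2 * pi) ^+ N != 0 :> R by rewrite expf_neq0// mulf_neq0// gt_eqF// pi_gt0.
have isx y : leb.-integrable setT (EFin \o (fun xi : borel_rV R N => sin (dotE y xi) * m2 xi)).
  exact: integrable_sinM.
have m_sinN : measurable_fun setT (fun t : R => - sin t).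
  by apply: measurable_funN; exact: measurable_sinb.
split.
  have K := key cos (fun t => - sin t) cos _ measurable_cosb m_sinN
    (fun t => normr_cos_le1 t) _.
  transitivity ((2 * pi) ^- N * \int[leb]_xi (cos (dotE x xi) * m2 xi)) => //.
  rewrite -K; first last.
  - by move=> t; rewrite normrN normr_sin_le1.
  - move=> xi; rewrite -[RHS](comb (cos (dotE x xi)) (- sin (dotE x xi))).
    by apply: eq_Rintegral => y _; rewrite dB cosB sinB; ring.
  transitivity ((2 * pi) ^- N * \int[leb]_y ((2 * pi) ^+ N *
      (kre m1 y * kre m2 (x - y) - kim m1 y * kim m2 (x - y)))).
    congr (_ * _); apply: eq_Rintegral => y _.
    have -> : \int[leb]_xi (- sin (dotE (x - y) xi) * m2 xi) =
        - \int[leb]_xi (sin (dotE (x - y) xi) * m2 xi).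
      by under eq_Rintegral do rewrite mulNr -mulN1r; rewrite RintegralZl// mulN1r.
    by rewrite /ifourier_re /ifourier_im; set D := (2 * pi) ^+ N; field.
  rewrite RintegralZl//; last exact: (integrableB measurableT (bK _ _ ir r2) (bK _ _ ii i2)).
  by rewrite mulrA c0 mul1r RintegralB//; [exact: bK|exact: bK].
have K := key sin cos sin _ measurable_sinb measurable_cosb
  (fun t => normr_sin_le1 t) (fun t => normr_cos_le1 t).
transitivity ((2 * pi) ^- N * \int[leb]_xi (sin (dotE x xi) * m2 xi)) => //.
rewrite -K; first last.
- move=> xi; rewrite -[RHS](comb (sin (dotE x xi)) (cos (dotE x xi))).
  by apply: eq_Rintegral => y _; rewrite dB cosB sinB; ring.
transitivity ((2 * pi) ^- N * \int[leb]_y ((2 * pi) ^+ N *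
    (kre m1 y * kim m2 (x - y) + kim m1 y * kre m2 (x - y)))).
  congr (_ * _); apply: eq_Rintegral => y _.
  by rewrite /ifourier_re /ifourier_im; set D := (2 * pi) ^+ N; field.
rewrite RintegralZl//; last exact: (integrableD measurableT (bK _ _ ir i2) (bK _ _ ii r2)).
by rewrite mulrA c0 mul1r RintegralD//; [exact: bK|exact: bK].
Qed.

Lemma kernel_scale m (c : R) y : 0 < c -> is_bump m ->
  kre (fun xi => m (c^-1 *: xi)) y = c ^+ N * kre m (c *: y) /\
  kim (fun xi => m (c^-1 *: xi)) y = c ^+ N * kim m (c *: y).
Proof.
move=> c0 bm; have mi := bump_integrable bm.
have cV0 : c^-1 != 0 by rewrite invr_eq0 lt0r_neq0.
have E1 xi : dotE (c *: y) (c^-1 *: xi + 0) = dotE y xi.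
  by rewrite addr0 dotEZl dotEZr mulrA mulfV ?mul1r// lt0r_neq0.
have E2 : (c^-1 ^+ N)^-1 = c ^+ N by rewrite exprVn invrK.
rewrite /ifourier_re /ifourier_im; split; rewrite mulrCA; congr (_ * _).
  have := Rintegral_affine_rV 0 cV0 (integrable_cosM (c *: y) mi).
  rewrite gtr0_norm ?invr_gt0// E2 => <-.
  by apply: eq_Rintegral => xi _; rewrite E1 addr0.
have := Rintegral_affine_rV 0 cV0 (integrable_sinM (c *: y) mi).
rewrite gtr0_norm ?invr_gt0// E2 => <-.
by apply: eq_Rintegral => xi _; rewrite E1 addr0.
Qed.

End convolution_theorem.

(** * The L2 norm and Young's inequality *)

Section square_norm.
Context {R : realType} {N : nat}.
Local Notation E := 'rV[R]_N.
Local Notation leb := (lebesgue_rV R N).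
Implicit Types (f g K : E -> R) (x y z : E).
Local Open Scope ereal_scope.

(** The square, with values in the extended reals, adds up over real and imaginary parts, blocks and
    components; [nrm2] is kept beside it for the triangle and Cauchy-Schwarz inequalities. *)
Definition sq f : \bar R := \int[leb]_x ((f x) ^+ 2)%:E.

Definition nrm2 f : \bar R := Lnorm leb 2%:E (EFin \o (f : borel_rV R N -> R)).

Lemma sq_ge0 f : 0 <= sq f.
Proof. by apply: integral_ge0 => x _; rewrite lee_fin sqr_ge0. Qed.

Lemma nrm2_ge0 f : 0 <= nrm2 f.
Proof. exact: Lnorm_ge0. Qed.

Lemma poweR2 (a : \bar R) : 0 <= a -> a `^ 2 = a * a.
Proof.
case: a => [a| |]// a0; first by rewrite poweR_EFin powR_mulrn// expr2 EFinM.
by rewrite poweRyr ?mulyy// pnatr_eq0.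
Qed.

Lemma nrm2_sq f : nrm2 f * nrm2 f = sq f.
Proof.
rewrite -poweR2 ?nrm2_ge0// /nrm2 powR_Lnorm//; apply: eq_integral => x _ /=.
by rewrite powR_mulrn// real_normK ?num_real.
Qed.

Lemma nrm2E f : nrm2 f = sq f `^ 2^-1.
Proof.
rewrite /nrm2 unlock /=; congr (_ `^ _); apply: eq_integral => x _ /=.
by rewrite powR_mulrn// real_normK ?num_real.
Qed.

Lemma nrm2_le f (a : R) : (0 <= a)%R -> (nrm2 f <= a%:E) = (sq f <= (a ^+ 2)%:E).
Proof.
move=> a0; have := nrm2_ge0 f; rewrite -nrm2_sq.
case: (nrm2 f) => [b| |]//; rewrite ?lee_fin => b0.
  by rewrite -expr2 ler_pXn2r// nnegrE.
Qed.

Lemma nrm2_lty f : (nrm2 f < +oo) = (sq f < +oo).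
Proof.
have := nrm2_ge0 f; rewrite -nrm2_sq.
by case: (nrm2 f) => [b| |]//; rewrite -?EFinM ?ltry// mulyy !ltxx.
Qed.

Lemma cauchy_schwarz f g :
  measurable_fun setT (f : borel_rV R N -> R) -> measurable_fun setT (g : borel_rV R N -> R) ->
  \int[leb]_x `|f x * g x|%:E <= nrm2 f * nrm2 g.
Proof.
move=> mf mg.
have := @hoelder _ _ _ leb f g 2 2 mf mg.
by rewrite Lnorm1 => H; apply: H => //; lra.
Qed.

Lemma minkowski2 f g :
  measurable_fun setT (f : borel_rV R N -> R) -> measurable_fun setT (g : borel_rV R N -> R) ->
  nrm2 (fun x => f x + g x)%R <= nrm2 f + nrm2 g.
Proof. by move=> mf mg; apply: (minkowski_EFin leb mf mg); rewrite ler1n. Qed.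

Lemma nrm2Z (c : R) f : measurable_fun setT (f : borel_rV R N -> R) ->
  nrm2 (fun x => c * f x)%R = `|c|%:E * nrm2 f.
Proof.
move=> mf; have h : sq (fun x => c * f x)%R = (c ^+ 2)%:E * sq f.
  rewrite /sq -ge0_integralZl//.
  - by apply: eq_integral => x _; rewrite exprMn EFinM.
  - by apply/measurable_EFinP; exact: measurable_funX.
  - by move=> x _; rewrite lee_fin sqr_ge0.
  - by rewrite lee_fin sqr_ge0.
rewrite !nrm2E h poweRM ?sq_ge0 ?lee_fin ?sqr_ge0//; congr (_ * _).
rewrite poweR_EFin; congr EFin.
by rewrite powR12_sqrt ?sqr_ge0// sqrtr_sqr.
Qed.

(** [fine] sends an infinite integral to 0, so that the left-hand side is 0 in that case and
    measurability is enough. *)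
Lemma ge0_abse_Rintegral (f : borel_rV R N -> R) : measurable_fun setT f ->
  `|\int[leb]_x f x|%R%:E <= \int[leb]_x `|f x|%:E.
Proof.
move=> mf; have := @le_abse_integral _ _ _ leb setT (EFin \o f) measurableT.
have mF : measurable_fun setT (EFin \o f) by exact/measurable_EFinP.
move=> /(_ mF); rewrite /Rintegral /=.
case: (\int[leb]_x (f x)%:E) => [r| |] //=.
- by move=> _; rewrite normr0; apply: integral_ge0 => x _; rewrite lee_fin.
- by move=> _; rewrite normr0; apply: integral_ge0 => x _; rewrite lee_fin.
Qed.

Lemma sq_shift x f : measurable_fun setT (f : borel_rV R N -> R) ->
  sq (fun y => f (x - y)%R) = sq f.
Proof.
move=> mf; apply: (ge0_integral_shift x (f := fun y => (f y ^+ 2)%:E)).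
  by apply/measurable_EFinP; exact: measurable_funX.
by move=> y; rewrite lee_fin sqr_ge0.
Qed.

Lemma conv_sup_le K f x :
  measurable_fun setT (K : borel_rV R N -> R) -> measurable_fun setT (f : borel_rV R N -> R) ->
  \int[leb]_y `|K y * f (x - y)|%:E <= nrm2 K * nrm2 f.
Proof.
move=> mK mf; have -> : nrm2 f = nrm2 (fun y => f (x - y)%R) by rewrite !nrm2E sq_shift.
by apply: cauchy_schwarz => //; exact: measurable_shift.
Qed.

Lemma conv_le_nrm2 K f x :
  measurable_fun setT (K : borel_rV R N -> R) -> measurable_fun setT (f : borel_rV R N -> R) ->
  `|convolve K f x|%:E <= nrm2 K * nrm2 f.
Proof.
move=> mK mf; apply: le_trans (conv_sup_le x mK mf); apply: ge0_abse_Rintegral.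
by apply: measurable_funM => //; exact: measurable_shift.
Qed.

End square_norm.

Section young_inequality.
Context {R : realType} {N : nat}.
Local Notation E := 'rV[R]_N.
Local Notation leb := (lebesgue_rV R N).
Implicit Types (f g K : E -> R) (x y z : E).
Local Open Scope ereal_scope.

Lemma measurable_integral_section (F : borel_rV R N -> borel_rV R N -> \bar R) :
  measurable_fun setT (fun z : borel_rV R N * borel_rV R N => F z.1 z.2) ->
  (forall x y, 0 <= F x y) ->
  measurable_fun setT (fun x : borel_rV R N => \int[leb]_y F x y).
Proof.
move=> mF F0.
exact (@measurable_fun_fubini_tonelli_F _ _ _ _ _ leb
  (fun z : borel_rV R N * borel_rV R N => F z.1 z.2) mF (fun w => F0 w.1 w.2)).
Qed.

Lemma tonelli_section (F : borel_rV R N -> borel_rV R N -> \bar R) :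
  measurable_fun setT (fun z : borel_rV R N * borel_rV R N => F z.1 z.2) ->
  (forall x y, 0 <= F x y) ->
  \int[leb]_x \int[leb]_y F x y = \int[leb]_y \int[leb]_x F x y.
Proof.
move=> mF F0.
exact (@fubini_tonelli _ _ _ _ _ leb leb
  (fun z : borel_rV R N * borel_rV R N => F z.1 z.2) mF (fun w => F0 w.1 w.2)).
Qed.

Lemma measurable_Rintegral_section (F : borel_rV R N -> borel_rV R N -> R) :
  measurable_fun setT (fun z : borel_rV R N * borel_rV R N => F z.1 z.2) ->
  measurable_fun setT (fun x : borel_rV R N => (\int[leb]_y F x y)%R).
Proof.
move=> mF.
have mE : measurable_fun setT (fun z : borel_rV R N * borel_rV R N => (F z.1 z.2)%:E).
  exact/measurable_EFinP.
apply: (measurableT_comp (f := @fine R)); first exact: fine_measurable.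
under eq_fun do rewrite integralE.
apply: emeasurable_funB.
  apply: (@measurable_integral_section (fun x y => (EFin \o F x)^\+ y)) => [|x y].
    rewrite (_ : (fun w => _) = (fun z : borel_rV R N * borel_rV R N => (F z.1 z.2)%:E)^\+).
      exact: (measurable_funepos mE).
    by apply/funext => z; rewrite !funeposE.
  exact: funepos_ge0.
apply: (@measurable_integral_section (fun x y => (EFin \o F x)^\- y)) => [|x y].
  rewrite (_ : (fun w => _) = (fun z : borel_rV R N * borel_rV R N => (F z.1 z.2)%:E)^\-).
    exact: (measurable_funeneg mE).
  by apply/funext => z; rewrite !funenegE.
exact: funeneg_ge0.
Qed.

Lemma measurable_convM K f :
  measurable_fun setT (K : borel_rV R N -> R) -> measurable_fun setT (f : borel_rV R N -> R) ->
  measurable_fun setT (fun z : borel_rV R N * borel_rV R N => K z.2 * f (z.1 - z.2))%R.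
Proof.
move=> mK mf; apply: measurable_funM; first exact: (measurableT_comp mK measurable_snd).
exact: (measurableT_comp mf (@measurable_sub_rV R N)).
Qed.

Lemma measurable_conv K f :
  measurable_fun setT (K : borel_rV R N -> R) -> measurable_fun setT (f : borel_rV R N -> R) ->
  measurable_fun setT (convolve K f : borel_rV R N -> R).
Proof.
move=> mK mf.
exact: (measurable_Rintegral_section (F := fun x y => K y * f (x - y))%R (measurable_convM mK mf)).
Qed.

(* Cauchy-Schwarz against the weight |K|. *)
Lemma sq_conv_le K f (a : R) :
  measurable_fun setT (K : borel_rV R N -> R) -> measurable_fun setT (f : borel_rV R N -> R) ->
  \int[leb]_y `|K y|%:E = a%:E -> sq (convolve K f) <= (a ^+ 2)%:E * sq f.
Proof.
move=> mK mf Ka.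
have a0 : (0 <= a)%R by rewrite -lee_fin -Ka; apply: integral_ge0 => y _; rewrite lee_fin.
have mKf := measurable_convM mK mf.
pose F x y := (`|K y| * (f (x - y)) ^+ 2)%R.
have mF : measurable_fun setT (fun z : borel_rV R N * borel_rV R N => F z.1 z.2).
  apply: measurable_funM.
    by apply: measurableT_comp => //; exact: (measurableT_comp mK measurable_snd).
  by apply: measurable_funX; exact: (measurableT_comp mf (@measurable_sub_rV R N)).
have F0 x y : (0 <= F x y)%R by rewrite mulr_ge0// sqr_ge0.
have mEF : measurable_fun setT (fun z : borel_rV R N * borel_rV R N => (F z.1 z.2)%:E).
  exact/measurable_EFinP.
have F0' x y : 0 <= (F x y)%:E by rewrite lee_fin.
have mIF : measurable_fun setT (fun x : borel_rV R N => \int[leb]_y (F x y)%:E).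
  exact: (@measurable_integral_section (fun x y => (F x y)%:E)).
pose s y := Num.sqrt `|K y|.
have ms : measurable_fun setT (s : borel_rV R N -> R).
  apply: (measurableT_comp (f := @Num.sqrt R)).
    by apply: continuous_measurable_fun; exact: sqrt_continuous.
  exact: measurableT_comp.
have ss y : (s y ^+ 2 = `|K y|)%R by rewrite sqr_sqrtr.
have pt x : ((convolve K f x) ^+ 2)%:E <= a%:E * \int[leb]_y (F x y)%:E.
  have mfx := measurable_shift x mf.
  have msf : measurable_fun setT (fun y : borel_rV R N => (s y * f (x - y))%R).
    exact: measurable_funM.
  have cs := cauchy_schwarz ms msf.
  have -> : \int[leb]_y (F x y)%:E = sq (fun y => s y * f (x - y))%R.
    by apply: eq_integral => y _; rewrite exprMn ss.
  have -> : a%:E = sq s by rewrite -Ka; apply: eq_integral => y _; rewrite ss.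
  have h : `|convolve K f x|%:E <= nrm2 s * nrm2 (fun y => s y * f (x - y))%R.
    apply: le_trans cs; apply: (le_trans (ge0_abse_Rintegral _)).
      exact: measurable_funM.
    rewrite le_eqVlt; apply/orP; left; apply/eqP; apply: eq_integral => y _.
    by rewrite mulrA -expr2 ss !normrM normr_id.
  rewrite -real_normK ?num_real// expr2 EFinM -!nrm2_sq muleACA.
  by apply: lee_pmul; rewrite ?lee_fin.
apply: (@le_trans _ _ (\int[leb]_x (a%:E * \int[leb]_y (F x y)%:E))).
  apply: ge0_le_integral => //.
  - by move=> x _; rewrite lee_fin sqr_ge0.
  - by apply/measurable_EFinP; apply: measurable_funX; exact: measurable_conv.
  - by apply: emeasurable_funM.
rewrite ge0_integralZl//; last first.
  by move=> x _; apply: integral_ge0 => y _; rewrite lee_fin.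
rewrite expr2 EFinM -muleA lee_wpmul2l ?lee_fin//.
rewrite (@tonelli_section (fun x y => (F x y)%:E))//.
have mK' : measurable_fun setT (fun y : borel_rV R N => `|K y|%:E).
  by apply/measurable_EFinP; exact: measurableT_comp.
rewrite -Ka -(@ge0_integralZr _ _ _ _ _ measurableT _ mK')//; last exact: sq_ge0.
rewrite le_eqVlt; apply/orP; left; apply/eqP; apply: eq_integral => y _ /=.
have -> : sq f = sq (fun x => f (x - y)%R).
  have := ge0_integral_affine_rV (- y) (oner_neq0 R) (f := fun x => (f x ^+ 2)%:E).
  rewrite normr1 expr1n invr1 mul1e /sq => <-.
  - by apply: eq_integral => x _; rewrite scale1r.
  - by apply/measurable_EFinP; exact: measurable_funX.
  - by move=> x; rewrite lee_fin sqr_ge0.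
rewrite /sq -ge0_integralZl//.
- apply/measurable_EFinP; apply: measurable_funX.
  exact: (measurableT_comp mf (measurableT_comp (@measurable_sub_rV R N) (pair2_measurable y))).
- by move=> x _; rewrite lee_fin sqr_ge0.
Qed.

(** Fubini: the uniform bound B on the inner absolute integrals bounds the double integral by B
    times the L1 norm of [L]. *)
Lemma conv_assoc L K f (B : R) x : rapid L -> rapid K ->
  measurable_fun setT (f : borel_rV R N -> R) ->
  (forall x, \int[leb]_y `|K y * f (x - y)|%:E <= B%:E) ->
  convolve L (convolve K f) x = convolve (convolve L K) f x.
Proof.
move=> rL rK mf KB.
have iL := rapid_integrable rL; have iK := rapid_integrable rK.
have mL := rapid_measurable rL; have mK := rapid_measurable rK.
have mKf y : measurable_fun setT (fun z : borel_rV R N => (K z * f (y - z))%R).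
  by apply: measurable_funM => //; exact: measurable_shift.
have iKf y : leb.-integrable setT (EFin \o (fun z => K z * f (y - z))%R).
  apply/integrableP; split; first exact/measurable_EFinP.
  by rewrite (le_lt_trans (KB y))// ltry.
pose F (y z : borel_rV R N) := (L y * (K (z - y) * f (x - z)))%R.
(* After replacing z by z - y, the argument of [f] no longer depends on y, and the integral over y
   becomes the convolution of [L] and [K]. *)
have shiftE y : (fun z => K (z - y) * f (x - z))%R =
    (fun z => (fun z => K z * f (x - y - z)) (1 *: z + - y))%R.
  by apply/funext => z /=; rewrite scale1r; congr (_ * f _)%R; rewrite opprB addrC addrA subrK addrC.
have iF y : leb.-integrable setT (EFin \o (fun z => K (z - y) * f (x - z))%R).
  rewrite shiftE; exact: (integrable_affine_rV (- y) (oner_neq0 R) (iKf (x - y)%R)).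
transitivity (\int[leb]_y \int[leb]_z F y z)%R.
  apply: eq_Rintegral => y _; rewrite /F RintegralZl//; congr (_ * _)%R.
  rewrite shiftE (Rintegral_affine_rV (- y) (oner_neq0 R) (iKf (x - y)%R)).
  by rewrite normr1 expr1n invr1 mul1r.
have mLK z : measurable_fun setT (fun y : borel_rV R N => (L y * K (z - y))%R).
  by apply: measurable_funM => //; exact: measurable_shift.
have iLK z : leb.-integrable setT (EFin \o (fun y => L y * K (z - y))%R).
  have [C KC] := rapid_bounded rK.
  apply: (le_integrable measurableT _ _ (integrableZr measurableT C iL)).
    exact/measurable_EFinP.
  by move=> y _ /=; rewrite lee_fin !normrM ler_wpM2l// (le_trans (KC _))// ler_norm.
have mF : measurable_fun setT (fun z : borel_rV R N * borel_rV R N => F z.1 z.2).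
  apply: measurable_funM; first exact: (measurableT_comp mL measurable_fst).
  apply: measurable_funM.
    have m1 := @measurable_sub_rV R N.
    exact: (measurableT_comp mK (measurableT_comp m1 (measurable_fun_pair measurable_snd measurable_fst))).
  exact: (measurableT_comp (measurable_shift x mf) measurable_snd).
have FE z : (fun y => F y z) = (fun y => (L y * K (z - y)) * f (x - z))%R.
  by apply/funext => y; rewrite /F mulrA.
rewrite fubini_Rintegral //.
- by apply: eq_Rintegral => z _; rewrite FE RintegralZr.
- apply: (@le_lt_trans _ _ (\int[leb]_y (`|L y|%:E * B%:E))).
    apply: ge0_le_integral => //.
    + by move=> y _; apply: integral_ge0 => z _; rewrite lee_fin.
    + apply: (@measurable_integral_section (fun y z => `|F y z|%:E)) => [|y z]; last by rewrite lee_fin.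
      by apply/measurable_EFinP; exact: measurableT_comp.
    + apply: emeasurable_funM => //; apply/measurable_EFinP; exact: measurableT_comp.
    + move=> y _; apply: (@le_trans _ _ (`|L y|%:E * \int[leb]_z `|K (z - y) * f (x - z)|%:E)).
        rewrite -ge0_integralZl//.
        * by rewrite le_eqVlt; apply/orP; left; apply/eqP; apply: eq_integral => z _; rewrite /F normrM EFinM.
        * by have := measurable_int _ (iF y) => /measurable_EFinP h; apply/measurable_EFinP; exact: measurableT_comp.
      apply: lee_wpmul2l; first by rewrite lee_fin.
      have := ge0_integral_affine_rV (- y) (oner_neq0 R) (f := fun z => `|K z * f (x - y - z)|%:E).
      rewrite normr1 expr1n invr1 mul1e => h.
      have <- : \int[leb]_z `|K (1 *: z + - y) * f (x - y - (1 *: z + - y))|%:E =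
        \int[leb]_z `|K (z - y) * f (x - z)|%:E.
        apply: eq_integral => z _.
        by rewrite (congr1 (@^~ z) (shiftE y)).
      rewrite h; first exact: KB.
      + by apply/measurable_EFinP; apply: measurableT_comp.
      + by move=> z; rewrite lee_fin.
  rewrite ge0_integralZr//.
  + have /integrableP[_ h] := iL; rewrite lte_mul_pinfty ?ltry//.
      by apply: integral_ge0 => y _; rewrite lee_fin.
    by rewrite ge0_fin_numE//; apply: integral_ge0 => y _; rewrite lee_fin.
  + by apply/measurable_EFinP; exact: measurableT_comp.
  + by apply: le_trans (KB 0%R); apply: integral_ge0 => y _; rewrite lee_fin.
- by move=> y; exact: (integrableZl measurableT (L y) (iF y)).
- by move=> z; rewrite FE; exact: (integrableZr measurableT (f (x - z)%R) (iLK z)).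
Qed.

End young_inequality.

Section ereal_aux.
Context {R : realType}.
Local Open Scope ereal_scope.

Lemma lee_add_double (a b c d a' b' : \bar R) : 0 <= a -> 0 <= b -> 0 <= c -> 0 <= d ->
  a' <= 2%:E * a + 2%:E * c -> b' <= 2%:E * b + 2%:E * d ->
  a' + b' <= 2%:E * (a + b) + 2%:E * (c + d).
Proof.
move=> a0 b0 c0 d0 h1 h2.
by rewrite (ge0_muleDr _ a0 b0) (ge0_muleDr _ c0 d0) addeACA; exact: leeD.
Qed.

Lemma nneseries_le_double (a b c : nat -> \bar R) :
  (forall j, 0 <= a j) -> (forall j, 0 <= b j) -> (forall j, 0 <= c j) ->
  (forall j, c j <= 2%:E * a j + 2%:E * b j) ->
  \sum_(0 <= j <oo) c j <= 2%:E * \sum_(0 <= j <oo) a j + 2%:E * \sum_(0 <= j <oo) b j.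
Proof.
move=> a0 b0 c0 h.
rewrite -(nneseriesZl (f := a))// -(nneseriesZl (f := b))// -nneseriesD; last 2 first.
- by move=> j _ _; rewrite mule_ge0.
- by move=> j _ _; rewrite mule_ge0.
by apply: lee_nneseries => j _ //; exact: h.
Qed.

End ereal_aux.

(** * Littlewood-Paley blocks *)

Section littlewood_paley.
Context {R : realType} {N : nat}.
Local Notation E := 'rV[R]_N.
Local Notation leb := (lebesgue_rV R N).
Implicit Types (f g m K : E -> R) (x y xi : E).
Local Notation kre := (@ifourier_re R N).
Local Notation kim := (@ifourier_im R N).

Lemma enormZ (c : R) x : enorm (c *: x) = `|c| * enorm x.
Proof.
rewrite /enorm dotEZl dotEZr mulrA -expr2 sqrtrM ?sqr_ge0//.
by rewrite sqrtr_sqr.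
Qed.

Lemma enorm0 : enorm (0 : E) = 0.
Proof. by rewrite -[X in enorm X](scale0r (0 : E)) enormZ normr0 mul0r. Qed.

Lemma enorm_ge0 x : 0 <= enorm x.
Proof. exact: sqrtr_ge0. Qed.

Lemma is_bump_enorm m (B : R) : smooth m -> (forall x, m x != 0 -> enorm x <= B) -> is_bump m.
Proof.
move=> sm mB; split => //; exists (1 + B ^+ 2) => x /mB h.
by rewrite /weight lerD2l ler_pXn2r// nnegrE ?enorm_ge0// (le_trans (enorm_ge0 x)).
Qed.

Lemma bump_dilation m (c : R) : c != 0 -> is_bump m -> is_bump (fun x => m (c *: x)).
Proof.
move=> c0 bm; have := bump_affine 0 c0 bm.
by rewrite (_ : (fun x => m (c *: x + 0)) = (fun x => m (c *: x)))//; apply/funext => x; rewrite addr0.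
Qed.

Variables (chi phi : E -> R).
Hypothesis hLP : LP_pair chi phi.
Local Notation S := (LP_symbol chi phi).

Let p2 j : 0 < 2 ^+ j :> R. Proof. by rewrite exprn_gt0. Qed.
Let p2n j : 2 ^+ j != 0 :> R. Proof. by rewrite gt_eqF// p2. Qed.
Let p2Vn j : (2 ^+ j)^-1 != 0 :> R. Proof. by rewrite invr_eq0 p2n. Qed.

Lemma bump_chi : is_bump chi.
Proof. exact: (is_bump_enorm (LP_chi_smooth hLP) (@LP_chi_supp _ _ _ _ hLP)). Qed.

Lemma bump_LP_symbol j : is_bump (S j).
Proof.
case: j => [|q]; first exact: bump_chi.
apply: (bump_dilation (m := phi) (p2Vn q)).
apply: (is_bump_enorm (B := 8 / 3) (LP_phi_smooth hLP)) => x /(LP_phi_supp hLP).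
by case/andP.
Qed.

(** Below 3 / 4 every term of the partition of unity built from [phi] vanishes, as its argument is
    no longer than xi. *)
Lemma LP_chi_eq1 xi : enorm xi < 3 / 4 -> chi xi = 1.
Proof.
move=> h.
have phi0 q : phi ((2 ^+ q)^-1 *: xi) = 0.
  apply: contraTeq h => /(LP_phi_supp hLP)/andP[h _]; rewrite -leNgt (le_trans h)//.
  rewrite enormZ gtr0_norm ?invr_gt0// ler_piMl ?enorm_ge0// invf_le1//.
  by rewrite exprn_ege1// ler1n.
have := LP_unity hLP xi.
under eq_cvg => n do rewrite big1 ?addr0//.
by move=> /(cvg_lim (@Rhausdorff R)) <-; rewrite lim_cst//; exact: Rhausdorff.
Qed.

Lemma LP_chi0 : chi 0 = 1.
Proof. by apply: LP_chi_eq1; rewrite enorm0 divr_gt0. Qed.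

(** [chi] and [phi] are linked only by the partition of unity. Written at xi and at 2^-J xi it has
    the same tail, and the difference of the two limits is the telescoped identity. *)
Lemma sum_LP_symbol J xi : \sum_(0 <= j < J.+1) S j xi = chi ((2 ^+ J)^-1 *: xi).
Proof.
rewrite big_nat_recl//=.
have h1 := LP_unity hLP xi.
have h2 := LP_unity hLP ((2 ^+ J)^-1 *: xi).
have h1' : chi xi + \sum_(0 <= q < J) phi ((2 ^+ q)^-1 *: xi) +
   \sum_(0 <= q < n) phi ((2 ^+ q)^-1 *: ((2 ^+ J)^-1 *: xi)) @[n --> \oo] --> (1 : R).
  move: h1; rewrite -(cvg_shiftn J).
  apply: cvg_trans; apply: near_eq_cvg; apply: nearW => n /=.
  rewrite (big_cat_nat (n := J))//=; last exact: leq_addl.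
  rewrite addrA; congr (_ + _); rewrite -{1}(add0n J) big_addn addnK.
  by apply: eq_bigr => q _; rewrite scalerA exprD invfM.
have h := cvgB h1' h2; rewrite subrr in h; have {}h := h eventually_filter.
pose c := chi xi + \sum_(0 <= q < J) phi ((2 ^+ q)^-1 *: xi) - chi ((2 ^+ J)^-1 *: xi).
have hc : (fun _ : nat => c) @ \oo --> (0 : R).
  apply: cvg_trans h; apply: near_eq_cvg; apply: nearW => n /=.
  pose r := \sum_(0 <= q < n) phi ((2 ^+ q)^-1 *: ((2 ^+ J)^-1 *: xi)).
  rewrite -[LHS]/(chi xi + \sum_(0 <= q < J) phi ((2 ^+ q)^-1 *: xi) + r -
    (chi ((2 ^+ J)^-1 *: xi) + r)).
  by rewrite /c; ring.
have := cvg_lim (@Rhausdorff R) hc; rewrite lim_cst; last exact: Rhausdorff.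
move=> h3; apply/eqP; rewrite -subr_eq0; apply/eqP; exact: h3.
Qed.

Lemma LP_symbol_supp j xi : S j xi != 0 -> enorm xi <= 2 ^+ j * (4 / 3).
Proof.
case: j => [|q] /=; first by rewrite mul1r; exact: (LP_chi_supp hLP).
move=> /(LP_phi_supp hLP)/andP[_]; rewrite enormZ gtr0_norm ?invr_gt0//.
by rewrite mulrC ler_pdivrMr// => h; rewrite exprS (le_trans h)//; lra.
Qed.

(** Where [S j] is nonzero the dilated argument has length at most 2 / 3 < 3 / 4, so [chi] is 1
    there. This wider cut-off is what reproduces the block. *)
Lemma chi_LP_symbol j xi : chi ((2 ^+ j.+1)^-1 *: xi) * S j xi = S j xi.
Proof.
have [->|/LP_symbol_supp h] := eqVneq (S j xi) 0; first by rewrite mulr0.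
rewrite LP_chi_eq1 ?mul1r// enormZ gtr0_norm ?invr_gt0//.
rewrite mulrC ltr_pdivrMr// exprS (le_lt_trans h)//.
have := p2 j; nra.
Qed.

Definition LPre j f := convolve (kre (S j)) f.
Definition LPim j f := convolve (kim (S j)) f.

Local Open Scope ereal_scope.

Definition LPsq j f : \bar R := sq (LPre j f) + sq (LPim j f).

Lemma LPsq_ge0 j f : 0 <= LPsq j f.
Proof. by rewrite adde_ge0// sq_ge0. Qed.

Lemma measurable_LPre j f : measurable_fun setT (f : borel_rV R N -> R) ->
  measurable_fun setT (LPre j f : borel_rV R N -> R).
Proof.
move=> mf; have [rr ri] := rapid_kernel (bump_LP_symbol j).
by apply: measurable_conv => //; exact: rapid_measurable.
Qed.

Lemma measurable_LPim j f : measurable_fun setT (f : borel_rV R N -> R) ->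
  measurable_fun setT (LPim j f : borel_rV R N -> R).
Proof.
move=> mf; have [rr ri] := rapid_kernel (bump_LP_symbol j).
by apply: measurable_conv => //; exact: rapid_measurable.
Qed.

Lemma multiplier_absE j f x :
  multiplier_abs (S j) f x = Num.sqrt (LPre j f x ^+ 2 + LPim j f x ^+ 2)%R.
Proof. by []. Qed.

Lemma sq_multiplier_abs j f : measurable_fun setT (f : borel_rV R N -> R) ->
  sq (multiplier_abs (S j) f) = LPsq j f.
Proof.
move=> mf; rewrite /LPsq /sq -ge0_integralD//.
- by apply: eq_integral => x _; rewrite multiplier_absE sqr_sqrtr ?addr_ge0 ?sqr_ge0// EFinD.
- by move=> x _; rewrite lee_fin sqr_ge0.
- by apply/measurable_EFinP; apply: measurable_funX; exact: measurable_LPre.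
- by move=> x _; rewrite lee_fin sqr_ge0.
- by apply/measurable_EFinP; apply: measurable_funX; exact: measurable_LPim.
Qed.

Definition lam (s : R) (j : nat) : R := ((2 `^ ((j%:R - 1) * s)) ^+ 2)%R.

Lemma lam_gt0 s j : (0 < lam s j)%R.
Proof. by rewrite exprn_gt0// powR_gt0. Qed.

Lemma poweR2K (a : \bar R) : 0 <= a -> (a `^ 2^-1) `^ 2 = a.
Proof. by move=> a0; rewrite -poweRrM mulVf ?pnatr_eq0// poweRe1. Qed.

Lemma besov_term (s : R) (p : \bar R) j f :
  ((2 `^ ((j%:R - 1) * s))%:E * Lnorm leb p (fun x => (multiplier_abs (S j) f x)%:E)) `^ 2 =
  (lam s j)%:E * Lnorm leb p (fun x => (multiplier_abs (S j) f x)%:E) `^ 2.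
Proof.
rewrite poweRM ?lee_fin ?powR_ge0 ?Lnorm_ge0//; congr (_ * _).
by rewrite poweR_EFin powR_mulrn ?powR_ge0.
Qed.

Lemma sqnormE (s : R) f : measurable_fun setT (f : borel_rV R N -> R) ->
  sqnorm chi phi s f = \sum_(0 <= j <oo) ((lam s j)%:E * LPsq j f).
Proof.
move=> mf; rewrite /sqnorm /besov_norm poweR2K; last first.
  by apply: nneseries_ge0 => j _ _; exact: poweR_ge0.
apply: eq_eseriesr => j _; rewrite besov_term; congr (_ * _).
by rewrite poweR2 ?Lnorm_ge0// nrm2_sq sq_multiplier_abs.
Qed.

Lemma tempered_measurable f : tempered f -> measurable_fun setT (f : borel_rV R N -> R).
Proof.
move=> [k /measurable_int/measurable_EFinP h].
have -> : f = (fun x => (f x / weight x ^+ k) * weight x ^+ k)%R.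
  by apply/funext => x; rewrite mulfVK// expf_neq0// gt_eqF// weight_gt0.
apply: measurable_funM; first exact: h.
apply: measurable_funX; apply: continuous_measurable_rV; exact: continuous_weight.
Qed.

Lemma tempered_le k l f : (k <= l)%N ->
  leb.-integrable setT (fun x => (f x / weight x ^+ k)%:E) ->
  leb.-integrable setT (fun x => (f x / weight x ^+ l)%:E).
Proof.
move=> kl h; apply: (le_integrable measurableT _ _ h).
  apply/measurable_EFinP; apply: measurable_funM; last exact: measurable_weightVX.
  by apply: tempered_measurable; exists k.
move=> x _ /=; rewrite lee_fin !normrM ler_wpM2l//.
rewrite !ger0_norm ?invr_ge0 ?exprn_ge0 ?(ltW (weight_gt0 _))//.
rewrite lef_pV2 ?posrE ?exprn_gt0 ?weight_gt0//.
by rewrite ler_weXn2l// weight_ge1.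
Qed.

Lemma temperedZ (a : R) f : tempered f -> tempered (fun x => a * f x)%R.
Proof.
move=> [k h]; exists k.
have := integrableZl measurableT a h; apply: eq_integrable => // x _.
by rewrite /= EFinM muleA -EFinM.
Qed.

Lemma temperedD f g : tempered f -> tempered g -> tempered (fun x => f x + g x)%R.
Proof.
move=> [k hf] [l hg]; exists (maxn k l).
have := integrableD measurableT (tempered_le (leq_maxl k l) hf) (tempered_le (leq_maxr k l) hg).
by apply: eq_integrable => // x _; rewrite /= mulrDl EFinD.
Qed.

Lemma temperedB f g : tempered f -> tempered g -> tempered (fun x => f x - g x)%R.
Proof.
move=> tf tg; have := temperedD tf (temperedZ (-1) tg).
by under [X in tempered X -> _]funext => x do rewrite mulN1r.
Qed.

(** Peetre's inequality turns the weight at x - y, in which [f] is controlled, into a weight at y,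
    which the decay of [K] absorbs. *)
Lemma integrable_conv_tempered K f x : rapid K -> tempered f ->
  leb.-integrable setT (EFin \o (fun y : borel_rV R N => K y * f (x - y))%R).
Proof.
move=> rK tf; have mf := tempered_measurable tf; have mK := rapid_measurable rK.
move: tf => [k h]; have [C KC] := rK.2 k.
have := integrable_shift x h => /(integrableZl measurableT (C * 2 ^+ k * weight x ^+ k)%R) h'.
apply: (le_integrable measurableT _ _ h').
  by apply/measurable_EFinP; apply: measurable_funM => //; exact: measurable_shift.
move=> y _ /=; rewrite lee_fin.
have w0 (a : E) := weight_gt0 a.
pose g := (f (x - y) / (1 + enorm (x - y) ^+ 2) ^+ k)%R.
rewrite -/g (_ : f (x - y) = g * weight (x - y) ^+ k)%R; last first.
  by rewrite mulfVK// expf_neq0// gt_eqF// w0.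
rewrite [leRHS]normrM [leLHS]normrM (normrM g) mulrCA [leRHS]mulrC ler_wpM2l//.
rewrite [leRHS]ger0_norm ?mulr_ge0 ?exprn_ge0 ?(ltW (w0 _))//; last first.
  have := le_trans (normr_ge0 _) (KC 0%R).
  by rewrite pmulr_lge0// invr_gt0 exprn_gt0.
rewrite [X in (_ * X)%R]ger0_norm ?exprn_ge0 ?(ltW (w0 _))//.
have C0 : (0 <= C)%R.
  have := le_trans (normr_ge0 _) (KC 0%R).
  by rewrite pmulr_lge0// invr_gt0 exprn_gt0.
apply: (@le_trans _ _ (C * weight y ^- k * (2 * weight x * weight y) ^+ k)%R).
  apply: ler_pM => //; first by rewrite exprn_ge0// ltW.
  apply: lerXn2r; last exact: weight_sub_le.
    by rewrite nnegrE ltW.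
  by rewrite nnegrE !mulr_ge0// ltW.
rewrite !exprMn le_eqVlt; apply/orP; left; apply/eqP.
have wy : (weight y ^+ k != 0)%R by rewrite expf_neq0// gt_eqF.
by field.
Qed.

Lemma LPsq_sub j f g : tempered f -> tempered g ->
  LPsq j (fun x => f x - g x)%R <= 2%:E * LPsq j f + 2%:E * LPsq j g.
Proof.
move=> tf tg; have mf := tempered_measurable tf; have mg := tempered_measurable tg.
have [rr ri] := rapid_kernel (bump_LP_symbol j).
have key K : rapid K -> sq (convolve K (fun x => f x - g x)%R) <=
    2%:E * sq (convolve K f) + 2%:E * sq (convolve K g).
  move=> rK; have mK := rapid_measurable rK.
  have mX h : measurable_fun setT (h : borel_rV R N -> R) ->
      measurable_fun setT (fun x : borel_rV R N => (convolve K h x ^+ 2)%:E).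
    by move=> mh; apply/measurable_EFinP; apply: measurable_funX; exact: measurable_conv.
  have X0 h x : 0 <= (convolve K h x ^+ 2)%:E by rewrite lee_fin sqr_ge0.
  rewrite /sq -!ge0_integralZl//; [|exact: mX|exact: mX].
  rewrite -ge0_integralD//; last 4 first.
  - by move=> x _; rewrite mule_ge0.
  - by apply: emeasurable_funM => //; exact: mX.
  - by move=> x _; rewrite mule_ge0.
  - by apply: emeasurable_funM => //; exact: mX.
  apply: ge0_le_integral => //.
  - by apply: mX; exact: measurable_funB.
  - by apply: emeasurable_funD; apply: emeasurable_funM => //; exact: mX.
  move=> x _; have -> : convolve K (fun x => f x - g x)%R x = (convolve K f x - convolve K g x)%R.
    rewrite /convolve -RintegralB//; [|exact: integrable_conv_tempered|exact: integrable_conv_tempered].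
    by apply: eq_Rintegral => y _; rewrite mulrBr.
  rewrite -!EFinM -EFinD lee_fin.
  have := sqr_ge0 (convolve K f x + convolve K g x)%R; nra.
have h1 := key _ rr; have h2 := key _ ri.
exact: (lee_add_double (sq_ge0 _) (sq_ge0 _) (sq_ge0 _) (sq_ge0 _) h1 h2).
Qed.

Lemma sqnorm_sub (s : R) f g : tempered f -> tempered g ->
  sqnorm chi phi s (fun x => f x - g x)%R <= 2%:E * sqnorm chi phi s f + 2%:E * sqnorm chi phi s g.
Proof.
move=> tf tg; have mf := tempered_measurable tf; have mg := tempered_measurable tg.
rewrite !sqnormE//; last exact: measurable_funB.
have l0 h j : 0 <= (lam s j)%:E * LPsq j h by rewrite mule_ge0 ?LPsq_ge0// lee_fin ltW// lam_gt0.
apply: nneseries_le_double => [j|j|j|j]; [exact: l0|exact: l0|exact: l0|].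
rewrite !(muleCA 2%:E) -ge0_muleDr ?mule_ge0 ?LPsq_ge0//.
by apply: lee_wpmul2l; [rewrite lee_fin ltW// lam_gt0|exact: LPsq_sub].
Qed.

End littlewood_paley.

(** * Reconstruction of a function from its blocks *)

Section approximate_identity.
Context {R : realType} {N : nat}.
Local Notation E := 'rV[R]_N.
Local Notation leb := (lebesgue_rV R N).
Implicit Types (f K : E -> R) (x y : E).

Lemma weight_sub_leX k x y : weight (x - y) ^+ k <= (2 * weight x * weight y) ^+ k.
Proof.
have w0 (a : E) := ltW (weight_gt0 a).
apply: lerXn2r; last exact: weight_sub_le.
  by rewrite nnegrE.
by rewrite nnegrE !mulr_ge0.
Qed.

Lemma tempered_shift f x : tempered f -> tempered (fun y => f (x - y)).
Proof.
move=> tf; have mf := tempered_measurable tf.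
move: tf => [k h]; exists k; have w0 (a : E) := weight_gt0 a.
have := integrable_shift x h => /(integrableZl measurableT (2 ^+ k * weight x ^+ k)) h'.
apply: (le_integrable measurableT _ _ h').
  by apply/measurable_EFinP; apply: measurable_funM; [exact: measurable_shift|exact: measurable_weightVX].
move=> y _ /=; rewrite lee_fin [leLHS]normrM [leRHS]normrM (normrM (f _)) mulrCA ler_wpM2l//.
rewrite !gtr0_norm ?mulr_gt0 ?invr_gt0 ?exprn_gt0 ?(w0 _)//.
rewrite -[1 + enorm y ^+ 2]/(weight y) -[1 + enorm (x - y) ^+ 2]/(weight (x - y)).
rewrite ler_pdivlMr ?exprn_gt0// mulrC ler_pdivrMr ?exprn_gt0// -!exprMn.
exact: weight_sub_leX.
Qed.

Lemma tempered_cst (a : R) : tempered (fun _ : E => a).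
Proof.
exists N; have := integrableZl measurableT a (@integrable_weightVX R N N (leqnn N)).
by apply: eq_integrable.
Qed.

(** Near the origin continuity of [f] makes the oscillation [h] small; away from it the decay of [K]
    beats both the growth of [h] and the factor c^N of the dilation. *)
Lemma approximate_identity K f x : rapid K -> tempered f -> continuous f ->
  \int[leb]_y K y = 1 ->
  \int[leb]_y ((2 ^+ J) ^+ N * K (2 ^+ J *: y) * f (x - y)) @[J --> \oo] --> f x.
Proof.
move=> rK tf cf K1; have mK := rapid_measurable rK.
pose h y := f (x - y) - f x.
have th : tempered h by apply: temperedB; [exact: tempered_shift|exact: tempered_cst].
have mh := tempered_measurable th.
case: (th) => k hk.
(* Of these powers, [k] absorb the growth of [h]. On the cube near 0, N of the others make the
   kernel integrable; outside it N + 1 of them leave c^N c^(-2(N + 1)) <= c^-1. *)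
have [C0 KC0] := rK.2 (N.+1 + k)%N.
pose C := `|C0|.
have C0' : 0 <= C by exact: normr_ge0.
have KC y : `|K y| <= C * weight y ^- (N.+1 + k).
  by rewrite (le_trans (KC0 y))// ler_wpM2r ?ler_norm// invr_ge0 exprn_ge0// ltW// weight_gt0.
pose H := \int[leb]_y (`|h y| * weight y ^- k).
have iH : leb.-integrable setT (EFin \o (fun y : borel_rV R N => `|h y| * weight y ^- k)).
  have := integrable_norm hk; apply: eq_integrable => // y _ /=.
  by rewrite normrM (ger0_norm (x := _^-1))// invr_ge0 exprn_ge0// ltW// weight_gt0.
have H0 : 0 <= H.
  by apply: Rintegral_ge0 => // y _; rewrite mulr_ge0// invr_ge0 exprn_ge0// ltW// weight_gt0.
pose W := \int[leb]_y (weight y ^- N : R).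
have iW := @integrable_weightVX R N N (leqnn N).
have W0 : 0 <= W.
  by apply: Rintegral_ge0 => // y _; rewrite invr_ge0 exprn_ge0// ltW// weight_gt0.
have scaled (c : R) (g : borel_rV R N -> R) : 0 < c -> leb.-integrable setT (EFin \o g) ->
    leb.-integrable setT (EFin \o (fun y : borel_rV R N => c ^+ N * g (c *: y))) /\
    \int[leb]_y (c ^+ N * g (c *: y)) = \int[leb]_y g y.
  move=> c0 ig; have cn : c != 0 by rewrite gt_eqF.
  have ig' := integrable_affine_rV 0 cn ig.
  have E1 : (fun y : borel_rV R N => g (c *: y + 0)) = (fun y => g (c *: y)).
    by apply/funext => y; rewrite addr0.
  have := Rintegral_affine_rV 0 cn ig; rewrite E1 in ig' * => E2.
  split; first exact: (integrableZl measurableT (c ^+ N) ig').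
  rewrite RintegralZl// E2 gtr0_norm// mulrA mulfV ?mul1r//.
  by rewrite expf_neq0.
have iK := rapid_integrable rK.
have bound (c d e : R) : 1 <= c -> 0 < d -> 0 <= e -> (forall y, ball (0 : E) d y -> `|h y| <= e) ->
    `|f x - \int[leb]_y (c ^+ N * K (c *: y) * f (x - y))| <=
    C * e * W + c^-1 * (C * (d ^+ 2) ^- N.+1 * H).
  move=> c1 d0 e0 he.
  have c0 : 0 < c by rewrite (lt_le_trans ltr01).
  have [iKc Kc1] := scaled c _ c0 iK.
  have [iWc Wc] := scaled c _ c0 iW.
  have mKc : measurable_fun setT (fun y : borel_rV R N => K (c *: y)).
    have := measurableT_comp mK (measurable_affine_rV c 0).
    by under [X in measurable_fun _ X -> _]funext => y do rewrite /= addr0.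
  pose G y := C * e * (c ^+ N * weight (c *: y) ^- N) + c^-1 * (C * (d ^+ 2) ^- N.+1) * (`|h y| * weight y ^- k).
  have iG1 := integrableZl measurableT (C * e) iWc.
  have iG2 := integrableZl measurableT (c^-1 * (C * (d ^+ 2) ^- N.+1)) iH.
  have iG : leb.-integrable setT (EFin \o (G : borel_rV R N -> R)) by exact: (integrableD measurableT iG1 iG2).
  have pt y : `|c ^+ N * K (c *: y) * h y| <= G y.
    have w0 (a : E) := weight_gt0 a.
    have wv (a : E) i : 0 <= weight a ^- i by rewrite invr_ge0 exprn_ge0// ltW.
    have dv : 0 <= (d ^+ 2) ^- N.+1 by rewrite invr_ge0 exprn_ge0// sqr_ge0.
    have cV0 : 0 <= c^-1 by rewrite invr_ge0 ltW.
    have cN0 : 0 <= c ^+ N by rewrite exprn_ge0// ltW.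
    have G1 : 0 <= C * e * (c ^+ N * weight (c *: y) ^- N).
      by do ! apply: mulr_ge0.
    have G2 : 0 <= c^-1 * (C * (d ^+ 2) ^- N.+1) * (`|h y| * weight y ^- k).
      by do ! apply: mulr_ge0.
    rewrite !normrM (ger0_norm (x := c ^+ N)) ?exprn_ge0 ?(ltW c0)//.
    apply: (@le_trans _ _ (c ^+ N * (C * weight (c *: y) ^- (N.+1 + k)) * `|h y|)).
      by rewrite ler_wpM2r// ler_wpM2l// exprn_ge0// ltW.
    have wVX (a : E) i j : (i <= j)%N -> weight a ^- j <= weight a ^- i.
      move=> ij; rewrite lef_pV2 ?posrE ?exprn_gt0//.
      by rewrite ler_weXn2l// weight_ge1.
    have [yd|yd] := pselect (ball (0 : E) d y).
      rewrite /G -[leLHS]addr0 lerD//.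
      apply: (@le_trans _ _ (c ^+ N * (C * weight (c *: y) ^- N) * e)).
        apply: ler_pM => //; last exact: he.
          by do ! apply: mulr_ge0.
        rewrite ler_wpM2l ?exprn_ge0 ?(ltW c0)// ler_wpM2l// wVX//.
        by rewrite addSnnS leq_addr.
      by rewrite le_eqVlt; apply/orP; left; apply/eqP; ring.
    rewrite /G -[leLHS]add0r lerD//.
    have wc : c ^+ 2 * d ^+ 2 <= weight (c *: y).
      have [i yi] : exists i, d <= `|y 0 i|.
        apply: contrapT => hn; apply: yd; split => // a b.
        rewrite (ord1 a) mxE /ball /= sub0r normrN ltNge; apply/negP => hh; apply: hn; by exists b.
      rewrite (le_trans _ (sqr_coord_le_weight _ i))// mxE exprMn.
      have : d ^+ 2 <= y 0 i ^+ 2.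
        by rewrite -(real_normK (num_real (y 0 i))) ler_pXn2r// nnegrE ltW.
      have : 0 <= c ^+ 2 by rewrite sqr_ge0.
      by nra.
    have wy : weight y <= weight (c *: y).
      rewrite !weightE lerD2l; apply: ler_sum => i _; rewrite mxE exprMn ler_peMl ?sqr_ge0//.
      by rewrite exprn_ege1.
    have -> : c^-1 * (C * (d ^+ 2) ^- N.+1) * (`|h y| * weight y ^- k) =
       (C * `|h y|) * (c^-1 * ((d ^+ 2) ^- N.+1 * weight y ^- k)) by ring.
    have -> : c ^+ N * (C * weight (c *: y) ^- (N.+1 + k)) * `|h y| =
       (C * `|h y|) * (c ^+ N * weight (c *: y) ^- (N.+1 + k)) by ring.
    apply: ler_wpM2l; first exact: mulr_ge0.
    apply: (@le_trans _ _ (c ^+ N * ((c ^+ 2 * d ^+ 2) ^- N.+1 * weight y ^- k))).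
      rewrite ler_wpM2l ?exprn_ge0 ?(ltW c0)// exprD invfM; apply: ler_pM.
      - by rewrite invr_ge0 exprn_ge0// ltW.
      - by rewrite invr_ge0 exprn_ge0// ltW.
      - rewrite lef_pV2 ?posrE ?exprn_gt0 ?mulr_gt0 ?exprn_gt0//.
        by apply: lerXn2r; rewrite ?nnegrE// ?mulr_ge0 ?sqr_ge0// ltW.
      - rewrite lef_pV2 ?posrE ?exprn_gt0//.
        by apply: lerXn2r; rewrite ?nnegrE// ltW.
    have -> : (c ^+ 2 * d ^+ 2) ^- N.+1 = (c ^+ 2) ^- N.+1 * (d ^+ 2) ^- N.+1.
      by rewrite exprMn invfM.
    rewrite -(mulrA (c ^+ 2 ^- N.+1)) (mulrA (c ^+ N)).
    apply: ler_wpM2r; first exact: mulr_ge0.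
    rewrite -exprM ler_pdivrMr ?exprn_gt0// ler_pdivlMl// -exprS.
    by rewrite ler_weXn2l// mul2n -addnn leq_addr.
  have mF : measurable_fun setT (fun y : borel_rV R N => c ^+ N * K (c *: y) * h y).
    by apply: measurable_funM => //; apply: measurable_funM.
  have iF : leb.-integrable setT (EFin \o (fun y : borel_rV R N => c ^+ N * K (c *: y) * h y)).
    apply: (le_integrable measurableT _ _ iG); first exact/measurable_EFinP.
    by move=> y _ /=; rewrite lee_fin (le_trans (pt y))// ler_norm.
  have iKf := integrableZr measurableT (f x) iKc.
  have -> : \int[leb]_y (c ^+ N * K (c *: y) * f (x - y)) =
      \int[leb]_y (c ^+ N * K (c *: y) * h y) + f x.
    rewrite -[in RHS](mul1r (f x)) -[X in X * f x]K1 -Kc1 -RintegralZr// -RintegralD//.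
    by apply: eq_Rintegral => y _; rewrite /h; ring.
  rewrite opprD addrCA subrr addr0 normrN.
  apply: (le_trans (le_normr_Rintegral measurableT iF)).
  apply: (@le_trans _ _ (\int[leb]_y G y)).
    by apply: le_Rintegral => //; exact: integrable_norm.
  rewrite /G RintegralD//.
  rewrite (RintegralZl (C * e) measurableT iWc) (RintegralZl _ measurableT iH).
  by rewrite Wc -/H -/W le_eqVlt; apply/orP; left; apply/eqP; ring.
apply/cvgrPdist_le => e e0.
pose e1 := e / 2 / (C * W + 1).
have CW : 0 < C * W + 1 by rewrite ltr_wpDl// mulr_ge0.
have e10 : 0 < e1 by rewrite !divr_gt0.
have /nbhs_ballP[d d0 hd] : \forall y \near (0 : E), `|h y| <= e1.
  have cx : {for (0 : E), continuous (fun y : E => x - y)}.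
    have := @continuous_affine R N (-1) x 0.
    by rewrite (_ : (fun y : E => -1 *: y + x) = (fun y => x - y))//; apply/funext => y; rewrite scaleN1r addrC.
  have ch := @continuous_comp _ _ _ (fun y : E => x - y) f 0 cx (cf _).
  move: ch => /cvgrPdist_le /(_ e1 e10).
  by apply: filterS => y /=; rewrite subr0 distrC.
pose D := C * (d ^+ 2) ^- N.+1 * H.
have D0 : 0 <= D.
  apply: mulr_ge0 => //; apply: mulr_ge0 => //.
  by rewrite invr_ge0 exprn_ge0// sqr_ge0.
have e20 : 0 < e / 2 / (D + 1) by rewrite !divr_gt0// ltr_wpDl.
have [J0 _ J0P] := near_infty_natSinv_lt (PosNum e20).
exists J0 => // J /= /J0P /= hJ.
have c1 : 1 <= 2 ^+ J :> R by rewrite exprn_ege1// ler1n.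
apply: (le_trans (bound _ d e1 c1 d0 (ltW e10) _)); first by move=> y yd; exact: hd.
rewrite (splitr e); apply: lerD.
  rewrite /e1 mulrAC mulrA ler_pdivrMr// mulrC ler_wpM2l ?divr_ge0 ?(ltW e0)//.
  by rewrite lerDl.
have c2 : (2 ^+ J : R)^-1 <= J.+1%:R^-1.
  by rewrite lef_pV2 ?posrE ?exprn_gt0// -natrX ler_nat ltn_expl.
rewrite -/D (le_trans (ler_wpM2r D0 c2))//.
rewrite (le_trans (ler_wpM2r D0 (ltW hJ)))//.
rewrite mulrAC ler_pdivrMr ?ltr_wpDl// ler_wpM2l ?divr_ge0 ?(ltW e0)//.
by rewrite lerDl.
Qed.

End approximate_identity.

Section weighted_series.
Context {R : realType}.

Lemma cauchy_schwarz_sum (l a : nat -> R) J : (forall j, 0 < l j) ->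
  (\sum_(0 <= j < J) a j) ^+ 2 <= (\sum_(0 <= j < J) (l j)^-1) * (\sum_(0 <= j < J) l j * a j ^+ 2).
Proof.
move=> l0; elim: J => [|J IH]; first by rewrite !big_geq// expr0n mul0r.
rewrite !big_nat_recr//=.
set A := \sum_(0 <= j < J) a j in IH *; set P := \sum_(0 <= j < J) (l j)^-1 in IH *.
set Q := \sum_(0 <= j < J) l j * a j ^+ 2 in IH *.
have P0 : 0 <= P by apply: sumr_ge0 => j _; rewrite invr_ge0 ltW.
have Q0 : 0 <= Q by apply: sumr_ge0 => j _; rewrite mulr_ge0 ?sqr_ge0// ltW.
(* [X] and [Y] are the cross terms of the product on the right. Their product dominates (A a_J)^2 by
   the induction hypothesis, so their sum dominates 2 A a_J. *)
have lJ := l0 J; set X := P * (l J * a J ^+ 2); set Y := Q / l J.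
have X0 : 0 <= X by rewrite mulr_ge0// mulr_ge0 ?sqr_ge0// ltW.
have Y0 : 0 <= Y by rewrite divr_ge0// ltW.
have XY : X * Y = P * Q * a J ^+ 2.
  by rewrite /X /Y; field; rewrite gt_eqF.
have h : (A * a J) ^+ 2 <= X * Y by rewrite XY exprMn ler_wpM2r// sqr_ge0.
have h2 : 2 * (A * a J) <= X + Y.
  rewrite leNgt; apply/negP => hn.
  have : (X + Y) ^+ 2 < (2 * (A * a J)) ^+ 2.
    by rewrite ltr_pXn2r ?nnegrE ?addr_ge0// ltW// (le_lt_trans _ hn)// addr_ge0.
  have := sqr_ge0 (X - Y); nra.
have -> : (P + (l J)^-1) * (Q + l J * a J ^+ 2) = P * Q + (X + Y) + a J ^+ 2.
  by rewrite /X /Y; field; rewrite gt_eqF.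
rewrite sqrrD -mulr_natl; lra.
Qed.

Lemma lamV (s : R) j : (lam s j)^-1 = 2 `^ (2 * s) * (2 `^ (- (2 * s))) ^+ j.
Proof.
have n0 : (2 : R) != 0 by rewrite pnatr_eq0.
rewrite /lam -powR_mulrn ?powR_ge0// -powRrM -[in RHS]powR_mulrn ?powR_ge0// -powRrM.
rewrite -powRN -powRD; last by rewrite n0 implybT.
by congr (_ `^ _); ring.
Qed.

Lemma lamD (s t : R) j : lam (s + t) j = lam s j * lam t j.
Proof.
rewrite /lam -exprMn -powRD; last by rewrite pnatr_eq0 implybT.
by congr (_ `^ _ ^+ _); ring.
Qed.

Lemma sum_lamV_le (s : R) : 0 < s -> exists C : R, 0 <= C /\
  forall J, \sum_(0 <= j < J) (lam s j)^-1 <= C.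
Proof.
move=> s0; set a := 2 `^ (2 * s); set z : R := 2 `^ (- (2 * s)).
have a0 : 0 <= a by exact: powR_ge0.
have z0 : 0 < z by rewrite powR_gt0.
have z1 : z < 1.
  rewrite /z powRN invf_lt1 ?powR_gt0//.
  have s20 : 0 < 2 * s by rewrite mulr_gt0.
  have := @gt0_ltr_powR R (2 * s) s20 1 2.
  by rewrite powR1 => -> //; rewrite ?in_itv/= ?nnegrE ?ltr1n//.
exists (a / (1 - z)); split; first by rewrite divr_ge0// subr_ge0 ltW.
move=> J; have := geometric_le_lim J a0 z0; rewrite ger0_norm ?(ltW z0)// => /(_ z1).
rewrite /series /geometric /=; apply: le_trans.
by rewrite le_eqVlt; apply/orP; left; apply/eqP; apply: eq_bigr => j _; rewrite lamV.
Qed.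

Local Open Scope ereal_scope.

(** Cauchy-Schwarz against the geometric weights, whose inverses are summable for s > 0. It plays
    the part of the orthogonality of the blocks: a weighted sum of squares controls the square of
    the sum. *)
Lemma sq_series_le (s : R) : (0 < s)%R -> exists C : R, (0 <= C)%R /\
  forall (a : nat -> R) (l : R), (\sum_(0 <= j < J) a j)%R @[J --> \oo] --> l ->
  (l ^+ 2)%:E <= C%:E * \sum_(0 <= j <oo) (lam s j * a j ^+ 2)%:E.
Proof.
move=> s0; have [C [C0 hC]] := sum_lamV_le s0; exists C; split => // a l al.
have la0 j : (0 <= lam s j * a j ^+ 2)%R by rewrite mulr_ge0 ?sqr_ge0// ltW// lam_gt0.
set T := \sum_(0 <= j <oo) _.
have T0 : 0 <= T by apply: nneseries_ge0 => j _ _; rewrite lee_fin.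
have h J : (((\sum_(0 <= j < J) a j) ^+ 2)%R)%:E <= C%:E * T.
  apply: (@le_trans _ _ (C%:E * (\sum_(0 <= j < J) lam s j * a j ^+ 2)%R%:E)).
    rewrite -EFinM lee_fin (le_trans (cauchy_schwarz_sum a J (lam_gt0 s)))//.
    by rewrite ler_wpM2r// sumr_ge0.
  apply: lee_wpmul2l; first by rewrite lee_fin.
  rewrite -sumEFin; apply: nneseries_lim_ge => j _ _; by rewrite lee_fin.
have : (((\sum_(0 <= j < J) a j) ^+ 2)%R)%:E @[J --> \oo] --> (l ^+ 2)%:E.
  apply: cvg_EFin; first exact: nearW.
  have al2 := cvgM al al; have {}al2 := al2 eventually_filter; rewrite -expr2 in al2.
  by apply: cvg_trans al2; apply: near_eq_cvg; apply: nearW => J /=; rewrite expr2.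
move=> hl; rewrite -(cvg_lim _ hl)//; apply: lime_le; first by apply/cvg_ex; exists (l ^+ 2)%:E.
exact: nearW.
Qed.

End weighted_series.

Section reconstruction.
Context {R : realType} {N : nat}.
Local Notation E := 'rV[R]_N.
Local Notation leb := (lebesgue_rV R N).
Implicit Types (f g m K L : E -> R) (x y xi : E).
Local Notation kre := (@ifourier_re R N).
Local Notation kim := (@ifourier_im R N).
Variables (chi phi : E -> R).
Hypothesis hLP : LP_pair chi phi.
Local Notation S := (LP_symbol chi phi).

Let p2 j : 0 < 2 ^+ j :> R. Proof. by rewrite exprn_gt0. Qed.

Lemma sum_kernel J y : \sum_(0 <= j < J.+1) kre (S j) y = (2 ^+ J) ^+ N * kre chi (2 ^+ J *: y).
Proof.
rewrite -(kernel_scale y (p2 J) (bump_chi hLP)).1 /ifourier_re -mulr_sumr; congr (_ * _).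
have [_ <-] := Rintegral_sum (index_iota 0 J.+1)
  (fun j => integrable_cosM y (bump_integrable (bump_LP_symbol hLP j))).
by apply: eq_Rintegral => xi _; rewrite -mulr_sumr (sum_LP_symbol hLP).
Qed.

(** The partial sums of the kernels are dilates of [kre chi], an approximate identity of mass
    [chi 0 = 1]. As [f] is real, the real parts alone recover it. *)
Lemma LP_reconstruction f x : tempered f -> continuous f ->
  \sum_(0 <= j < J) LPre chi phi j f x @[J --> \oo] --> f x.
Proof.
move=> tf cf.
have [rr _] := rapid_kernel (bump_chi hLP).
have K1 : \int[leb]_y kre chi y = 1.
  by rewrite (fourier_inversion0 (bump_chi hLP)).1 (LP_chi0 hLP).
have := approximate_identity (x := x) rr tf cf K1.
rewrite -(cvg_shiftS (fun J => \sum_(0 <= j < J) LPre chi phi j f x)).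
apply: cvg_trans; apply: near_eq_cvg; apply: nearW => J /=.
have [_ <-] := Rintegral_sum (index_iota 0 J.+1)
  (fun j => integrable_conv_tempered x (rapid_kernel (bump_LP_symbol hLP j)).1 tf).
by apply: eq_Rintegral => y _; rewrite -mulr_suml sum_kernel.
Qed.

Local Open Scope ereal_scope.

(** The pointwise bound of [sq_series_le], applied to the reconstruction of f(x), is integrated over
    x. *)
Lemma sq_le_sqnorm (s : R) : (0 < s)%R -> exists C : R, (0 <= C)%R /\
  forall f, tempered f -> continuous f -> sq f <= C%:E * sqnorm chi phi s f.
Proof.
move=> s0; have [C [C0 hC]] := @sq_series_le R s s0; exists C; split => // f tf cf.
have mf := tempered_measurable tf; rewrite (sqnormE hLP)//.
have mA j := measurable_LPre hLP j mf.
have mA2 j : measurable_fun setT (fun x : borel_rV R N => (lam s j * LPre chi phi j f x ^+ 2)%:E).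
  by apply/measurable_EFinP; apply: measurable_funM => //; exact: measurable_funX.
have A0 j x : 0 <= (lam s j * LPre chi phi j f x ^+ 2)%:E.
  by rewrite lee_fin mulr_ge0 ?sqr_ge0// ltW// lam_gt0.
apply: (@le_trans _ _ (\int[leb]_x (C%:E * \sum_(0 <= j <oo) (lam s j * LPre chi phi j f x ^+ 2)%:E))).
  apply: ge0_le_integral => //.
  - by move=> x _; rewrite lee_fin sqr_ge0.
  - by apply/measurable_EFinP; exact: measurable_funX.
  - by apply: emeasurable_funM => //; apply: ge0_emeasurable_sum.
  - by move=> x _; apply: hC; exact: LP_reconstruction.
rewrite ge0_integralZl//; last 2 first.
- by apply: ge0_emeasurable_sum.
- by move=> x _; apply: nneseries_ge0.
apply: lee_wpmul2l; first by rewrite lee_fin.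
rewrite integral_nneseries//; apply: lee_nneseries => j _.
  by move=> _; apply: integral_ge0 => x _; exact: A0.
have -> : \int[leb]_x (lam s j * LPre chi phi j f x ^+ 2)%:E = (lam s j)%:E * sq (LPre chi phi j f).
  rewrite /sq -ge0_integralZl//.
  - by apply/measurable_EFinP; exact: measurable_funX.
  - by move=> x _; rewrite lee_fin sqr_ge0.
  - by rewrite lee_fin ltW// lam_gt0.
apply: lee_wpmul2l; first by rewrite lee_fin ltW// lam_gt0.
by rewrite /LPsq leeDl// sq_ge0.
Qed.

End reconstruction.

(** * Bernstein's inequality and increments of blocks *)

Section bernstein.
Context {R : realType} {N : nat}.
Local Notation E := 'rV[R]_N.
Local Notation leb := (lebesgue_rV R N).
Implicit Types (f g m K L : E -> R) (x y z xi : E).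
Local Notation kre := (@ifourier_re R N).
Local Notation kim := (@ifourier_im R N).

(** Uniformly tempered functions: their convolution with a rapid kernel converges absolutely with a
    bound uniform in x, as [conv_assoc] requires. Square integrable and bounded functions both
    qualify; the latter case serves for gradients. *)
Definition utemp f := measurable_fun setT (f : borel_rV R N -> R) /\
  exists B : R, forall x, (\int[leb]_y `|weight y ^- N * f (x - y)|%:E <= B%:E)%E.

Lemma utemp_conv K f C : utemp f -> measurable_fun setT (K : borel_rV R N -> R) ->
  (forall y, `|K y| <= C * weight y ^- N) ->
  exists B : R, forall x, (\int[leb]_y `|K y * f (x - y)|%:E <= B%:E)%E.
Proof.
move=> [mf [B hB]] mK KC; exists (C * B) => x.
have C0 : 0 <= C.
  have := le_trans (normr_ge0 _) (KC 0).
  by rewrite pmulr_lge0// invr_gt0 exprn_gt0// weight_gt0.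
have mfx := measurable_shift x mf.
have mw : measurable_fun setT (fun y : borel_rV R N => `|weight y ^- N * f (x - y)|%:E).
  apply/measurable_EFinP; apply: measurableT_comp => //; apply: measurable_funM => //.
  exact: measurable_weightVX.
apply: (@le_trans _ _ (\int[leb]_y (C%:E * `|weight y ^- N * f (x - y)|%:E))%E).
  apply: ge0_le_integral => //.
  - by apply/measurable_EFinP; apply: measurableT_comp => //; exact: measurable_funM.
  - by apply: emeasurable_funM.
  - move=> y _; rewrite -EFinM lee_fin !normrM mulrA ler_wpM2r// (le_trans (KC y))//.
    by rewrite ler_wpM2l// ler_norm.
by rewrite ge0_integralZl// EFinM; apply: lee_wpmul2l; [rewrite lee_fin|exact: hB].
Qed.

Lemma utemp_integrable K f C x : utemp f -> measurable_fun setT (K : borel_rV R N -> R) ->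
  (forall y, `|K y| <= C * weight y ^- N) ->
  leb.-integrable setT (EFin \o (fun y : borel_rV R N => K y * f (x - y))).
Proof.
move=> uf mK KC; have [B hB] := utemp_conv uf mK KC; have mf := uf.1.
apply/integrableP; split; last by rewrite (le_lt_trans (hB x))// ltry.
by apply/measurable_EFinP; apply: measurable_funM => //; exact: measurable_shift.
Qed.

Lemma utemp_bounded f (M : R) : measurable_fun setT (f : borel_rV R N -> R) ->
  (forall x, `|f x| <= M) -> utemp f.
Proof.
move=> mf fM; split=> //.
have M0 : 0 <= M by exact: le_trans (fM 0).
have iw := @integrable_weightVX R N N (leqnn N).
have w0 (y : E) : 0 <= weight y ^- N by rewrite invr_ge0 exprn_ge0// ltW// weight_gt0.
exists (M * \int[leb]_y (weight y ^- N)) => x.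
have -> : (M * \int[leb]_y (weight y ^- N : R))%:E = (\int[leb]_y (M%:E * (weight y ^- N)%:E))%E.
  rewrite ge0_integralZl//; last 2 first.
  - by apply/measurable_EFinP; exact: measurable_weightVX.
  - by move=> y _; rewrite lee_fin.
  by rewrite EFinM; congr (_ * _)%E; rewrite /Rintegral fineK//; exact: integrable_fin_num iw.
apply: ge0_le_integral => //.
- apply/measurable_EFinP; apply: measurableT_comp => //; apply: measurable_funM.
    exact: measurable_weightVX.
  exact: measurable_shift.
- by apply: emeasurable_funM => //; apply/measurable_EFinP; exact: measurable_weightVX.
- by move=> y _; rewrite -EFinM lee_fin normrM (ger0_norm (w0 y)) mulrC ler_wpM2r.
Qed.

Lemma sq_lty_of_le_weight f C : measurable_fun setT (f : borel_rV R N -> R) ->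
  (forall x, `|f x| <= C * weight x ^- N) -> (sq f < +oo)%E.
Proof.
move=> mf fC.
have w0 (y : E) : 0 <= weight y ^- N by rewrite invr_ge0 exprn_ge0// ltW// weight_gt0.
have h x : `|f x ^+ 2| <= C ^+ 2 * weight x ^- N.
  rewrite normrX (@le_trans _ _ ((C * weight x ^- N) ^+ 2))//.
    by apply: lerXn2r; rewrite ?nnegrE// (le_trans _ (fC x)).
  rewrite exprMn ler_wpM2l ?sqr_ge0// expr2 ler_piMr//.
  by rewrite invf_le1 ?exprn_gt0 ?weight_gt0// exprn_ege1// weight_ge1.
have /integrableP[_] := integrable_le_weight (leqnn N) (measurable_funX 2 mf) h.
by under eq_integral => x _ do rewrite /= ger0_norm ?sqr_ge0//.
Qed.

Lemma rapid_sq_lty K : rapid K -> (sq K < +oo)%E.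
Proof.
move=> rK; have [C KC] := rK.2 N; exact: (sq_lty_of_le_weight (rapid_measurable rK) KC).
Qed.

Lemma utemp_L2 f : measurable_fun setT (f : borel_rV R N -> R) -> (sq f < +oo)%E -> utemp f.
Proof.
move=> mf sf; split => //.
have mw := @measurable_weightVX R N N.
have w2 : (sq (fun x : E => weight x ^- N)%R < +oo)%E.
  apply: (@sq_lty_of_le_weight _ 1) => // x.
  by rewrite mul1r ger0_norm// invr_ge0 exprn_ge0// ltW// weight_gt0.
have hfin : (nrm2 (fun x : E => weight x ^- N)%R * nrm2 f < +oo)%E.
  by rewrite lte_mul_pinfty ?nrm2_ge0// ?nrm2_lty// ge0_fin_numE ?nrm2_ge0// nrm2_lty.
exists (fine (nrm2 (fun x : E => weight x ^- N)%R * nrm2 f)) => x.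
rewrite fineK ?ge0_fin_numE ?mule_ge0 ?nrm2_ge0//.
exact: conv_sup_le.
Qed.

Lemma convolve_decay L K : rapid L -> rapid K -> exists C : R, forall x,
  `|convolve L K x| <= C * weight x ^- N.
Proof.
(* Decay of order 2 N for [L]: N powers are exchanged by Peetre's inequality for decay in x, and N
   make the integral over y converge. *)
move=> rL rK; have [C1 LC] := rL.2 (N + N)%N; have [C2 KC] := rK.2 N.
have mL := rapid_measurable rL; have mK := rapid_measurable rK.
have pw k (c : R) (h : E -> R) : (forall x, `|h x| <= c * weight x ^- k) -> 0 <= c.
  move=> hc; have := le_trans (normr_ge0 _) (hc 0).
  by rewrite pmulr_lge0// invr_gt0 exprn_gt0// weight_gt0.
have C10 := pw _ _ _ LC; have C20 := pw _ _ _ KC.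
have iw := @integrable_weightVX R N N (leqnn N).
exists (C1 * C2 * 2 ^+ N * \int[leb]_y (weight y ^- N)) => x.
have wv (a : E) i : 0 <= weight a ^- i by rewrite invr_ge0 exprn_ge0// ltW// weight_gt0.
have wNy (y : E) : weight (- y) = weight y.
  by rewrite !weightE; congr (_ + _); apply: eq_bigr => i _; rewrite mxE sqrrN.
have pt y : `|L y * K (x - y)| <= C1 * C2 * 2 ^+ N * weight x ^- N * weight y ^- N.
  rewrite normrM (@le_trans _ _ (C1 * weight y ^- (N + N) * (C2 * weight (x - y) ^- N)))//.
    by apply: ler_pM.
  have hw : weight y ^- N * weight (x - y) ^- N <= 2 ^+ N * weight x ^- N.
    have := weight_sub_leX N (x - y) (- y); rewrite opprK subrK wNy => h.
    rewrite ler_pdivlMr ?exprn_gt0 ?weight_gt0// -invfM mulrC ler_pdivrMr.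
      rewrite (le_trans h)// !exprMn le_eqVlt; apply/orP; left; apply/eqP; ring.
    by rewrite mulr_gt0 ?exprn_gt0 ?weight_gt0.
  have -> : C1 * weight y ^- (N + N) * (C2 * weight (x - y) ^- N) =
    C1 * C2 * weight y ^- N * (weight y ^- N * weight (x - y) ^- N).
    by rewrite exprD invfM; ring.
  rewrite (@le_trans _ _ (C1 * C2 * weight y ^- N * (2 ^+ N * weight x ^- N)))//.
    by apply: ler_wpM2l => //; apply: mulr_ge0 => //; exact: mulr_ge0.
  by rewrite le_eqVlt; apply/orP; left; apply/eqP; ring.
have mLK : measurable_fun setT (fun y : borel_rV R N => L y * K (x - y)).
  by apply: measurable_funM => //; exact: measurable_shift.
have iG := integrableZl measurableT (C1 * C2 * 2 ^+ N * weight x ^- N) iw.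
have iLK : leb.-integrable setT (EFin \o (fun y : borel_rV R N => L y * K (x - y))).
  apply: (le_integrable measurableT _ _ iG); first exact/measurable_EFinP.
  by move=> y _ /=; rewrite lee_fin (le_trans (pt y))// ler_norm.
apply: (le_trans (le_normr_Rintegral measurableT iLK)).
apply: (@le_trans _ _ (\int[leb]_y (C1 * C2 * 2 ^+ N * weight x ^- N * weight y ^- N))).
  by apply: le_Rintegral => //; exact: integrable_norm.
by rewrite (RintegralZl _ measurableT iw) mulrAC.
Qed.

Lemma convolveB K1 K2 f x :
  leb.-integrable setT (EFin \o (fun y : borel_rV R N => K1 y * f (x - y))) ->
  leb.-integrable setT (EFin \o (fun y : borel_rV R N => K2 y * f (x - y))) ->
  convolve (fun y => K1 y - K2 y) f x = convolve K1 f x - convolve K2 f x.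
Proof.
move=> i1 i2; rewrite /convolve -RintegralB//.
by apply: eq_Rintegral => y _; rewrite mulrBl.
Qed.

Lemma convolveD K1 K2 f x :
  leb.-integrable setT (EFin \o (fun y : borel_rV R N => K1 y * f (x - y))) ->
  leb.-integrable setT (EFin \o (fun y : borel_rV R N => K2 y * f (x - y))) ->
  convolve (fun y => K1 y + K2 y) f x = convolve K1 f x + convolve K2 f x.
Proof.
move=> i1 i2; rewrite /convolve -RintegralD//.
by apply: eq_Rintegral => y _; rewrite mulrDl.
Qed.

(** [kernel_conv] combined with associativity. A block becomes the convolution of itself with a
    wider kernel, so that its pointwise size and its increments can be read off from its own L2
    norm. *)
Lemma reproducing m1 m2 f x : is_bump m1 -> is_bump m2 -> (forall xi, m1 xi * m2 xi = m2 xi) ->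
  utemp f ->
  convolve (kre m2) f x =
    convolve (kre m1) (convolve (kre m2) f) x - convolve (kim m1) (convolve (kim m2) f) x /\
  convolve (kim m2) f x =
    convolve (kre m1) (convolve (kim m2) f) x + convolve (kim m1) (convolve (kre m2) f) x.
Proof.
move=> b1 b2 m12 uf; have mf := uf.1.
have [r1 i1] := rapid_kernel b1; have [r2 i2] := rapid_kernel b2.
have assoc L K : rapid L -> rapid K -> convolve L (convolve K f) x = convolve (convolve L K) f x.
  move=> rL rK; have [C KC] := rK.2 N.
  have [B hB] := utemp_conv uf (rapid_measurable rK) KC.
  exact: conv_assoc hB.
have int L K : rapid L -> rapid K ->
    leb.-integrable setT (EFin \o (fun y : borel_rV R N => convolve L K y * f (x - y))).
  move=> rL rK; have [C LK] := convolve_decay rL rK.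
  apply: (utemp_integrable x uf _ LK).
  by apply: measurable_conv; exact: rapid_measurable.
have E1 : kre m2 = (fun y => convolve (kre m1) (kre m2) y - convolve (kim m1) (kim m2) y).
  by apply/funext => y; exact: (kernel_conv y b1 b2 m12).1.
have E2 : kim m2 = (fun y => convolve (kre m1) (kim m2) y + convolve (kim m1) (kre m2) y).
  by apply/funext => y; exact: (kernel_conv y b1 b2 m12).2.
split.
  rewrite (assoc _ _ r1 r2) (assoc _ _ i1 i2) -(convolveB (int _ _ r1 r2) (int _ _ i1 i2)).
  by congr (convolve _ f x); exact: E1.
rewrite (assoc _ _ r1 i2) (assoc _ _ i1 r2) -(convolveD (int _ _ r1 i2) (int _ _ i1 r2)).
by congr (convolve _ f x); exact: E2.
Qed.

Local Open Scope ereal_scope.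

Lemma sq_conv_sup K g x :
  measurable_fun setT (K : borel_rV R N -> R) -> measurable_fun setT (g : borel_rV R N -> R) ->
  ((convolve K g x) ^+ 2)%:E <= sq K * sq g.
Proof.
move=> mK mg; have h := conv_le_nrm2 x mK mg.
rewrite -(real_normK (num_real (convolve K g x))) expr2 EFinM -!nrm2_sq muleACA.
by apply: lee_pmul; rewrite ?lee_fin.
Qed.

Lemma lee_add_mul (a b c d : \bar R) : 0 <= a -> 0 <= b -> 0 <= c -> 0 <= d ->
  a * c + b * d <= (a + b) * (c + d).
Proof.
move=> a0 b0 c0 d0; have cd0 : 0 <= c + d by exact: adde_ge0.
rewrite (ge0_muleDl (c + d) a0 b0); apply: leeD; apply: lee_wpmul2l => //.
  by rewrite leeDl.
by rewrite leeDr.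
Qed.

Lemma sq_conv_pair P Q A B x :
  measurable_fun setT (P : borel_rV R N -> R) -> measurable_fun setT (Q : borel_rV R N -> R) ->
  measurable_fun setT (A : borel_rV R N -> R) -> measurable_fun setT (B : borel_rV R N -> R) ->
  ((convolve P A x - convolve Q B x) ^+ 2)%:E <= 2%:E * ((sq P + sq Q) * (sq A + sq B)) /\
  ((convolve P A x + convolve Q B x) ^+ 2)%:E <= 2%:E * ((sq P + sq Q) * (sq A + sq B)).
Proof.
move=> mP mQ mA mB.
have hA := sq_conv_sup x mP mA; have hB := sq_conv_sup x mQ mB.
have h : (convolve P A x ^+ 2)%:E + (convolve Q B x ^+ 2)%:E <= (sq P + sq Q) * (sq A + sq B).
  by apply: (le_trans (leeD hA hB)); exact: (lee_add_mul (sq_ge0 _) (sq_ge0 _) (sq_ge0 _) (sq_ge0 _)).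
have h2 : 2%:E * ((convolve P A x ^+ 2)%:E + (convolve Q B x ^+ 2)%:E) <=
  2%:E * ((sq P + sq Q) * (sq A + sq B)) by apply: lee_wpmul2l; rewrite ?lee_fin.
split; apply: le_trans h2; rewrite -EFinD -EFinM lee_fin.
  have := sqr_ge0 (convolve P A x + convolve Q B x); lra.
have := sqr_ge0 (convolve P A x - convolve Q B x); lra.
Qed.

(** At c = 2^(j + 1) this factor c^N is the frequency factor of Bernstein's inequality. *)
Lemma sq_dilation K (c : R) : (0 < c)%R -> measurable_fun setT (K : borel_rV R N -> R) ->
  sq (fun y => c ^+ N * K (c *: y))%R = (c ^+ N)%:E * sq K.
Proof.
move=> c0 mK; have cn : c != 0%R by rewrite gt_eqF.
have mK2 : measurable_fun setT (fun y : borel_rV R N => (K y ^+ 2)%:E).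
  by apply/measurable_EFinP; exact: measurable_funX.
have mKc : measurable_fun setT (fun y : borel_rV R N => K (c *: y)).
  have := measurableT_comp mK (measurable_affine_rV c 0).
  by under [X in measurable_fun _ X -> _]funext => y do rewrite /= addr0.
have := ge0_integral_affine_rV 0 cn mK2 (fun y => ltac:(by rewrite lee_fin sqr_ge0)).
under eq_integral => y _ do rewrite addr0.
rewrite gtr0_norm// => h.
rewrite /sq; under eq_integral => y _ do rewrite exprMn EFinM.
rewrite ge0_integralZl//; last 3 first.
- by apply/measurable_EFinP; exact: measurable_funX.
- by move=> y _; rewrite lee_fin sqr_ge0.
- by rewrite lee_fin sqr_ge0.
rewrite h muleA -EFinM; congr (_%:E * _).
by rewrite expr2 mulfK// expf_neq0.
Qed.

End bernstein.

Section lipschitz.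
Context {R : realType} {N : nat}.
Local Notation E := 'rV[R]_N.
Local Notation leb := (lebesgue_rV R N).
Implicit Types (f g m K L : E -> R) (x y z xi : E).
Local Notation kre := (@ifourier_re R N).
Local Notation kim := (@ifourier_im R N).

Definition shift_diff z K y := K (y + z) - K y.

Lemma measurable_translate z f : measurable_fun setT (f : borel_rV R N -> R) ->
  measurable_fun setT (fun y : borel_rV R N => f (y + z)).
Proof.
move=> mf; have := measurableT_comp mf (measurable_affine_rV 1 z).
by under [X in measurable_fun _ X -> _]funext => y do rewrite /= scale1r.
Qed.

Lemma measurable_shift_diff z K : measurable_fun setT (K : borel_rV R N -> R) ->
  measurable_fun setT (shift_diff z K : borel_rV R N -> R).
Proof. by move=> mK; apply: measurable_funB => //; exact: measurable_translate. Qed.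

Lemma sq_translate z f : measurable_fun setT (f : borel_rV R N -> R) ->
  sq (fun y => f (y + z)) = sq f.
Proof.
move=> mf; rewrite /sq.
have mf2 : measurable_fun setT (fun y : borel_rV R N => (f y ^+ 2)%:E).
  by apply/measurable_EFinP; exact: measurable_funX.
have f0 (y : E) : (0 <= (f y ^+ 2)%:E)%E by rewrite lee_fin sqr_ge0.
have := ge0_integral_affine_rV z (oner_neq0 R) mf2 f0.
rewrite normr1 expr1n invr1 mul1e => <-.
by apply: eq_integral => y _; rewrite scale1r.
Qed.

Lemma sq_lty_cst (c : R) f : measurable_fun setT (f : borel_rV R N -> R) ->
  sq (fun x => c * f x) = ((c ^+ 2)%:E * sq f)%E.
Proof.
move=> mf; rewrite /sq -ge0_integralZl//.
- by apply: eq_integral => x _; rewrite exprMn EFinM.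
- by apply/measurable_EFinP; exact: measurable_funX.
- by move=> x _; rewrite lee_fin sqr_ge0.
- by rewrite lee_fin sqr_ge0.
Qed.

Lemma sq_le f g : measurable_fun setT (f : borel_rV R N -> R) ->
  measurable_fun setT (g : borel_rV R N -> R) -> (forall x, `|f x| <= g x) -> (sq f <= sq g)%E.
Proof.
move=> mf mg fg; apply: ge0_le_integral => //.
- by move=> x _; rewrite lee_fin sqr_ge0.
- by apply/measurable_EFinP; exact: measurable_funX.
- by apply/measurable_EFinP; exact: measurable_funX.
- move=> x _; rewrite lee_fin -(real_normK (num_real (f x))).
  by apply: lerXn2r; rewrite ?nnegrE// (le_trans _ (fg x)).
Qed.

Lemma sq_sub_le f g : measurable_fun setT (f : borel_rV R N -> R) ->
  measurable_fun setT (g : borel_rV R N -> R) ->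
  (sq (fun x => f x - g x)%R <= 2%:E * sq f + 2%:E * sq g)%E.
Proof.
move=> mf mg.
have m2 h : measurable_fun setT (h : borel_rV R N -> R) ->
    measurable_fun setT (fun x : borel_rV R N => (h x ^+ 2)%:E).
  by move=> mh; apply/measurable_EFinP; exact: measurable_funX.
have h0 h x : (0 <= (h x ^+ 2)%:E :> \bar R)%E by rewrite lee_fin sqr_ge0.
rewrite /sq -!ge0_integralZl//; [|exact: m2|exact: m2].
rewrite -ge0_integralD//; last 4 first.
- by move=> x _; rewrite mule_ge0.
- by apply: emeasurable_funM => //; exact: m2.
- by move=> x _; rewrite mule_ge0.
- by apply: emeasurable_funM => //; exact: m2.
apply: ge0_le_integral => //.
- by move=> x _; rewrite lee_fin sqr_ge0.
- by apply: m2; exact: measurable_funB.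
- by apply: emeasurable_funD; apply: emeasurable_funM => //; exact: m2.
move=> x _; rewrite -!EFinM -EFinD lee_fin.
by have := sqr_ge0 (f x + g x); nra.
Qed.

(** Small increments use [kernel_increment], whose weight is square integrable; for [l1 z > 1] the
    triangle inequality is enough, since then the square of [l1 z] exceeds 1. Large z matter because
    the bound is applied to the dilates 2^(j + 1) z. *)
Lemma sq_shift_diff_kernel m : is_bump m -> exists C : R, 0 <= C /\ forall z,
  (sq (shift_diff z (kre m)) + sq (shift_diff z (kim m)) <= (C * l1 z ^+ 2)%:E)%E.
Proof.
move=> bm; have [rr ri] := rapid_kernel bm.
have mr := rapid_measurable rr; have mi := rapid_measurable ri.
have [C [C0 hC]] := kernel_increment N bm.
have mw := @measurable_weightVX R N N.
have w0 (y : E) : 0 <= weight y ^- N by rewrite invr_ge0 exprn_ge0// ltW// weight_gt0.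
have W : (sq (fun x : E => weight x ^- N)%R < +oo)%E.
  apply: (@sq_lty_of_le_weight _ _ _ 1) => // x.
  by rewrite mul1r ger0_norm.
have sr := rapid_sq_lty rr; have si := rapid_sq_lty ri.
have fin f : (sq f < +oo)%E -> sq f = (fine (sq f))%:E.
  by move=> h; rewrite fineK// ge0_fin_numE// sq_ge0.
have f0 f : 0 <= fine (sq f) by rewrite fine_ge0// sq_ge0.
pose w := fine (sq (fun x : E => weight x ^- N)%R).
pose a := fine (sq (kre m)); pose b := fine (sq (kim m)).
exists (2 * C ^+ 2 * w + 4 * (a + b)); split.
  apply: addr_ge0; apply: mulr_ge0 => //; first by rewrite mulr_ge0// sqr_ge0.
    exact: f0.
  by apply: addr_ge0; exact: f0.
move=> z; have l0 := l1_ge0 z.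
have [z1|z1] := leP (l1 z) 1.
  have key K : measurable_fun setT (K : borel_rV R N -> R) ->
      (forall x, `|K (x + z) - K x| <= C * l1 z * weight x ^- N) ->
      (sq (shift_diff z K) <= (C ^+ 2 * w * l1 z ^+ 2)%:E)%E.
    move=> mK hK; apply: (@le_trans _ _ (sq (fun x => C * l1 z * weight x ^- N))).
      apply: sq_le => //; first exact: measurable_shift_diff.
      by apply: measurable_funM.
    by rewrite sq_lty_cst// (fin _ W) -EFinM lee_fin -/w exprMn mulrAC.
  apply: (@le_trans _ _ ((C ^+ 2 * w * l1 z ^+ 2)%:E + (C ^+ 2 * w * l1 z ^+ 2)%:E)%E).
    by apply: leeD; apply: key => // x; have [] := hC x z z1.
  have -> : (2 * C ^+ 2 * w + 4 * (a + b)) * l1 z ^+ 2 = C ^+ 2 * w * l1 z ^+ 2 +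
      C ^+ 2 * w * l1 z ^+ 2 + 4 * (a + b) * l1 z ^+ 2 by ring.
  rewrite -EFinD lee_fin lerDl; apply: mulr_ge0; last exact: sqr_ge0.
  by apply: mulr_ge0 => //; apply: addr_ge0; exact: f0.
have key K : measurable_fun setT (K : borel_rV R N -> R) -> (sq K < +oo)%E ->
    (sq (shift_diff z K) <= (4 * fine (sq K) * l1 z ^+ 2)%:E)%E.
  move=> mK sK; apply: (le_trans (sq_sub_le (measurable_translate z mK) mK)).
  rewrite sq_translate// (fin _ sK) -!EFinM -EFinD lee_fin /=.
  have := f0 K; have : 1 <= l1 z ^+ 2 by rewrite exprn_ege1// ltW.
  by nra.
apply: (le_trans (leeD (key _ mr sr) (key _ mi si))).
have -> : (2 * C ^+ 2 * w + 4 * (a + b)) * l1 z ^+ 2 = 4 * a * l1 z ^+ 2 +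
    4 * b * l1 z ^+ 2 + 2 * (C ^+ 2 * w * l1 z ^+ 2) by ring.
rewrite -EFinD lee_fin lerDl; apply: mulr_ge0 => //.
by rewrite !mulr_ge0 ?sqr_ge0// f0.
Qed.

Lemma convolve_translate K g x z :
  leb.-integrable setT (EFin \o (fun y : borel_rV R N => K y * g (x + z - y))) ->
  convolve K g (x + z) = convolve (fun y => K (y + z)) g x.
Proof.
move=> /(Rintegral_affine_rV z (oner_neq0 R)).
rewrite normr1 expr1n invr1 mul1r /convolve => <-.
by apply: eq_Rintegral => y _; rewrite scale1r; congr (_ * g _); rewrite opprD addrACA subrr addr0.
Qed.

Variables (chi phi : E -> R).
Hypothesis hLP : LP_pair chi phi.
Local Notation S := (LP_symbol chi phi).

Let p2 j : 0 < 2 ^+ j :> R. Proof. by rewrite exprn_gt0. Qed.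

(** The widened cut-off of block j. Being a dilate of the single symbol [chi], it yields constants
    that depend on j only through powers of 2^(j + 1). *)
Local Notation fat j := (fun xi => chi ((2 ^+ j.+1)^-1 *: xi)).

Let bump_fat j : is_bump (fat j).
Proof. by apply: bump_dilation (bump_chi hLP); rewrite invr_eq0 gt_eqF. Qed.

Lemma LP_reproducing j f x : utemp f ->
  LPre chi phi j f x =
    convolve (kre (fat j)) (LPre chi phi j f) x - convolve (kim (fat j)) (LPim chi phi j f) x /\
  LPim chi phi j f x =
    convolve (kre (fat j)) (LPim chi phi j f) x + convolve (kim (fat j)) (LPre chi phi j f) x.
Proof.
by move=> uf; apply: reproducing => //; [exact: bump_LP_symbol|exact: chi_LP_symbol].
Qed.

Local Open Scope ereal_scope.

Let fin f : sq f < +oo -> sq f = (fine (sq f))%:E.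
Proof. by move=> h; rewrite fineK// ge0_fin_numE// sq_ge0. Qed.

(** Reproduce the block by the wider kernel and apply Cauchy-Schwarz. The factor (2^(j + 1))^N comes
    from the squared L2 norm of the dilated kernel, and the factor 2 from combining real and
    imaginary parts. *)
Lemma bernstein : exists C : R, (0 <= C)%R /\ forall j f x, utemp f ->
  (LPre chi phi j f x ^+ 2)%:E <= (C * (2 ^+ j.+1) ^+ N)%:E * LPsq chi phi j f /\
  (LPim chi phi j f x ^+ 2)%:E <= (C * (2 ^+ j.+1) ^+ N)%:E * LPsq chi phi j f.
Proof.
have [rr ri] := rapid_kernel (bump_chi hLP).
have mr := rapid_measurable rr; have mi := rapid_measurable ri.
have sr := rapid_sq_lty rr; have si := rapid_sq_lty ri.
exists (2 * (fine (sq (kre chi)) + fine (sq (kim chi))))%R; split.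
  by rewrite mulr_ge0// addr_ge0// fine_ge0// sq_ge0.
move=> j f x uf.
have [fr fi] := rapid_kernel (bump_fat j).
have [h1 h2] := LP_reproducing j x uf.
have mA := measurable_LPre hLP j uf.1; have mB := measurable_LPim hLP j uf.1.
have [k1 _] := sq_conv_pair x (rapid_measurable fr) (rapid_measurable fi) mA mB.
have [_ k2] := sq_conv_pair x (rapid_measurable fr) (rapid_measurable fi) mB mA.
have -> : (2 * (fine (sq (kre chi)) + fine (sq (kim chi))) * 2 ^+ j.+1 ^+ N)%:E =
    2%:E * (sq (kre (fat j)) + sq (kim (fat j))).
  have -> : kre (fat j) = (fun y => (2 ^+ j.+1) ^+ N * kre chi (2 ^+ j.+1 *: y))%R.
    by apply/funext => y; rewrite (kernel_scale y (p2 j.+1) (bump_chi hLP)).1.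
  have -> : kim (fat j) = (fun y => (2 ^+ j.+1) ^+ N * kim chi (2 ^+ j.+1 *: y))%R.
    by apply/funext => y; rewrite (kernel_scale y (p2 j.+1) (bump_chi hLP)).2.
  rewrite !sq_dilation//; move: sr si (sq_ge0 (kre chi)) (sq_ge0 (kim chi)).
  case: (sq (kre chi)) => [a| |]//; case: (sq (kim chi)) => [b| |]// _ _ _ _.
  by rewrite -(EFinM _ a) -(EFinM _ b) -EFinD -EFinM /=; congr EFin; ring.
have E1 : (LPre chi phi j f x ^+ 2)%:E = ((convolve (kre (fat j)) (LPre chi phi j f) x -
      convolve (kim (fat j)) (LPim chi phi j f) x) ^+ 2)%:E by rewrite -h1.
have E2 : (LPim chi phi j f x ^+ 2)%:E = ((convolve (kre (fat j)) (LPim chi phi j f) x +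
      convolve (kim (fat j)) (LPre chi phi j f) x) ^+ 2)%:E by rewrite -h2.
split; rewrite -muleA; first by rewrite E1; exact: k1.
rewrite E2.
by rewrite /LPsq (addeC (sq (LPre _ _ _ _))); exact: k2.
Qed.

(** The increment is put on the wider kernel. Of the N + 2 powers, N come from its L2 norm and 2
    from the dilation of z. *)
Lemma LP_increment : exists C : R, (0 <= C)%R /\ forall j f x z, utemp f ->
  LPsq chi phi j f < +oo ->
  ((LPre chi phi j f (x + z) - LPre chi phi j f x) ^+ 2)%:E <=
    (C * (2 ^+ j.+1) ^+ N.+2 * l1 z ^+ 2)%:E * LPsq chi phi j f.
Proof.
have [rr ri] := rapid_kernel (bump_chi hLP).
have mr := rapid_measurable rr; have mi := rapid_measurable ri.
have [C [C0 hC]] := sq_shift_diff_kernel (bump_chi hLP).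
exists (2 * C)%R; split; first by rewrite mulr_ge0.
move=> j f x z uf Df.
have [fr fi] := rapid_kernel (bump_fat j).
have mfr := rapid_measurable fr; have mfi := rapid_measurable fi.
have mA := measurable_LPre hLP j uf.1; have mB := measurable_LPim hLP j uf.1.
have uA : utemp (LPre chi phi j f).
  by apply: utemp_L2 => //; apply: le_lt_trans Df; rewrite leeDl// sq_ge0.
have uB : utemp (LPim chi phi j f).
  by apply: utemp_L2 => //; apply: le_lt_trans Df; rewrite leeDr// sq_ge0.
have int K g y : rapid K -> utemp g ->
    leb.-integrable setT (EFin \o (fun y' : borel_rV R N => K y' * g (y - y'))%R).
  by move=> rK ug; have [D KD] := rK.2 N; apply: (utemp_integrable y ug (rapid_measurable rK) KD).
have diffE K g : rapid K -> utemp g ->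
    (convolve K g (x + z) - convolve K g x = convolve (shift_diff z K) g x)%R.
  move=> rK ug; rewrite convolve_translate; last exact: int.
  rewrite -convolveB//; last exact: int.
  have := integrable_affine_rV z (oner_neq0 R) (int K g (x + z)%R rK ug).
  apply: eq_integrable => // y _ /=; rewrite scale1r; congr (_ * g _)%:E.
  by rewrite opprD addrACA subrr addr0.
have -> : (LPre chi phi j f (x + z) - LPre chi phi j f x =
    convolve (shift_diff z (kre (fat j))) (LPre chi phi j f) x -
    convolve (shift_diff z (kim (fat j))) (LPim chi phi j f) x)%R.
  rewrite -(diffE _ _ fr uA) -(diffE _ _ fi uB).
  rewrite (LP_reproducing j (x + z) uf).1 (LP_reproducing j x uf).1.
  have aux (a b c d : R) : (a - b - (c - d) = a - c - (b - d))%R by ring.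
  exact: aux.
have [k1 _] := sq_conv_pair x (measurable_shift_diff z mfr) (measurable_shift_diff z mfi) mA mB.
apply: (le_trans k1); rewrite muleA; apply: lee_wpmul2r; first exact: LPsq_ge0.
have scE K : measurable_fun setT (K : borel_rV R N -> R) ->
   sq (shift_diff z (fun y => (2 ^+ j.+1) ^+ N * K (2 ^+ j.+1 *: y))%R) =
   ((2 ^+ j.+1) ^+ N)%:E * sq (shift_diff (2 ^+ j.+1 *: z) K).
  move=> mK; rewrite -sq_dilation//; last exact: measurable_shift_diff.
  by congr sq; apply/funext => y; rewrite /shift_diff scalerDr mulrBr.
have -> : kre (fat j) = (fun y => (2 ^+ j.+1) ^+ N * kre chi (2 ^+ j.+1 *: y))%R.
  by apply/funext => y; rewrite (kernel_scale y (p2 j.+1) (bump_chi hLP)).1.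
have -> : kim (fat j) = (fun y => (2 ^+ j.+1) ^+ N * kim chi (2 ^+ j.+1 *: y))%R.
  by apply/funext => y; rewrite (kernel_scale y (p2 j.+1) (bump_chi hLP)).2.
rewrite !scE// -ge0_muleDr ?sq_ge0//.
have h := hC (2 ^+ j.+1 *: z).
apply: (@le_trans _ _ (2%:E * (((2 ^+ j.+1) ^+ N)%:E * (C * l1 (2 ^+ j.+1 *: z) ^+ 2)%:E))).
  apply: lee_wpmul2l; first by rewrite lee_fin.
  by apply: lee_wpmul2l => //; rewrite lee_fin exprn_ge0.
rewrite -!EFinM lee_fin l1Z exprMn (ger0_norm (x := 2 ^+ j.+1)) ?exprn_ge0//.
rewrite le_eqVlt; apply/orP; left; apply/eqP.
have -> : ((2 ^+ j.+1) ^+ N.+2 = (2 ^+ j.+1) ^+ N * (2 ^+ j.+1) ^+ 2 :> R)%R.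
  by rewrite -exprD addn2.
by ring.
Qed.

Lemma LPsq_le_sqnorm (s : R) j f : measurable_fun setT (f : borel_rV R N -> R) ->
  (lam s j)%:E * LPsq chi phi j f <= sqnorm chi phi s f.
Proof.
move=> mf; rewrite (sqnormE hLP)//.
have l0 k : 0 <= (lam s k)%:E * LPsq chi phi k f.
  by rewrite mule_ge0 ?LPsq_ge0// lee_fin ltW// lam_gt0.
apply: (@le_trans _ _ (\sum_(0 <= k < j.+1) (lam s k)%:E * LPsq chi phi k f)).
  by rewrite big_nat_recr//= leeDr// sume_ge0.
exact: nneseries_lim_ge.
Qed.

Lemma LPsq_lty (s : R) j f : measurable_fun setT (f : borel_rV R N -> R) ->
  sqnorm chi phi s f < +oo -> LPsq chi phi j f < +oo.
Proof.
move=> mf h; have := le_lt_trans (LPsq_le_sqnorm s j mf) h.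
have := LPsq_ge0 chi phi j f; case: (LPsq _ _ _ _) => [r| |]//; first by move=> _ _; rewrite ltry.
by rewrite gt0_muley ?lte_fin ?lam_gt0.
Qed.

(** Because 2 sigma = N + 2: increments of blocks cost exactly the Besov weight of order sigma.
    Passing from j - 1 to j + 1 accounts for 4^(N + 2). *)
Lemma lam_sigma j : ((2 ^+ j.+1) ^+ N.+2 = 4 ^+ N.+2 * lam (sigma R N) j)%R.
Proof.
have n0 : (2%R : R) != 0%R by rewrite pnatr_eq0.
have -> : (4%R : R) = (2 ^+ 2)%R by rewrite -natrX.
rewrite /lam -!exprM -!powR_mulrn ?powR_ge0// -powRrM -powRD; last by rewrite n0 implybT.
by congr (powR _ _); rewrite /sigma !natrM -!natr1; field.
Qed.

(** The embedding of the space of order sigma + e into Lipschitz functions: sigma pays for the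
    increments of the blocks, and e > 0 makes their series summable. *)
Lemma lipschitz_of_sqnorm (e : R) : (0 < e)%R -> exists C : R, (0 <= C)%R /\
  forall f x z, tempered f -> continuous f -> utemp f ->
  sqnorm chi phi (sigma R N + e) f < +oo ->
  ((f (x + z) - f x) ^+ 2)%:E <= (C * l1 z ^+ 2)%:E * sqnorm chi phi (sigma R N + e) f.
Proof.
move=> e0; have [C1 [C10 hC1]] := sq_series_le e0; have [C2 [C20 hC2]] := LP_increment.
exists (C1 * (C2 * 4 ^+ N.+2))%R; split; first by apply: mulr_ge0 => //; apply: mulr_ge0 => //; exact: exprn_ge0.
move=> f x z tf cf uf sf; have mf := uf.1.
have c1 := LP_reconstruction hLP (x := x + z) tf cf.
have c2 := LP_reconstruction hLP (x := x) tf cf.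
have c3 : (\sum_(0 <= j < J) (LPre chi phi j f (x + z) - LPre chi phi j f x))%R @[J --> \oo] -->
    (f (x + z) - f x)%R.
  have c12 := cvgB c1 c2; have {}c12 := c12 eventually_filter.
  by apply: cvg_trans c12; apply: near_eq_cvg; apply: nearW => J; rewrite sumrB.
apply: (le_trans (hC1 _ _ c3)).
rewrite -mulrA EFinM -muleA; apply: lee_wpmul2l; first by rewrite lee_fin.
rewrite (sqnormE hLP)//.
have l0 j : 0 <= (lam (sigma R N + e) j)%:E * LPsq chi phi j f.
  by rewrite mule_ge0 ?LPsq_ge0// lee_fin ltW// lam_gt0.
rewrite -(nneseriesZl (f := fun j => (lam (sigma R N + e) j)%:E * LPsq chi phi j f))//.
apply: lee_nneseries => j _.
  by move=> _; rewrite lee_fin mulr_ge0 ?sqr_ge0// ltW// lam_gt0.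
rewrite EFinM; apply: (le_trans (lee_wpmul2l _ (hC2 j f x z uf (LPsq_lty j mf sf)))).
  by rewrite lee_fin ltW// lam_gt0.
rewrite !muleA -!EFinM lam_sigma lamD le_eqVlt; apply/orP; left; apply/eqP.
by congr (_%:E * _); ring.
Qed.

End lipschitz.

(** * Lipschitz dependence on time *)

Section real_induction.
Context {R : realType}.

(** Consider the supremum of the initial segments on which P holds: it satisfies P by the closure
    premise and can be passed by the extension premise. This suits mean value inequalities that rest
    on one-sided difference quotients. *)
Lemma real_induction (P : R -> Prop) (s : R) : P s ->
  (forall r, s <= r -> P r -> exists2 d : R, 0 < d & forall r', r < r' < r + d -> P r') ->
  (forall c, s < c -> (forall r, s <= r < c -> P r) -> P c) ->
  forall t, s <= t -> P t.
Proof.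
move=> Ps ext clo t st; apply: contrapT => nPt.
pose A := [set r : R | s <= r <= t /\ forall r', s <= r' <= r -> P r'].
have As : A s.
  split; first by rewrite lexx.
  by move=> r' h; have -> : r' = s by apply/eqP; rewrite eq_le andbC.
have hA : has_sup A.
  by split; [exists s|exists t => r [/andP[_]]].
have below r : s <= r < sup A -> P r.
  move=> /andP[sr rA]; have rA' : 0 < sup A - r by rewrite subr_gt0.
  have [a [_ ha] h] := sup_adherent rA' hA.
  by apply: ha; rewrite sr /=; move: h; lra.
have sA : s <= sup A by exact: sup_upper_bound.
have At : sup A <= t by apply: ge_sup => [|r [/andP[_]]//]; exists s.
have PA : P (sup A).
  move: sA; rewrite le_eqVlt => /orP[/eqP <-//|sA]; exact: clo.
have {}At : sup A < t.
  by rewrite lt_neqAle At andbT; apply/eqP => E; apply: nPt; rewrite -E.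
have [d d0 hd] := ext _ sA PA.
pose c := Order.min (sup A + d / 2) t.
have cA : sup A < c by rewrite lt_min At andbT ltrDl divr_gt0.
have cd : c < sup A + d.
  by rewrite /c gt_min ltrD2l; apply/orP; left; lra.
have : A c.
  split; first by rewrite (le_trans sA (ltW cA)) /= ge_min lexx orbT.
  move=> r' /andP[sr' r'c].
  have [h|h|h] := ltgtP r' (sup A).
  - by apply: below; rewrite sr' h.
  - by apply: hd; rewrite h (le_lt_trans r'c).
  - by rewrite h.
by move=> /(sup_upper_bound hA); rewrite leNgt cA.
Qed.

End real_induction.

Section fatou_square.
Context {R : realType} {N : nat}.
Local Notation E := 'rV[R]_N.
Local Notation leb := (lebesgue_rV R N).
Local Open Scope ereal_scope.

Lemma sq_fatou (f_ : nat -> E -> R) (f : E -> R) (B : \bar R) :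
  (forall n, measurable_fun setT (f_ n : borel_rV R N -> R)) ->
  (forall x, f_ n x @[n --> \oo] --> f x) ->
  (forall n, sq (f_ n) <= B) -> sq f <= B.
Proof.
move=> mf cf hB.
pose F n (x : borel_rV R N) := (f_ n x ^+ 2)%:E.
have mF n : measurable_fun setT (F n) by apply/measurable_EFinP; exact: measurable_funX.
have F0 n x : setT x -> 0 <= F n x by move=> _; rewrite lee_fin sqr_ge0.
have := fatou leb measurableT mF F0.
have -> : \int[leb]_x limn_einf (F^~ x) = sq f.
  apply: eq_integral => x _.
  have cF : F n x @[n --> \oo] --> (f x ^+ 2)%:E.
    apply: cvg_EFin; first exact: nearW.
    have h := cvgM (cf x) (cf x); have {}h := h eventually_filter; rewrite -expr2 in h.
    by apply: cvg_trans h; apply: near_eq_cvg; apply: nearW => n /=; rewrite expr2.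
  by rewrite (cvg_limn_einf_sup cF).1.
move=> /le_trans; apply; rewrite limn_einf_lim; apply: lime_le; first exact: is_cvg_einfs.
apply: nearW => n; apply: (le_trans _ (hB n)).
by apply: ereal_inf_lbound; exists n => /=.
Qed.

(** For a weight 0 <= w <= 1 one has |f| w <= f^2 + w, according to whether |f| is at most 1. *)
Lemma tempered_L2 (f : E -> R) : measurable_fun setT (f : borel_rV R N -> R) ->
  sq f < +oo -> tempered f.
Proof.
move=> mf sf; exists N.
have iw := @integrable_weightVX R N N (leqnn N).
have mw := @measurable_weightVX R N N.
have i2 : leb.-integrable setT (EFin \o (fun x : borel_rV R N => f x ^+ 2)%R).
  apply/integrableP; split; first by apply/measurable_EFinP; exact: measurable_funX.
  by under eq_integral => x _ do rewrite /= ger0_norm ?sqr_ge0//.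
apply: (le_integrable measurableT _ _ (integrableD measurableT i2 iw)).
  by apply/measurable_EFinP; apply: measurable_funM.
move=> x _ /=; rewrite lee_fin normrM.
have w0 : (0 <= weight x ^- N)%R by rewrite invr_ge0 exprn_ge0// ltW// weight_gt0.
have w1 : (weight x ^- N <= 1)%R.
  by rewrite invf_le1 ?exprn_gt0 ?weight_gt0// exprn_ege1// weight_ge1.
rewrite -[(1 + enorm x ^+ 2)%R]/(weight x) (ger0_norm w0) (le_trans _ (ler_norm _))//.
rewrite -(real_normK (num_real (f x))).
move: (weight x ^- N)%R w0 w1 => w w0 w1.
have [f1|f1] := leP `|f x|%R 1%R.
  by rewrite (@le_trans _ _ w)// ?ler_piMl// lerDr sqr_ge0.
rewrite (@le_trans _ _ `|f x|%R)// ?ler_piMr//.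
by rewrite (@le_trans _ _ (`|f x| ^+ 2)%R)// ?lerDl// expr2 ler_peMr// ltW.
Qed.

End fatou_square.

Section time_lipschitz.
Context {R : realType} {N : nat}.
Local Notation E := 'rV[R]_N.
Local Notation leb := (lebesgue_rV R N).
Local Notation F := (fun t : R => within [set tau : R | 0 <= tau] t^').

Lemma near_dtP (t : R) (P : R -> Prop) : F t P ->
  exists2 r : R, 0 < r & forall tau, 0 <= tau -> tau != t -> `|tau - t| < r -> P tau.
Proof.
move=> /nbhs_ballP[r r0 h]; exists r => // tau t0 tt tr.
by apply: h => //; rewrite /ball/= distrC.
Qed.

(** A sequence tending to t through values other than t when [c] is nonzero, from the right or the
    left according to its sign. Sequences are what Fatou's lemma accepts. *)
Definition approach (t c : R) (k : nat) : R := t + c / k.+1%:R.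

Lemma approach_cvg (t c : R) : c != 0 -> (forall k, 0 <= approach t c k) ->
  approach t c k @[k --> \oo] --> F t.
Proof.
move=> c0 tc P /near_dtP[r r0 h].
have cr : 0 < r / `|c| by rewrite divr_gt0 ?normr_gt0.
have [K _ KP] := near_infty_natSinv_lt (PosNum cr).
exists K => // k /KP /= hk; apply: h => //.
  by rewrite /approach addrC -subr_eq0 addrK mulf_neq0// invr_eq0 pnatr_eq0.
rewrite /approach addrAC subrr add0r normrM normfV (ger0_norm (x := k.+1%:R))//.
by rewrite mulrC -ltr_pdivlMr ?normr_gt0.
Qed.

Lemma approach_dist (t c : R) k : `|approach t c k - t| <= `|c|.
Proof.
rewrite /approach addrAC subrr add0r normrM normfV (ger0_norm (x := k.+1%:R))//.
by rewrite ler_piMr// invf_le1// ler1n.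
Qed.

Lemma approach_neq (t c : R) k : c != 0 -> approach t c k != t.
Proof.
by move=> c0; rewrite /approach addrC -subr_eq0 addrK mulf_neq0// invr_eq0 pnatr_eq0.
Qed.

Lemma dt_seq (f : R -> E -> R) (t c : R) x : c != 0 -> (forall k, 0 <= approach t c k) ->
  dt_derivable f t x -> dt_quot f t x (approach t c k) @[k --> \oo] --> dt f t x.
Proof. by move=> c0 tc h; exact: (@cvg_comp _ _ _ (approach t c) (dt_quot f t x) _ _ _ (approach_cvg c0 tc) h). Qed.

Lemma dt_seq0 (f : R -> E -> R) (t c : R) x : c != 0 -> (forall k, 0 <= approach t c k) ->
  dt_derivable f t x -> f (approach t c k) x @[k --> \oo] --> f t x.
Proof.
move=> c0 tc /(dt_seq c0 tc) h.
have hc : c / k.+1%:R @[k --> \oo] --> (0 : R).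
  rewrite -[X in _ --> X](mulr0 c); apply: cvgMl_tmp; exact: cvg_harmonic.
have h1 := cvgM h hc; have {}h1 := h1 eventually_filter; rewrite mulr0 in h1.
have h2 := cvgD h1 (cvg_cst (f t x)); have {}h2 := h2 eventually_filter eventually_filter; rewrite add0r in h2.
apply: cvg_trans h2; apply: near_eq_cvg; apply: nearW => k.
rewrite -[LHS]/(dt_quot f t x (approach t c k) * (c / k.+1%:R) + f t x) /dt_quot.
have -> : approach t c k - t = c / k.+1%:R by rewrite /approach addrAC subrr add0r.
by rewrite divfK ?subrK// mulf_neq0// invr_eq0 pnatr_eq0.
Qed.

Variables (chi phi : E -> R).
Hypothesis hLP : LP_pair chi phi.
Variables (s M : R) (f : R -> E -> R).
Hypotheses (s0 : 0 < s) (hbes : C1_besov chi phi s f)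
  (hcx : forall t, 0 <= t -> continuous (f t))
  (hdc : forall t, 0 <= t -> continuous (dt f t))
  (hdd : forall t x, 0 <= t -> dt_derivable f t x)
  (hM : forall t, 0 <= t -> (sqnorm chi phi s (dt f t) <= M%:E)%E).

Let tf t : 0 <= t -> tempered (f t).
Proof. by move=> t0; have [[]] := hbes.1 t t0. Qed.

Let mf t : 0 <= t -> measurable_fun setT (f t : borel_rV R N -> R).
Proof. by move=> t0; apply: continuous_measurable_rV; exact: hcx. Qed.

Let Dq t tau : E -> R := fun x => dt_quot f t x tau.

Let cD t tau : 0 <= t -> 0 <= tau -> continuous (Dq t tau).
Proof.
move=> t0 h; apply: continuous_mul; last by move=> x; exact: cst_continuous.
by apply: continuous_add; [exact: hcx|apply: continuous_opp; exact: hcx].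
Qed.

Let tD t tau : 0 <= t -> 0 <= tau -> tempered (Dq t tau).
Proof.
move=> t0 h; have := temperedZ (tau - t)^-1 (temperedB (tf h) (tf t0)).
by rewrite (_ : (fun x => _) = Dq t tau)//; apply/funext => x; rewrite mulrC.
Qed.

Local Open Scope ereal_scope.

(** The derivative [g] of [C1_besov] is not identified with [dt f]. Comparison with [g] makes the
    difference quotients a Cauchy family in L2; when one of the two times tends to t, Fatou's lemma
    replaces its quotient by the pointwise limit [dt f t]. *)
Lemma dt_quot_cvg_L2 t (eta : R) : (0 <= t)%R -> (0 < eta)%R ->
  exists2 r : R, (0 < r)%R & forall tau, (0 <= tau)%R -> tau != t -> (`|tau - t| < r)%R ->
    sq (fun x => Dq t tau x - dt f t x)%R <= eta%:E.
Proof.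
move=> t0 eta0; have [C [C0 hC]] := sq_le_sqnorm hLP s0.
have [g [hg hgc]] := hbes.2; have [[tg _] _] := hg t t0.
(* Two quotients, each within d of [g], differ by at most 4 d^2 in squared Besov norm, and the
   embedding into L2 multiplies this by [C]. *)
pose d := Num.sqrt (eta / (4 * (C + 1))).
have C1 : (0 < C + 1)%R by rewrite ltr_wpDl.
have d0 : (0 < d)%R by rewrite sqrtr_gt0 divr_gt0// mulr_gt0.
have dE : (d ^+ 2 = eta / (4 * (C + 1)))%R by rewrite sqr_sqrtr// ltW// divr_gt0// mulr_gt0.
have hn : F t (fun tau => besov_norm chi phi s 2%:E 2
    (fun x => (f tau x - f t x) / (tau - t) - g t x)%R < d%:E).
  have nd : nbhs (0 : \bar R) [set y | y < d%:E] by apply: open_ereal_lt'; rewrite lte_fin.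
  exact: (hgc t t0 _ nd).
have [r r0 hr] := near_dtP hn; exists r => // tau tau0 tt tr.
have sqn tau' : (0 <= tau')%R -> tau' != t -> (`|tau' - t| < r)%R ->
    sqnorm chi phi s (fun x => Dq t tau' x - g t x)%R <= (d ^+ 2)%:E.
  move=> h1 h2 h3; have := hr tau' h1 h2 h3 => h.
  rewrite /sqnorm poweR2 ?poweR_ge0// expr2 EFinM.
  by apply: lee_pmul; rewrite ?poweR_ge0//; exact: ltW.
have pair tau' : (0 <= tau')%R -> tau' != t -> (`|tau' - t| < r)%R ->
    sq (fun x => Dq t tau x - Dq t tau' x)%R <= eta%:E.
  move=> h1 h2 h3.
  have tT : tempered (fun x => Dq t tau x - Dq t tau' x)%R by apply: temperedB; exact: tD.
  have cT : continuous (fun x => Dq t tau x - Dq t tau' x)%R.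
    by apply: continuous_add; [exact: cD|apply: continuous_opp; exact: cD].
  apply: (le_trans (hC _ tT cT)).
  have := sqnorm_sub hLP s (temperedB (tD t0 tau0) tg) (temperedB (tD t0 h1) tg).
  rewrite (_ : (fun x => _) = (fun x => Dq t tau x - Dq t tau' x)%R); last first.
    by apply/funext => x; rewrite opprB addrA subrK.
  move=> h; apply: (@le_trans _ _ (C%:E * (4 * d ^+ 2)%:E)).
    apply: lee_wpmul2l; first by rewrite lee_fin.
    apply: (le_trans h).
    apply: (@le_trans _ _ (2%:E * (d ^+ 2)%:E + 2%:E * (d ^+ 2)%:E)).
      by apply: leeD; apply: lee_wpmul2l; rewrite ?lee_fin//; exact: sqn.
    by rewrite -!EFinM -EFinD lee_fin; lra.
  rewrite -EFinM lee_fin dE.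
  have -> : (C * (4 * (eta / (4 * (C + 1)))) = eta * (C / (C + 1)))%R.
    by field; rewrite gt_eqF.
  by rewrite ler_piMr ?(ltW eta0)// ler_pdivrMr// mul1r lerDl.
pose c := (r / 2)%R.
have c0 : c != 0%R by rewrite gt_eqF// divr_gt0.
have c1 : (0 < c)%R by rewrite divr_gt0.
have ta k : (0 <= approach t c k)%R by rewrite addr_ge0// divr_ge0// ltW.
apply: (@sq_fatou R N (fun k x => Dq t tau x - Dq t (approach t c k) x)%R).
- move=> k; apply: continuous_measurable_rV; apply: continuous_add; first exact: cD.
  by apply: continuous_opp; exact: cD.
- move=> x; have h := cvgB (cvg_cst (Dq t tau x)) (dt_seq c0 ta (@hdd t x t0)).
  have {}h := h eventually_filter eventually_filter; apply: cvg_trans h; by apply: near_eq_cvg; apply: nearW.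
- move=> k; apply: pair => //; first exact: approach_neq.
  rewrite (le_lt_trans (approach_dist _ _ _))// gtr0_norm// /c; lra.
Qed.

(** [hM] bounds the blocks of [dt f t], but [sq_le_sqnorm] asks for a tempered function. This
    follows from the preceding L2 convergence, since the difference quotients are square
    integrable. *)
Lemma dt_nrm2_le : exists K : R, (0 <= K)%R /\
  forall t, (0 <= t)%R -> nrm2 (dt f t) <= K%:E.
Proof.
have [C [C0 hC]] := sq_le_sqnorm hLP s0.
exists (Num.sqrt (C * M)); split => [|t t0]; first exact: sqrtr_ge0.
rewrite nrm2_le ?sqrtr_ge0//.
have M0 : (0 <= M)%R.
  by rewrite -lee_fin (le_trans _ (hM t0))// poweR_ge0.
rewrite sqr_sqrtr ?mulr_ge0//.
have md : measurable_fun setT (dt f t : borel_rV R N -> R).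
  by apply: continuous_measurable_rV; exact: hdc.
have [r r0 hr] := dt_quot_cvg_L2 t0 (@ltr01 R).
pose tau := (t + r / 2)%R.
have tau0 : (0 <= tau)%R by rewrite addr_ge0// divr_ge0// ltW.
have h1 : sq (fun x => Dq t tau x - dt f t x)%R <= 1%:E.
  apply: hr => //; first by rewrite /tau addrC -subr_eq0 addrK gt_eqF// divr_gt0.
  by rewrite /tau addrAC subrr add0r gtr0_norm ?divr_gt0//; lra.
have sqf t' : (0 <= t')%R -> sq (f t') < +oo.
  move=> h; have [[tt bt] _] := hbes.1 t' h.
  apply: (le_lt_trans (hC _ tt (hcx h))).
  rewrite lte_mul_pinfty ?lee_fin//; exact: poweR_lty.
have sqD : sq (Dq t tau) < +oo.
  have -> : Dq t tau = (fun x => (tau - t)^-1 * (f tau x - f t x))%R.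
    by apply/funext => x; rewrite mulrC.
  rewrite sq_lty_cst; last by apply: measurable_funB; exact: mf.
  rewrite lte_mul_pinfty ?lee_fin ?sqr_ge0//.
  apply: (le_lt_trans (sq_sub_le (mf tau0) (mf t0))).
  by apply: lte_add_pinfty; rewrite lte_mul_pinfty ?lee_fin// sqf.
have mD : measurable_fun setT (Dq t tau : borel_rV R N -> R).
  by apply: continuous_measurable_rV; exact: cD.
have sqdt : sq (dt f t) < +oo.
  have -> : dt f t = (fun x => Dq t tau x - (Dq t tau x - dt f t x))%R.
    by apply/funext => x; rewrite opprB addrC subrK.
  apply: (le_lt_trans (sq_sub_le mD (measurable_funB mD md))).
  apply: lte_add_pinfty; rewrite lte_mul_pinfty ?lee_fin//.
  by rewrite (le_lt_trans h1)// ltry.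
apply: (le_trans (hC _ (tempered_L2 md sqdt) (hdc t0))).
by rewrite EFinM; apply: lee_wpmul2l; [rewrite lee_fin|exact: hM].
Qed.

(** The mean value inequality for a curve in L2. The slope K + 1 leaves room for the error of the
    difference quotient just after t, and Fatou's lemma passes to a limit time from the left. *)
Lemma time_lipschitz : exists L : R, (0 < L)%R /\ forall r t, (0 <= r)%R -> (r <= t)%R ->
  nrm2 (fun x => f t x - f r x)%R <= (L * (t - r))%:E.
Proof.
have [K [K0 hK]] := dt_nrm2_le; exists (K + 1)%R; split; first by rewrite ltr_wpDl.
have L0 : (0 < K + 1)%R by rewrite ltr_wpDl.
move=> r t r0; move: t; apply: real_induction => [|t rt Pt|t rt Pt].
- rewrite subrr mulr0 (_ : (fun x => _) = (fun _ => 0%R)); last by apply/funext => x; rewrite subrr.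
  by rewrite nrm2_le// /sq integral0_eq// => x _; rewrite expr0n.
- have t0 : (0 <= t)%R by exact: le_trans rt.
  have [d d0 hd] := dt_quot_cvg_L2 t0 (@ltr01 R).
  exists d => // t' /andP[tt' t'd]; have t'0 : (0 <= t')%R by rewrite (le_trans t0)// ltW.
  have tn : t' != t by rewrite gt_eqF.
  have tp : (0 < t' - t)%R by rewrite subr_gt0.
  have md : measurable_fun setT (dt f t : borel_rV R N -> R).
    by apply: continuous_measurable_rV; exact: hdc.
  have mD : measurable_fun setT (Dq t t' : borel_rV R N -> R).
    by apply: continuous_measurable_rV; exact: cD.
  have h1 : nrm2 (fun x => Dq t t' x - dt f t x)%R <= 1%:E.
    rewrite nrm2_le// expr1n; apply: hd => //; rewrite gtr0_norm//; lra.
  have h2 : nrm2 (Dq t t') <= (K + 1)%:E.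
    have := minkowski2 (measurable_funB mD md) md.
    rewrite (_ : (fun x => _) = Dq t t'); last by apply/funext => x; rewrite subrK.
    move=> /le_trans; apply; rewrite addrC EFinD; apply: leeD => //; exact: hK.
  have h3 : nrm2 (fun x => f t' x - f t x)%R <= ((K + 1) * (t' - t))%:E.
    have -> : (fun x => f t' x - f t x)%R = (fun x => (t' - t) * Dq t t' x)%R.
      by apply/funext => x; rewrite /Dq /dt_quot mulrC divfK// gt_eqF.
    rewrite nrm2Z// gtr0_norm// mulrC EFinM; apply: lee_wpmul2l => //.
    by rewrite lee_fin ltW.
  have := minkowski2 (measurable_funB (mf t'0) (mf t0)) (measurable_funB (mf t0) (mf r0)).
  rewrite (_ : (fun x => _) = (fun x => f t' x - f r x)%R); last by apply/funext => x; rewrite addrA subrK.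
  move=> /le_trans; apply; apply: (le_trans (leeD h3 Pt)).
  by rewrite -EFinD lee_fin -mulrDr addrA subrK.
- have t0 : (0 < t)%R by exact: le_lt_trans rt.
  (* Negative, for an approach from the left, and of half the distance to r, so that the whole
     sequence stays in [[r, t[]. *)
  pose c := (- ((t - r) / 2))%R.
  have tr : (0 < (t - r) / 2)%R by rewrite divr_gt0// subr_gt0.
  have c0 : c != 0%R by rewrite oppr_eq0 gt_eqF.
  have hk k : (r <= approach t c k < t)%R.
    have := approach_dist t c k; rewrite normrN (gtr0_norm tr) ler_norml => /andP[h _].
    apply/andP; split; first by move: h tr; lra.
    by rewrite /approach gtrDl mulNr oppr_lt0 divr_gt0.
  have ta k : (0 <= approach t c k)%R by have /andP[h _] := hk k; exact: le_trans h.
  rewrite nrm2_le ?mulr_ge0 ?subr_ge0 ?(ltW L0) ?(ltW rt)//.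
  apply: (@sq_fatou R N (fun k x => f (approach t c k) x - f r x)%R).
  + by move=> k; apply: measurable_funB; exact: mf.
  + move=> x; have h := cvgB (dt_seq0 c0 ta (@hdd t x (ltW t0))) (cvg_cst (f r x)).
    have {}h := h eventually_filter eventually_filter; apply: cvg_trans h; by apply: near_eq_cvg; apply: nearW.
  + move=> k; have /andP[k1 k2] := hk k.
    rewrite -nrm2_le ?mulr_ge0 ?subr_ge0 ?(ltW L0) ?(ltW rt)//.
    apply: (le_trans (Pt _ (hk k))).
    by rewrite lee_fin ler_wpM2l ?(ltW L0)// lerD2r ltW.
Qed.

End time_lipschitz.

(** * Decay of the frequency blocks *)

Section lower_integral.
Context d (T : measurableType d) (R : realType) (mu : {measure set T -> \bar R}).
Local Open Scope ereal_scope.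

(* [f] need not be measurable: the integral is the supremum of the integrals of
   the simple functions below [f]. *)
Lemma integral_ge_nonmeasurable (D : set T) (f g : T -> \bar R) :
  (forall x, D x -> 0 <= f x) -> (forall x, 0 <= g x) -> (forall x, g x <= (f \_ D) x) ->
  \int[mu]_x g x <= \int[mu]_(x in D) f x.
Proof.
move=> f0 g0 gf; rewrite (ge0_integralE mu f0) ge0_integralTE//.
apply: ge_ereal_sup => _ [h hg <-]; apply: ereal_sup_ubound; exists h => //= x.
exact: le_trans (hg x) (gf x).
Qed.

(** The simple function below [f] takes the value [c] on each of the sets. It serves both for
    disjoint balls in space and for disjoint intervals in time. *)
Lemma disjoint_lower_bound (D : set T) (f : T -> \bar R) (m : nat) (B : nat -> set T) (c v : R) :
  (0 <= c)%R -> (forall x, D x -> 0 <= f x) ->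
  (forall k, measurable (B k)) -> (forall k l x, B k x -> B l x -> k = l) ->
  (forall k, mu (B k) = v%:E) ->
  (forall k x, (k < m)%N -> B k x -> D x /\ c%:E <= f x) ->
  (m%:R * c * v)%:E <= \int[mu]_(x in D) f x.
Proof.
move=> c0 f0 mB dB vB hB.
pose g x := \sum_(k < m) c%:E * (\1_(B k) x)%:E.
have mg k : measurable_fun setT (fun x => c%:E * (\1_(B k) x)%:E).
  by apply: emeasurable_funM => //; apply/measurable_EFinP; exact: measurable_indic.
have g0 (k : nat) x : 0 <= c%:E * (\1_(B k) x)%:E by rewrite mule_ge0// lee_fin.
have -> : (m%:R * c * v)%:E = \int[mu]_x g x.
  rewrite ge0_integral_sum//.
  transitivity (\sum_(k < m) (c * v)%:E).
    by rewrite sumEFin sumr_const card_ord -mulrA mulr_natl.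
  apply: eq_bigr => k _; rewrite ge0_integralZl//.
  - by rewrite integral_indic// setIT vB EFinM.
  - by apply/measurable_EFinP; exact: measurable_indic.
apply: integral_ge_nonmeasurable => // x; first by apply: sume_ge0.
have [[k [km kx]]|nB] := pselect (exists k, (k < m)%N /\ B k x).
  have [Dx cf] := hB k x km kx.
  rewrite patchE mem_set// (le_trans _ cf)// /g (bigD1 (Ordinal km))//= big1 => [|i ik].
    by rewrite adde0 indicE mem_set// mule1.
  rewrite indicE memNset ?mule0// => ix; move/eqP: ik; apply; apply: val_inj => /=.
  exact: dB ix kx.
rewrite /g big1 => [|i _].
  by rewrite patchE; case: ifPn => // /set_mem; exact: f0.
by rewrite indicE memNset ?mule0// => ix; apply: nB; exists i.
Qed.

End lower_integral.

Section spreading.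
Context {R : realType} {N : nat}.
Local Notation E := 'rV[R]_N.
Local Notation leb := (lebesgue_rV R N).
Implicit Types (f g m K L : E -> R) (x y z xi : E) (i : 'I_N).
Local Notation kre := (@ifourier_re R N).
Local Notation kim := (@ifourier_im R N).
Local Notation e_ i := (delta_mx 0 i : E).

Lemma l1_e i : l1 (e_ i) = 1.
Proof.
rewrite /l1 (bigD1 i)//= big1 => [|j ji]; first by rewrite mxE !eqxx addr0 normr1.
by rewrite mxE (negbTE ji) andbF normr0.
Qed.

Lemma partial_seq f i x (u : nat -> R) : derivable f x (e_ i) ->
  (forall n, u n != 0) -> u n @[n --> \oo] --> (0 : R) ->
  (f (x + u n *: e_ i) - f x) / u n @[n --> \oo] --> partial i f x.
Proof.
move=> df u0 uc.
have u0' : u n @[n --> \oo] --> (0 : R)^'.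
  move=> P h; have h' : \forall y \near (0 : R), y != 0 -> P y by exact: h.
  have h2 : \forall n \near \oo, u n != 0 -> P (u n) := uc _ h'.
  change (\forall n \near \oo, P (u n)).
  by apply: filterS h2 => n; apply; exact: u0.
have := @cvg_comp _ _ _ u _ _ _ _ u0' df.
apply: cvg_trans; apply: near_eq_cvg; apply: nearW => n /=.
rewrite -[LHS]/((u n)^-1 * (f (u n *: e_ i + x) - f x)) mulrC.
by rewrite (addrC x).
Qed.

Let harm_neq0 n : (n.+1%:R^-1 : R) != 0.
Proof. by rewrite invr_eq0 pnatr_eq0. Qed.

Lemma partial_le f i x (La : R) : derivable f x (e_ i) ->
  (forall x z, `|f (x + z) - f x| <= La * l1 z) -> `|partial i f x| <= La.
Proof.
move=> df fL.
have h := partial_seq df harm_neq0 (@cvg_harmonic R).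
have hn := cvg_norm h; have {}hn := hn eventually_filter; rewrite -(cvg_lim (@Rhausdorff R) hn).
apply: limr_le; first by apply/cvg_ex; exists `|partial i f x|.
apply: nearW => n; rewrite normrM normfV ler_pdivrMr ?normr_gt0//.
by rewrite (le_trans (fL _ _))// l1Z l1_e mulr1.
Qed.

(** The difference quotients of [f] are bounded by its Lipschitz constant, so dominated convergence
    applies with the majorant La |K|. A derivative from the right is what the extension premise of
    [real_induction] consumes. *)
Lemma convolve_right_derivative K f i x (La : R) : rapid K ->
  measurable_fun setT (f : borel_rV R N -> R) -> utemp f ->
  (forall x z, `|f (x + z) - f x| <= La * l1 z) ->
  (forall x, derivable f x (e_ i)) ->
  (convolve K f (x + h *: e_ i) - convolve K f x) / h @[h --> 0^'+] --> convolve K (partial i f) x.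
Proof.
move=> rK mf uf fL df.
apply/cvg_at_rightP => u [u0 uc].
have un n : u n != 0 by rewrite gt_eqF.
have La0 : 0 <= La.
  have := le_trans (normr_ge0 _) (fL 0 (e_ i)); by rewrite l1_e mulr1.
have mK := rapid_measurable rK; have iK := rapid_integrable rK.
have [C KC] := rK.2 N.
have int z := utemp_integrable z uf mK KC.
have qE n : (convolve K f (x + u n *: e_ i) - convolve K f x) / u n =
    \int[leb]_y (K y * ((f (x - y + u n *: e_ i) - f (x - y)) / u n)).
  rewrite /convolve -RintegralB//.
  rewrite mulrC -RintegralZl//; last exact: (integrableB measurableT (int _) (int _)).
  apply: eq_Rintegral => y _; rewrite (addrAC x).
  by field.
under eq_cvg do rewrite qE.
have mfx y' : measurable_fun setT (fun y : borel_rV R N => f (y' - y)) by exact: measurable_shift.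
refine (proj2 (@dominated_cvg_Rintegral _ _ _ leb
  (fun n y => K y * ((f (x - y + u n *: e_ i) - f (x - y)) / u n)) _
  (fun y => La * `|K y|) _ _ _ _)).
- move=> n; apply: measurable_funM => //; apply: measurable_funM => //; apply: measurable_funB => //.
  have := mfx (x + u n *: e_ i).
  by under [X in measurable_fun _ X -> _]funext => y do rewrite addrAC.
- move=> y; apply: cvgMl_tmp; exact: partial_seq.
- exact: (integrableZl _ _ (integrable_norm iK)).
- move=> n y; rewrite normrM mulrC; apply: ler_wpM2r => //.
  rewrite normrM normfV ler_pdivrMr ?normr_gt0//.
  by rewrite (le_trans (fL _ _))// l1Z l1_e mulr1.
Qed.

(** A mean value inequality from a right derivative. The gap B < L absorbs the error of the
    difference quotient, and the rough Lipschitz constant [La] gives the continuity needed at limit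
    points. *)
Lemma directional_lipschitz (G : E -> R) (H : E -> R) i (La B L : R) :
  (forall x z, `|G (x + z) - G x| <= La * l1 z) ->
  (forall x, (G (x + h *: e_ i) - G x) / h @[h --> 0^'+] --> H x) ->
  (forall x, `|H x| <= B) -> B < L ->
  forall x r, 0 <= r -> `|G (x + r *: e_ i) - G x| <= L * r.
Proof.
move=> GL dG HB BL x; have La0 : 0 <= La.
  by have := le_trans (normr_ge0 _) (GL 0 (e_ i)); rewrite l1_e mulr1.
have L0 : 0 < L by rewrite (le_lt_trans _ BL)// (le_trans _ (HB x)).
apply: real_induction => [|r r0 Pr|c c0 Pc].
- by rewrite scale0r addr0 subrr normr0 mulr0.
- have := dG (x + r *: e_ i) => /cvgrPdist_lt /(_ (L - B)).
  rewrite subr_gt0 => /(_ BL) /nbhs_ballP[d d0 hd]; exists d => // r' /andP[rr' r'd].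
  have h0 : 0 < r' - r by rewrite subr_gt0.
  have := hd (r' - r); rewrite /ball/= sub0r normrN gtr0_norm// ltrBlDl => /(_ r'd h0).
  have -> : x + r *: e_ i + (r' - r) *: e_ i = x + r' *: e_ i.
    by rewrite -addrA -scalerDl addrC (addrC r) subrK addrC.
  set D := G _ - G _ => h.
  have hD : `|D| <= L * (r' - r).
    have : `|D / (r' - r)| <= L.
      have e1 : D / (r' - r) = H (x + r *: e_ i) - (H (x + r *: e_ i) - D / (r' - r)) by ring.
      rewrite e1 (le_trans (ler_normB _ _))//.
      by have := HB (x + r *: e_ i); move: h; lra.
    by rewrite normrM normfV (gtr0_norm h0) ler_pdivrMr.
  have -> : G (x + r' *: e_ i) - G x = D + (G (x + r *: e_ i) - G x) by rewrite /D; ring.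
  by rewrite (le_trans (ler_normD _ _))//; move: hD Pr; lra.
- apply/ler_addgt0Pr => e e0.
  pose t := Order.min c (e / (La + 1)).
  have La1 : 0 < La + 1 by rewrite ltr_wpDl.
  have t0 : 0 < t by rewrite lt_min c0 divr_gt0.
  have tc : t <= c by rewrite ge_min lexx.
  have te : La * t <= e.
    rewrite (@le_trans _ _ ((La + 1) * t))// ?ler_wpM2r ?lerDl ?(ltW t0)//.
    by rewrite mulrC -ler_pdivlMr// ge_min lexx orbT.
  have := Pc (c - t); rewrite subr_ge0 tc /= ltrBlDr ltrDl t0 => /(_ isT) h1.
  have h2 := GL (x + (c - t) *: e_ i) (t *: e_ i).
  rewrite -addrA -scalerDl subrK l1Z l1_e mulr1 (gtr0_norm t0) in h2.
  have -> : G (x + c *: e_ i) - G x =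
    (G (x + c *: e_ i) - G (x + (c - t) *: e_ i)) + (G (x + (c - t) *: e_ i) - G x) by ring.
  rewrite (le_trans (ler_normD _ _))// addrC; apply: lerD; last exact: le_trans te.
  by rewrite (le_trans h1)// ler_wpM2l ?(ltW L0)// gerBl ltW.
Qed.

Lemma lebesgue_ball_rV_translate (x : borel_rV R N) (r : R) : 0 < r ->
  leb (ball (x : E) r) = ((2 * r) ^+ N)%:E.
Proof.
move=> r0; rewrite -(lebesgue_ball_rV N r0).
have mb (y : E) : measurable (ball y r : set (borel_rV R N)).
  by apply: sub_sigma_algebra; exact: ball_open.
have := ge0_integral_affine_rV (- x) (oner_neq0 R) (f := fun y => (\1_(ball (0 : E) r) y)%:E).
rewrite normr1 expr1n invr1 mul1e.
have -> : leb (ball (0 : E) r) = (\int[leb]_y (\1_(ball (0 : E) r) y)%:E)%E.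
  by rewrite integral_indic ?setIT//; exact: mb.
move=> <-.
- rewrite -(setIT (ball (x : E) r)) -integral_indic//; apply: eq_integral => y _; congr (_%:E).
  rewrite !indicE; congr (nat_of_bool _)%:R; apply/idP/idP => /set_mem h; apply/mem_set.
    split => // a b; have [_ /(_ a b)] := h.
    by rewrite scale1r !mxE /ball /= sub0r normrN distrC.
  split => // a b; have [_ /(_ a b)] := h.
  by rewrite scale1r !mxE /ball /= sub0r normrN distrC.
- by apply/measurable_EFinP; exact: measurable_indic.
- by move=> y; rewrite lee_fin.
Qed.

(** The value at x0 loses at most eta / 4 along the line, by the slow variation in direction i, and
    at most eta / 4 inside each ball, by the choice of [rho]. The centres are 2 rho apart, so the m
    balls are disjoint and each carries at least (eta / 2)^2 times its volume. *)
Lemma mass_lower_bound (G : E -> R) i x0 (La L eta : R) (m : nat) :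
  0 < La -> 0 < eta -> 0 <= L ->
  (forall x z, `|G (x + z) - G x| <= La * l1 z) ->
  (forall x r, 0 <= r -> `|G (x + r *: e_ i) - G x| <= L * r) ->
  eta <= `|G x0| ->
  let rho := eta / (4 * (La * N%:R)) in
  8 * L * rho * m%:R <= eta ->
  ((m%:R * (eta / 2) ^+ 2 * (2 * rho) ^+ N)%:E <= sq G)%E.
Proof.
move=> La0 eta0 L0 GL Gdir Gx0 rho hm.
have N0 : 0 < N%:R :> R by rewrite ltr0n (leq_ltn_trans (leq0n i) (ltn_ord i)).
have rho0 : 0 < rho by rewrite divr_gt0// !mulr_gt0.
pose ce (k : nat) : E := x0 + (2 * rho * k%:R) *: e_ i.
apply: (@disjoint_lower_bound _ (borel_rV R N) R leb setT (fun x => (G x ^+ 2)%:E) m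
  (fun k => ball (ce k) rho) ((eta / 2) ^+ 2) ((2 * rho) ^+ N)).
- exact: sqr_ge0.
- by move=> x _; rewrite lee_fin sqr_ge0.
- by move=> k; apply: sub_sigma_algebra; exact: ball_open.
- move=> k l x kx lx.
  have aux (k' l' : nat) : (k' < l')%N -> ball (ce k') rho x -> ball (ce l') rho x -> False.
    move=> kl [_ /(_ 0 i)]; rewrite !mxE !eqxx /ball /= !mulr1 => h1.
    move=> [_ /(_ 0 i)]; rewrite !mxE !eqxx /ball /= !mulr1 => h2.
    have kl1 : k'%:R + 1 <= l'%:R :> R by rewrite natr1 ler_nat.
    have : 2 * rho * (k'%:R + 1) <= 2 * rho * l'%:R by rewrite ler_wpM2l// mulr_ge0// ltW.
    by move: h1 h2; rewrite !ltr_norml => /andP[h1 h1'] /andP[h2 h2']; lra.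
  by case: (ltngtP k l) => // h; [case: (aux _ _ h kx lx)|case: (aux _ _ h lx kx)].
- by move=> k; exact: lebesgue_ball_rV_translate.
- move=> k x km kx; split => //; rewrite lee_fin.
  have s0 : 0 <= 2 * rho * k%:R by rewrite mulr_ge0// mulr_ge0// ltW.
  have h1 := Gdir x0 _ s0; rewrite -/(ce k) in h1.
  have h2 := GL (ce k) (x - ce k); rewrite (addrC (ce k)) subrK in h2.
  have hl : l1 (x - ce k) <= N%:R * rho.
    have -> : N%:R * rho = \sum_(j < N) rho by rewrite sumr_const card_ord mulr_natl.
    apply: ler_sum => j _; have [_ /(_ 0 j)] := kx.
    by rewrite !mxE /ball /= distrC => /ltW.
  have h3 : La * l1 (x - ce k) <= eta / 4.
    rewrite (le_trans (ler_wpM2l (ltW La0) hl))// /rho le_eqVlt; apply/orP; left; apply/eqP.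
    by field; rewrite !gt_eqF.
  have h4 : L * (2 * rho * k%:R) <= eta / 4.
    have : L * rho * k%:R <= L * rho * m%:R.
      by rewrite ler_wpM2l ?ler_nat ?(ltnW km)// mulr_ge0// ltW.
    by move: hm; lra.
  have h5 : eta / 2 <= `|G x|.
    have : `|G x0| <= `|G x| + `|G x - G (ce k)| + `|G (ce k) - G x0|.
      have e1 : G x0 = G x - (G x - G (ce k)) - (G (ce k) - G x0) by ring.
      rewrite {1}e1.
      by rewrite (le_trans (ler_normB _ _))// lerD2r ler_normB.
    by move: h1 h2 h3 h4 Gx0; lra.
  rewrite -(real_normK (num_real (G x))); apply: lerXn2r => //.
  by rewrite nnegrE divr_ge0// ltW.
Qed.

End spreading.

Section gradient_detects.
Context {R : realType} {N : nat}.
Local Notation E := 'rV[R]_N.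
Local Notation leb := (lebesgue_rV R N).
Implicit Types (f g m K L : E -> R) (x y z xi : E) (i : 'I_N).
Local Notation kre := (@ifourier_re R N).
Local Notation kim := (@ifourier_im R N).

Lemma abs_le_of_sq (a b : R) : 0 <= b -> a ^+ 2 <= b ^+ 2 -> `|a| <= b.
Proof.
by move=> b0; rewrite -(real_normK (num_real a)) ler_pXn2r// nnegrE.
Qed.

Lemma rapid_L1 K : rapid K -> exists2 a : R, 0 <= a & (\int[leb]_y `|K y|%:E = a%:E)%E.
Proof.
move=> rK; have /integrableP[_ h] := rapid_integrable rK.
have p : (0 <= \int[leb]_y `|K y|%:E)%E by apply: integral_ge0 => y _; rewrite lee_fin.
exists (fine (\int[leb]_y `|K y|%:E)%E); first exact: fine_ge0.
by rewrite fineK// ge0_fin_numE.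
Qed.

Lemma convolve_increment K f x z : rapid K -> utemp f ->
  convolve K f (x + z) - convolve K f x = convolve (shift_diff z K) f x.
Proof.
move=> rK uf; have [C KC] := rK.2 N.
have int y := utemp_integrable y uf (rapid_measurable rK) KC.
rewrite convolve_translate; last exact: int.
rewrite -convolveB//.
have := integrable_affine_rV z (oner_neq0 R) (int (x + z)).
apply: eq_integrable => // y _ /=; rewrite scale1r; congr (_ * f _)%:E.
by rewrite opprD addrACA subrr addr0.
Qed.

Variables (chi phi : E -> R).
Hypothesis hLP : LP_pair chi phi.
Local Notation S := (LP_symbol chi phi).

Lemma LP_kernel_rapid j K : K = kre (S j) \/ K = kim (S j) -> rapid K.
Proof. by have [rr ri] := rapid_kernel (bump_LP_symbol hLP j); case=> ->. Qed.

(** [kappa] depends neither on [f] nor on x0 or the direction, since it has to serve at all times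
    and points at once. The constants are fixed backwards from the contradiction: m, then L, then
    kappa. *)
Lemma gradient_lower_bound (e M eta : R) j K : (0 < N)%N -> 0 < e -> 0 <= M -> 0 < eta ->
  K = kre (S j) \/ K = kim (S j) ->
  exists2 kappa : R, 0 < kappa & forall f x0 i, tempered f -> continuous f ->
    (forall x, derivable f x (delta_mx 0 i)) -> continuous (partial i f) ->
    (sqnorm chi phi (sigma R N + e) f <= M%:E)%E -> eta <= `|convolve K f x0| ->
    (kappa%:E <= LPsq chi phi j (partial i f))%E.
Proof.
move=> N0 e0 M0 eta0 hK; have rK := LP_kernel_rapid hK.
have mK := rapid_measurable rK.
have se0 : 0 < sigma R N + e by rewrite addr_gt0// /sigma ltr_wpDr// divr_ge0.
have [Cs [Cs0 hCs]] := sq_le_sqnorm hLP se0.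
have [Cl [Cl0 hCl]] := lipschitz_of_sqnorm hLP e0.
have [Cb [Cb0 hCb]] := bernstein hLP.
have [Ch [Ch0 hCh]] := sq_shift_diff_kernel (bump_LP_symbol hLP j).
have [a a0 Ka] := rapid_L1 rK.
pose La := Num.sqrt (Ch * (Cs * M)) + 1.
have La0 : 0 < La by rewrite ltr_wpDl// sqrtr_ge0.
pose Q := a ^+ 2 * (Cs * M).
have NR0 : 0 < N%:R :> R by rewrite ltr0n.
pose rho := eta / (4 * (La * N%:R)).
have rho0 : 0 < rho by rewrite divr_gt0// mulr_gt0// mulr_gt0.
pose v := (eta / 2) ^+ 2 * (2 * rho) ^+ N.
have v0 : 0 < v.
  apply: mulr_gt0; first by rewrite exprn_gt0// divr_gt0.
  by rewrite exprn_gt0// mulr_gt0.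
have Q0 : 0 <= Q by rewrite mulr_ge0 ?sqr_ge0// mulr_ge0.
(* [Q] bounds the squared L2 norm of the convolution by Young's inequality, and [v] is the mass
   carried by one ball: m balls are too many. *)
have [m hm] : exists m : nat, Q < m%:R * v.
  exists (Num.bound (Q / v)); rewrite -ltr_pdivrMr//.
  by apply: archi_boundP; rewrite divr_ge0// ltW.
(* A variation slow enough for [mass_lower_bound] to fit m balls. *)
pose L := eta / (8 * rho * (m%:R + 1)).
have m1 : 0 < m%:R + 1 :> R by rewrite ltr_wpDl.
have L0 : 0 < L by rewrite divr_gt0// mulr_gt0// mulr_gt0.
have hL : 8 * L * rho * m%:R <= eta.
  have -> : 8 * L * rho * m%:R = eta * (m%:R / (m%:R + 1)).
    by rewrite /L; field; rewrite !gt_eqF.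
  by rewrite ler_piMr ?(ltW eta0)// ler_pdivrMr// mul1r lerDl.
pose b := Cb * (2 ^+ j.+1) ^+ N.
have b0 : 0 <= b by rewrite mulr_ge0// exprn_ge0.
have b1 : 0 < b + 1 by rewrite ltr_wpDl.
(* Below this level Bernstein's inequality keeps the block of the derivative pointwise at most L /
   2, which is strictly less than L. *)
exists ((L / 2) ^+ 2 / (b + 1)); first by rewrite divr_gt0// exprn_gt0// divr_gt0.
move=> f x0 i tf cf df cpf sf Kf; rewrite leNgt; apply/negP => small.
have mf := tempered_measurable tf.
have sqf : (sq f <= (Cs * M)%:E)%E.
  by apply: (le_trans (hCs f tf cf)); rewrite EFinM; apply: lee_wpmul2l; rewrite ?lee_fin.
have uf : utemp f by apply: utemp_L2 => //; exact: le_lt_trans sqf (ltry _).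
have fL x z : `|f (x + z) - f x| <= Num.sqrt (Cl * M) * l1 z.
  have l0 := l1_ge0 z; apply: abs_le_of_sq; first by rewrite mulr_ge0// sqrtr_ge0.
  rewrite exprMn sqr_sqrtr ?mulr_ge0// -lee_fin.
  apply: (le_trans (hCl f x z tf cf uf (le_lt_trans sf (ltry _)))).
  rewrite mulrAC (EFinM _ M); apply: lee_wpmul2l => //.
  by rewrite lee_fin mulr_ge0// sqr_ge0.
have mpf : measurable_fun setT (partial i f : borel_rV R N -> R) by exact: continuous_measurable_rV.
(* The derivative is uniformly tempered through its sup bound, the Lipschitz constant of [f]. *)
have upf : utemp (partial i f).
  by apply: (utemp_bounded (M := Num.sqrt (Cl * M))) => // x; apply: partial_le.
have HB x : `|convolve K (partial i f) x| <= L / 2.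
  apply: abs_le_of_sq; first by rewrite divr_ge0// ltW.
  have h : ((convolve K (partial i f) x ^+ 2)%:E <= b%:E * LPsq chi phi j (partial i f))%E.
    by have [h1 h2] := hCb j (partial i f) x upf; case: hK => ->; [exact: h1|exact: h2].
  rewrite -lee_fin; apply: (le_trans h).
  apply: (@le_trans _ _ (b%:E * ((L / 2) ^+ 2 / (b + 1))%:E)%E).
    by apply: lee_wpmul2l; [rewrite lee_fin|exact: ltW].
  rewrite -EFinM lee_fin mulrCA ler_piMr ?sqr_ge0// ler_pdivrMr// mul1r lerDl//.
have GL x z : `|convolve K f (x + z) - convolve K f x| <= La * l1 z.
  have l0 := l1_ge0 z; rewrite convolve_increment//.
  apply: (@le_trans _ _ (Num.sqrt (Ch * (Cs * M)) * l1 z)); last by rewrite ler_wpM2r// lerDl.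
  apply: abs_le_of_sq; first by rewrite mulr_ge0// sqrtr_ge0.
  rewrite exprMn sqr_sqrtr ?mulr_ge0// -lee_fin.
  apply: (le_trans (sq_conv_sup x (measurable_shift_diff z mK) mf)).
  have h : (sq (shift_diff z K) <= (Ch * l1 z ^+ 2)%:E)%E.
    apply: le_trans (hCh z); case: hK => ->; first by rewrite leeDl// sq_ge0.
    by rewrite leeDr// sq_ge0.
  apply: (@le_trans _ _ ((Ch * l1 z ^+ 2)%:E * (Cs * M)%:E)%E).
    by apply: lee_pmul => //; exact: sq_ge0.
  by rewrite -EFinM lee_fin mulrAC.
have Gdir := directional_lipschitz GL
  (fun x => convolve_right_derivative (x := x) rK mf uf fL df) HB.
have L2 : L / 2 < L by rewrite ltr_pdivrMr// ltr_pMr// ltr1n.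
have := mass_lower_bound La0 eta0 (ltW L0) GL (Gdir L L2) Kf hL.
rewrite -/rho -mulrA -/v => low.
have up : (sq (convolve K f) <= Q%:E)%E.
  apply: (le_trans (sq_conv_le mK mf Ka)); rewrite /Q (EFinM (a ^+ 2)).
  by apply: lee_wpmul2l => //; rewrite lee_fin sqr_ge0.
by have := le_trans low up; rewrite lee_fin leNgt hm.
Qed.

End gradient_detects.

Section barrier.
Context {R : realType}.
Local Open Scope ereal_scope.

(* If q reached the level eta at arbitrarily large times it would stay above
   eta/2 on infinitely many disjoint time intervals of equal length, on each of
   which the dissipation is bounded below. *)
Lemma dissipation_barrier (X : Type) (D : R -> \bar R) (I L : R) (q : X -> R -> R) :
  (0 < L)%R -> (forall t, 0 <= D t) ->
  (forall t, (0 <= t)%R -> \int[lebesgue_measure]_(tau in `[0%R, t]) D tau <= I%:E) ->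
  (forall x r t, (0 <= r)%R -> (r <= t)%R -> (`|q x t - q x r| <= L * (t - r))%R) ->
  (forall eta, (0 < eta)%R -> exists2 c : R, (0 < c)%R &
     forall x t, (0 <= t)%R -> (eta <= q x t)%R -> c%:E <= D t) ->
  forall eta, (0 < eta)%R ->
    exists2 T : R, (0 <= T)%R & forall t, (T <= t)%R -> forall x, (q x t < eta)%R.
Proof.
move=> L0 D0 DI qL qD eta eta0; apply: contrapT => nT.
have [c c0 hc] := qD (eta / 2)%R (divr_gt0 eta0 (ltr0Sn R 1)).
pose h := (eta / 2 / L)%R.
have h0 : (0 < h)%R by rewrite !divr_gt0.
(* The condition [0 <= T] is placed inside so that [choice] yields a function of all real T. The
   index x may change from one T to another. *)
have step T : exists t : R, (0 <= T)%R -> (T <= t)%R /\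
    forall s, (t <= s <= t + h)%R -> c%:E <= D s.
  have [T0|] := boolP (0 <= T)%R; last by exists 0%R.
  have [t [Tt [x qx]]] : exists t, (T <= t)%R /\ exists x, (eta <= q x t)%R.
    apply: contrapT => hn; apply: nT; exists T => // t Tt x; rewrite ltNge.
    by apply/negP => qx; apply: hn; exists t; split => //; exists x.
  exists t => _; split => // s /andP[ts sth].
  have t0 : (0 <= t)%R by exact: le_trans Tt.
  apply: (hc x); first exact: le_trans ts.
  have := qL x t s t0 ts.
  have : (L * (s - t) <= eta / 2)%R by rewrite mulrC -ler_pdivlMr// -/h; lra.
  by rewrite ler_norml => h1 /andP[h2 _]; lra.
have [tau htau] := choice step.
(* The summand 1 separates consecutive closed intervals of length h. *)
pose t := fix t (k : nat) : R := if k is k'.+1 then tau (t k' + h + 1)%R else tau 0%R.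
have t0 k : (0 <= t k)%R.
  elim: k => [|k IH] /=; first by have [] := htau 0%R (lexx _).
  have p : (0 <= t k + h + 1)%R by rewrite !addr_ge0// ltW.
  by have [h1 _] := htau _ p; exact: le_trans h1.
have tS k : (t k + h + 1 <= t k.+1)%R.
  have p : (0 <= t k + h + 1)%R by rewrite !addr_ge0// ltW.
  by have [] := htau _ p.
have tD k s : (t k <= s <= t k + h)%R -> c%:E <= D s.
  case: k => [|k] /=; first by have [_] := htau 0%R (lexx _); exact.
  have p : (0 <= t k + h + 1)%R by rewrite !addr_ge0// ltW.
  by have [_] := htau _ p; exact.
have tlt k l : (k < l)%N -> (t k + h < t l)%R.
  elim: l => // l IH; rewrite ltnS leq_eqVlt => /orP[/eqP->|/IH kl].
    by have := tS l; lra.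
  by have := tS l; have := h0; lra.
have ch : (0 < c * h)%R by exact: mulr_gt0.
have [m hm] : exists m : nat, (I < m%:R * c * h)%R.
  exists (Num.bound `|I / (c * h)|%R); rewrite -mulrA -ltr_pdivrMr//.
  by rewrite (le_lt_trans (ler_norm _))// archi_boundP.
have low : (m%:R * c * h)%:E <= \int[lebesgue_measure]_(tau in `[0%R, (t m + h)%R]) D tau.
  apply: (@disjoint_lower_bound _ _ R lebesgue_measure _ D m
    (fun k => `[t k, (t k + h)%R]%classic) c h) => //.
  - exact: ltW.
  - move=> k l x /=; rewrite !in_itv/= => /andP[k1 k2] /andP[l1 l2].
    have [kl|lk|//] := ltngtP k l.
      by have := lt_le_trans (lt_le_trans (tlt _ _ kl) l1) k2; rewrite ltxx.
    by have := lt_le_trans (lt_le_trans (tlt _ _ lk) k1) l2; rewrite ltxx.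
  - move=> k; apply: etrans (lebesgue_measure_itv `[t k, (t k + h)%R]) _.
    rewrite /= lte_fin ltrDl h0.
    by rewrite -EFinB addrAC subrr add0r.
  - move=> k x km /=; rewrite !in_itv/= => /andP[k1 k2]; split.
      rewrite (le_trans (t0 k) k1)/=.
      by have := tlt _ _ km; have := h0; lra.
    by apply: (tD k); rewrite k1 k2.
have p : (0 <= t m + h)%R by rewrite addr_ge0// ltW.
by have := le_trans low (DI _ p); rewrite lee_fin leNgt hm.
Qed.

Lemma lam_decay (s : R) : (0 < s)%R -> forall d, (0 < d)%R ->
  exists J, forall j, (J <= j)%N -> (lam (- s) j <= d)%R.
Proof.
move=> s0 d d0; have [C [C0 hC]] := sum_lamV_le s0.
have E j : (lam (- s) j = (lam s j)^-1)%R.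
  by rewrite /lam mulrN powRN exprVn.
have cv : cvgn (series (fun j => (lam s j)^-1)%R).
  apply: nondecreasing_is_cvgn.
    apply/nondecreasing_seqP => n; rewrite /series /= big_nat_recr//= lerDl invr_ge0 ltW//.
    exact: lam_gt0.
  by exists C => _ [n _ <-]; exact: hC.
have := cvg_series_cvg_0 cv.
move=> /cvgrPdist_le /(_ d d0)[J _ hJ]; exists J => j /hJ.
by rewrite E sub0r normrN ger0_norm// invr_ge0 ltW// lam_gt0.
Qed.

Lemma weighted_tail (s s' M : R) (a : nat -> R -> \bar R) : (s' < s)%R ->
  (forall j t, 0 <= a j t) ->
  (exists T : R, forall t, (T <= t)%R -> \sum_(0 <= j <oo) ((lam s j)%:E * a j t) <= M%:E) ->
  (forall j d, (0 < d)%R -> exists T : R, forall t, (T <= t)%R -> a j t <= d%:E) ->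
  forall d, (0 < d)%R -> exists T : R, forall t, (T <= t)%R ->
    \sum_(0 <= j <oo) ((lam s' j)%:E * a j t) <= d%:E.
Proof.
move=> ss' a0 [T0 hT0] ha d d0.
have M0 : (0 <= M)%R.
  rewrite -lee_fin (le_trans _ (hT0 T0 (lexx _)))//; apply: nneseries_ge0 => j _ _.
  by rewrite mule_ge0// lee_fin ltW// lam_gt0.
have l0 (r : R) j : (0 <= lam r j)%R by rewrite ltW// lam_gt0.
have M1 : (0 < M + 1)%R by rewrite ltr_wpDl.
have dM : (0 < d / 2 / (M + 1))%R by rewrite !divr_gt0.
have sd : (0 < s - s')%R by rewrite subr_gt0.
have [J hJ] := lam_decay sd dM.
(* Each of the J low frequencies gets an equal share of d / 2; J + 1 avoids a division by 0. *)
have hj j : exists T : R, forall t, (T <= t)%R -> (lam s' j)%:E * a j t <= (d / 2 / J.+1%:R)%:E.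
  have p : (0 < d / 2 / J.+1%:R / lam s' j)%R by rewrite !divr_gt0// ?lam_gt0.
  have [T hT] := ha j _ p; exists T => t /hT h.
  apply: (@le_trans _ _ ((lam s' j)%:E * (d / 2 / J.+1%:R / lam s' j)%:E)).
    by apply: lee_wpmul2l => //; rewrite lee_fin.
  by rewrite -EFinM lee_fin mulrC divfK// gt_eqF// lam_gt0.
have [T hT] := choice hj.
exists (`|T0| + \sum_(j < J) `|T j|)%R => t ht.
have sT0 : (0 <= \sum_(j < J) `|T j| :> R)%R by rewrite sumr_ge0.
have tT0 : (T0 <= t)%R by rewrite (le_trans (ler_norm _))// (le_trans _ ht)// lerDl.
have tT j : (j < J)%N -> (T j <= t)%R.
  move=> jJ; rewrite (le_trans (ler_norm _))// (le_trans _ ht)//.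
  by rewrite (bigD1 (Ordinal jJ))//= addrCA lerDl addr_ge0// sumr_ge0.
have pos r j : 0 <= (lam r j)%:E * a j t by rewrite mule_ge0// lee_fin.
(* [b] majorises the low frequencies. For the others [g] uses that lowering the order from s to s'
   gains the factor [lam (- (s - s')) j], at most d / 2 / (M + 1) from J on. *)
pose b j : \bar R := if (j < J)%N then (d / 2 / J.+1%:R)%:E else 0.
have b0 j : 0 <= b j by rewrite /b; case: ifP => // _; rewrite lee_fin !divr_ge0// ltW.
pose g j := (d / 2 / (M + 1))%:E * ((lam s j)%:E * a j t).
have g0 j : 0 <= g j by rewrite mule_ge0// lee_fin ltW.
apply: (@le_trans _ _ (\sum_(0 <= j <oo) (b j + g j))).
  apply: lee_nneseries => j; first by move=> _ _; exact: pos.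
  move=> _; rewrite /b; case: ltnP => jJ.
    by rewrite (le_trans (hT j t (tT j jJ)))// leeDl.
  rewrite add0e /g muleA -EFinM; apply: lee_wpmul2r => //; rewrite lee_fin.
  have -> : (s' = s + - (s - s'))%R by ring.
  by rewrite lamD mulrC ler_wpM2r// hJ.
rewrite nneseriesD// (splitr d) EFinD; apply: leeD; last first.
  rewrite nneseriesZl; last by move=> j _; exact: pos.
  apply: (@le_trans _ _ ((d / 2 / (M + 1))%:E * M%:E)).
    by apply: lee_wpmul2l; [rewrite lee_fin ltW|exact: hT0].
  by rewrite -EFinM lee_fin mulrAC -(mulrA (d / 2)%R) ler_piMr ?divr_ge0 ?(ltW d0)// ler_pdivrMr// mul1r lerDl.
rewrite (@nneseries_split _ _ 0 J)// add0n eseries0 ?adde0; last first.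
  by move=> j Jj _; rewrite /b ltnNge Jj.
apply: (@le_trans _ _ (\sum_(0 <= j < J) (d / 2 / J.+1%:R)%:E)).
  by rewrite !big_mkord; apply: lee_sum => j _; rewrite /b ltn_ord.
rewrite big_mkord sumEFin sumr_const card_ord lee_fin.
rewrite -[X in (X <= _)%R]mulr_natr mulrAC -(mulrA (d / 2)%R) ler_piMr ?divr_ge0 ?(ltW d0)//.
by rewrite ler_pdivrMr// mul1r ler_nat.
Qed.

End barrier.

(** * Decay of the Besov norms *)

Lemma sqrD_le_sqr (R : realFieldType) (u v d : R) : `|u| < d / 2 -> `|v| < d / 2 ->
  u ^+ 2 + v ^+ 2 <= d ^+ 2.
Proof. by rewrite !ltr_norml => /andP[? ?] /andP[? ?]; nra. Qed.

Section interpolation.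
Context {R : realType} {N : nat}.
Local Notation E := 'rV[R]_N.
Local Notation leb := (lebesgue_rV R N).
Local Open Scope ereal_scope.

(** T^p <= B^(p - 2) T^2. The square of the norm is estimated because the Besov sums are sums of
    squares. *)
Lemma Lnorm_interpolation (T : E -> R) (p B D : R) : (2 < p)%R ->
  measurable_fun setT (T : borel_rV R N -> R) -> (forall x, 0 <= T x <= B)%R -> (0 <= D)%R ->
  sq T <= D%:E ->
  Lnorm leb p%:E (fun x : borel_rV R N => (T x)%:E) `^ 2 <= ((B `^ (p - 2) * D) `^ (2 / p))%:E.
Proof.
move=> p2 mT TB D0 TD; have p0 : (0 < p)%R by exact: lt_trans p2.
have p20 : (0 < p - 2)%R by rewrite subr_gt0.
have T0 x : (0 <= T x)%R by have /andP[] := TB x.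
have TleB x : (T x <= B)%R by have /andP[] := TB x.
have B0 : (0 <= B)%R by exact: le_trans (TleB 0%R).
have -> : Lnorm leb p%:E (fun x : borel_rV R N => (T x)%:E) = (\int[leb]_x (T x `^ p)%:E) `^ p^-1.
  rewrite unlock; congr (_ `^ _); apply: eq_integral => x _ /=.
  by rewrite ger0_norm.
rewrite -poweRrM (mulrC (p^-1)%R) -poweR_EFin.
have I0 : 0 <= \int[leb]_x (T x `^ p)%:E.
  by apply: integral_ge0 => x _; rewrite lee_fin powR_ge0.
apply: gt0_ler_poweR.
- by rewrite divr_ge0// ltW.
- by rewrite in_itv/= I0 leey.
- by rewrite in_itv/= leey lee_fin mulr_ge0 ?powR_ge0.
have mp : measurable_fun setT (fun x : borel_rV R N => (T x `^ p)%R).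
  exact: (measurableT_comp (measurable_powR p) mT).
apply: (@le_trans _ _ (\int[leb]_x ((B `^ (p - 2))%:E * (T x ^+ 2)%:E))).
  apply: ge0_le_integral => //.
  - by move=> x _; rewrite lee_fin powR_ge0.
  - exact/measurable_EFinP.
  - by apply: emeasurable_funM => //; apply/measurable_EFinP; exact: measurable_funX.
  - move=> x _; rewrite -EFinM lee_fin.
    have -> : (p = (p - 2) + 2)%R by rewrite subrK.
    rewrite powRD; last by rewrite subrK gt_eqF.
    rewrite addrK powR_mulrn// ler_wpM2r ?sqr_ge0//.
    by apply: ge0_ler_powR; rewrite ?nnegrE// ltW.
rewrite ge0_integralZl//; last 3 first.
- by apply/measurable_EFinP; exact: measurable_funX.
- by move=> x _; rewrite lee_fin sqr_ge0.
- by rewrite lee_fin powR_ge0.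
by rewrite EFinM; apply: lee_wpmul2l; rewrite ?lee_fin ?powR_ge0.
Qed.

Lemma small_interpolation (p M d : R) : (2 < p)%R -> (0 <= M)%R -> (0 < d)%R ->
  exists2 B : R, (0 < B)%R & ((B `^ (p - 2) * M) `^ (2 / p) <= d)%R.
Proof.
move=> p2 M0 d0; have p0 : (0 < p)%R by exact: lt_trans p2.
have p20 : (0 < p - 2)%R by rewrite subr_gt0.
pose th := ((p - 2) * (2 / p))%R.
have th0 : (0 < th)%R by rewrite mulr_gt0// divr_gt0.
pose m := (M `^ (2 / p) + 1)%R.
have m0 : (0 < m)%R by rewrite ltr_wpDl// powR_ge0.
exists ((d / m) `^ th^-1)%R; first by rewrite powR_gt0// divr_gt0.
rewrite powRM ?powR_ge0// -powRrM -/th -powRrM mulVf ?gt_eqF// powRr1 ?divr_ge0 ?(ltW d0) ?(ltW m0)//.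
by rewrite mulrAC ler_pdivrMr// ler_wpM2l ?(ltW d0)// /m lerDl.
Qed.

(** [Num.sqrt (K * D)] is the sup bound that Bernstein's inequality gives for a block of squared L2
    norm D. With it the powers of D add up to 1, so the interpolated bound is again linear in D. *)
Lemma scaled_interpolation (p K D : R) : (2 < p)%R -> (0 <= K)%R -> (0 <= D)%R ->
  ((Num.sqrt (K * D) `^ (p - 2) * D) `^ (2 / p) = K `^ ((p - 2) / p) * D)%R.
Proof.
move=> p2 K0 D0; have p0 : (0 < p)%R by exact: lt_trans p2.
have pn : (p != 0)%R by rewrite gt_eqF.
have s1 : (Num.sqrt (K * D) `^ (p - 2) = K `^ (2^-1 * (p - 2)) * D `^ (2^-1 * (p - 2)))%R.
  by rewrite -powR12_sqrt ?mulr_ge0// -powRrM powRM.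
have s2 : (D `^ (2^-1 * (p - 2)) * D = D `^ (p / 2))%R.
  have e1 : (2^-1 * (p - 2) + 1 = p / 2)%R by field.
  rewrite -[X in (_ * X)%R = _]powRr1// -powRD e1//.
  by rewrite mulf_eq0 (negbTE pn)/= invr_eq0 pnatr_eq0.
rewrite s1 -mulrA s2 powRM ?powR_ge0// -!powRrM; congr (_ * _)%R.
  by congr (powR _ _); field.
by rewrite (_ : p / 2 * (2 / p) = 1)%R ?powRr1//; field.
Qed.

End interpolation.

Section decay.
Context {R : realType} {N : nat}.
Local Notation E := 'rV[R]_N.
Local Notation leb := (lebesgue_rV R N).
Local Notation kre := (@ifourier_re R N).
Local Notation kim := (@ifourier_im R N).
Implicit Types (f g h K : E -> R).

Lemma convolve_sub K f g x : rapid K -> tempered f -> tempered g ->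
  convolve K f x - convolve K g x = convolve K (fun y => f y - g y) x.
Proof.
move=> rK tf tg; rewrite /convolve -RintegralB//.
- by apply: eq_Rintegral => y _; rewrite mulrBr.
- exact: integrable_conv_tempered.
- exact: integrable_conv_tempered.
Qed.

Local Open Scope ereal_scope.

Lemma nrm2_convolve_le K (a b : R) h : rapid K -> \int[leb]_y `|K y|%:E = a%:E ->
  measurable_fun setT (h : borel_rV R N -> R) -> (0 <= a)%R -> (0 <= b)%R -> nrm2 h <= b%:E ->
  nrm2 (convolve K h) <= (a * b)%:E.
Proof.
move=> rK Ka mh a0 b0; rewrite nrm2_le// nrm2_le ?mulr_ge0// => hb.
apply: (le_trans (sq_conv_le (rapid_measurable rK) mh Ka)).
rewrite exprMn (EFinM (a ^+ 2)%R); apply: lee_wpmul2l => //.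
by rewrite lee_fin sqr_ge0.
Qed.

Lemma nrm2_subC f g : nrm2 (fun x => f x - g x)%R = nrm2 (fun x => g x - f x)%R.
Proof.
by rewrite !nrm2E; congr (_ `^ _); apply: eq_integral => x _; rewrite -sqrrN opprB.
Qed.

Variables (chi phi : E -> R).
Hypothesis hLP : LP_pair chi phi.
Local Notation S := (LP_symbol chi phi).
Variables (e M L I : R) (D : R -> \bar R) (f : R -> E -> R).
Hypotheses (e0 : (0 < e)%R) (M0 : (0 <= M)%R) (L0 : (0 < L)%R) (N0 : (0 < N)%N)
  (D0 : forall t, 0 <= D t)
  (DI : forall t, (0 <= t)%R -> \int[lebesgue_measure]_(tau in `[0%R, t]) D tau <= I%:E)
  (tf : forall t, (0 <= t)%R -> tempered (f t))
  (cf : forall t, (0 <= t)%R -> continuous (f t))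
  (fM : forall t, (0 <= t)%R -> sqnorm chi phi (sigma R N + e) (f t) <= M%:E)
  (fL : forall r t, (0 <= r)%R -> (r <= t)%R -> nrm2 (fun x => f t x - f r x)%R <= (L * (t - r))%:E).

Let mf t (t0 : (0 <= t)%R) := tempered_measurable (tf t0).

Lemma block_decay j : (forall t, (0 <= t)%R -> sqnorm chi phi (sigma R N + e) (f t) <= D t) ->
  forall d, (0 < d)%R -> exists2 T : R, (0 <= T)%R & forall t, (T <= t)%R ->
    LPsq chi phi j (f t) <= d%:E.
Proof.
move=> fD.
have key K : K = kre (S j) \/ K = kim (S j) -> forall d, (0 < d)%R ->
    exists2 T : R, (0 <= T)%R & forall t, (T <= t)%R -> sq (convolve K (f t)) <= d%:E.
  move=> hK; have rK := LP_kernel_rapid hLP hK; have [a a0 Ka] := rapid_L1 rK.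
  have mK := rapid_measurable rK.
  have sqK t : sq (convolve K (f t)) <= LPsq chi phi j (f t).
    by case: hK => ->; [exact: (leeDl _ (sq_ge0 _))|exact: (leeDr _ (sq_ge0 _))].
  have finK t : (0 <= t)%R -> nrm2 (convolve K (f t)) \is a fin_num.
    move=> t0; rewrite ge0_fin_numE ?nrm2_ge0// nrm2_lty (le_lt_trans (sqK t))//.
    exact: LPsq_lty hLP _ _ _ (mf t0) (le_lt_trans (fM t0) (ltry _)).
  (* The barrier is used with a single index, since the L2 norm over space is one function of
     time. *)
  pose q (_ : unit) t := fine (nrm2 (convolve K (f t))).
  have qE t : (0 <= t)%R -> (q tt t)%:E = nrm2 (convolve K (f t)).
    by move=> t0; rewrite fineK// finK.
  have q0 t : (0 <= q tt t)%R by rewrite fine_ge0// nrm2_ge0.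
  have half r t : (0 <= r)%R -> (0 <= t)%R -> forall b : R, (0 <= b)%R ->
      nrm2 (fun x => f t x - f r x)%R <= b%:E -> (q tt t <= q tt r + a * b)%R.
    move=> r0 t0 b b0 hb; rewrite -lee_fin EFinD !qE//.
    have mc := measurable_conv mK (mf r0).
    have md := measurable_conv mK (measurable_funB (mf t0) (mf r0)).
    have := minkowski2 mc md.
    rewrite (_ : (fun x => _) = convolve K (f t)); last first.
      apply/funext => x; rewrite -convolve_sub//; [|exact: tf|exact: tf].
      by rewrite addrC subrK.
    move=> /le_trans; apply; apply: leeD => //.
    by apply: (nrm2_convolve_le rK Ka) => //; apply: measurable_funB; exact: mf.
  (* The summand 1 keeps the constant positive even if [a] vanishes. *)
  have qL (x : unit) r t : (0 <= r)%R -> (r <= t)%R -> (`|q x t - q x r| <= (a * L + 1) * (t - r))%R.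
    case: x => r0 rt; have t0 : (0 <= t)%R by exact: le_trans rt.
    have b0 : (0 <= L * (t - r))%R by rewrite mulr_ge0 ?subr_ge0// ltW.
    have h1 := half r t r0 t0 _ b0 (fL r0 rt).
    have h2 : (q tt r <= q tt t + a * (L * (t - r)))%R.
      by apply: half => //; rewrite nrm2_subC; exact: fL.
    have tr : (0 <= t - r)%R by rewrite subr_ge0.
    have -> : ((a * L + 1) * (t - r) = a * (L * (t - r)) + (t - r))%R by ring.
    by rewrite ler_norml; apply/andP; split; lra.
  have aL : (0 < a * L + 1)%R by rewrite ltr_wpDl// mulr_ge0// ltW.
  move=> d d0; have sd : (0 < Num.sqrt d)%R by rewrite sqrtr_gt0.
  have [|T T0 hT] := @dissipation_barrier R unit D I _ q aL D0 DI qL _ _ sd.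
    move=> eta eta0; exists (lam (sigma R N + e) j * eta ^+ 2)%R.
      by rewrite mulr_gt0 ?lam_gt0// exprn_gt0.
    move=> [] t t0 hq; apply: le_trans (fD t t0).
    apply: le_trans (LPsq_le_sqnorm hLP _ j (mf t0)).
    rewrite EFinM; apply: lee_wpmul2l; first by rewrite lee_fin ltW// lam_gt0.
    apply: le_trans (sqK t); rewrite -nrm2_sq -qE// -EFinM -expr2 lee_fin.
    by apply: lerXn2r => //; rewrite nnegrE ?q0// ltW.
  exists T => // t Tt; have t0 : (0 <= t)%R by exact: le_trans Tt.
  have := hT t Tt tt => /ltW qd; rewrite -nrm2_sq -qE// -EFinM -expr2 lee_fin.
  by rewrite -[leRHS](sqr_sqrtr (ltW d0)); apply: lerXn2r; rewrite ?nnegrE ?sqrtr_ge0.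
move=> d d0; have d2 : (0 < d / 2)%R by rewrite divr_gt0.
have [T1 T10 h1] := key _ (or_introl erefl) _ d2.
have [T2 T20 h2] := key _ (or_intror erefl) _ d2.
exists (T1 + T2)%R; first by rewrite addr_ge0.
move=> t ht; rewrite (splitr d) EFinD /LPsq; apply: leeD.
  by apply: h1; rewrite (le_trans _ ht)// lerDl.
by apply: h2; rewrite (le_trans _ ht)// lerDr.
Qed.

(** The barrier is indexed by the points x, so its time T is uniform in x. Cauchy-Schwarz with the
    kernel turns Lipschitz dependence on time in L2 into a pointwise one. *)
Lemma sup_decay (i : 'I_N) (j : nat) :
  (forall t x, (0 <= t)%R -> derivable (f t) x (delta_mx 0%R i)) ->
  (forall t, (0 <= t)%R -> continuous (partial i (f t))) ->
  (forall t, (0 <= t)%R -> sqnorm chi phi (sigma R N - 1 + e) (partial i (f t)) <= D t) ->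
  forall d, (0 < d)%R -> exists2 T : R, (0 <= T)%R & forall t, (T <= t)%R ->
    forall x, (multiplier_abs (S j) (f t) x <= d)%R.
Proof.
move=> df cp fD.
have key K : K = kre (S j) \/ K = kim (S j) -> forall d, (0 < d)%R ->
    exists2 T : R, (0 <= T)%R & forall t, (T <= t)%R -> forall x, (`|convolve K (f t) x| < d)%R.
  move=> hK; have rK := LP_kernel_rapid hLP hK; have mK := rapid_measurable rK.
  have finK : nrm2 K \is a fin_num.
    by rewrite ge0_fin_numE ?nrm2_ge0// nrm2_lty rapid_sq_lty.
  pose b := fine (nrm2 K); have b0 : (0 <= b)%R by rewrite fine_ge0// nrm2_ge0.
  have bE : nrm2 K = b%:E by rewrite fineK.
  pose q x t := `|convolve K (f t) x|%R.
  have qL x r t : (0 <= r)%R -> (r <= t)%R -> (`|q x t - q x r| <= (b * L + 1) * (t - r))%R.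
    move=> r0 rt; have t0 : (0 <= t)%R by exact: le_trans rt.
    have tr : (0 <= t - r)%R by rewrite subr_ge0.
    rewrite (le_trans (ler_dist_dist _ _))// convolve_sub//; [|exact: tf|exact: tf].
    rewrite (@le_trans _ _ (b * (L * (t - r)))%R)//; last first.
      by rewrite mulrDl mul1r mulrA lerDl.
    rewrite -lee_fin; apply: (le_trans (conv_le_nrm2 x mK (measurable_funB (mf t0) (mf r0)))).
    by rewrite EFinM bE; apply: lee_wpmul2l; [rewrite lee_fin|exact: fL].
  have bL : (0 < b * L + 1)%R by rewrite ltr_wpDl// mulr_ge0// ltW.
  move=> d d0.
  have [|T T0 hT] := @dissipation_barrier R E D I _ q bL D0 DI qL _ _ d0.
    move=> eta eta0.
    have [kappa k0 hk] := gradient_lower_bound hLP N0 e0 M0 eta0 hK.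
    exists (lam (sigma R N - 1 + e) j * kappa)%R; first by rewrite mulr_gt0// lam_gt0.
    move=> x t t0 hq; apply: le_trans (fD t t0).
    have mp : measurable_fun setT (partial i (f t) : borel_rV R N -> R).
      by apply: continuous_measurable_rV; exact: cp.
    apply: le_trans (LPsq_le_sqnorm hLP _ j mp).
    rewrite EFinM; apply: lee_wpmul2l; first by rewrite lee_fin ltW// lam_gt0.
    apply: (hk (f t) x) => //; [exact: tf|exact: cf|by move=> y; exact: df|exact: cp|exact: fM].
  by exists T => // t Tt x; exact: hT.
move=> d d0; have d2 : (0 < d / 2)%R by rewrite divr_gt0.
have [T1 T10 h1] := key _ (or_introl erefl) _ d2.
have [T2 T20 h2] := key _ (or_intror erefl) _ d2.
exists (T1 + T2)%R; first by rewrite addr_ge0.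
move=> t ht x.
have k1 : (`|LPre chi phi j (f t) x| < d / 2)%R by apply: h1; rewrite (le_trans _ ht)// lerDl.
have k2 : (`|LPim chi phi j (f t) x| < d / 2)%R by apply: h2; rewrite (le_trans _ ht)// lerDr.
rewrite multiplier_absE -(ger0_norm (ltW d0)) -sqrtr_sqr ler_sqrt ?sqr_ge0//.
exact: sqrD_le_sqr k1 k2.
Qed.

End decay.

Section besov_decay.
Context {R : realType} {N : nat}.
Local Notation E := 'rV[R]_N.
Local Notation leb := (lebesgue_rV R N).
Local Open Scope ereal_scope.

(** (2^(j + 1))^2 is the cost of one derivative in squared norms; 16 accounts for passing from j - 1
    to j + 1. *)
Lemma lam_sub1 (s : R) j : (lam (s - 1) j * (2 ^+ j.+1) ^+ 2 = 16 * lam s j)%R.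
Proof.
have n0 : (2%R : R) != 0%R by rewrite pnatr_eq0.
have -> : (16%R : R) = (4 ^+ 2)%R by rewrite -natrX.
rewrite /lam -!exprMn; congr (_ ^+ 2)%R.
have -> : (4%R : R) = (2 `^ 2)%R by rewrite powR_mulrn// -natrX.
rewrite -powR_mulrn// -!powRD; [|by rewrite n0 implybT|by rewrite n0 implybT].
by congr (powR _ _); rewrite -natr1; ring.
Qed.

Variables (chi phi : E -> R).
Hypothesis hLP : LP_pair chi phi.
Local Notation S := (LP_symbol chi phi).

Lemma measurable_multiplier_abs j (f : E -> R) : measurable_fun setT (f : borel_rV R N -> R) ->
  measurable_fun setT (multiplier_abs (S j) f : borel_rV R N -> R).
Proof.
move=> mf; apply: (measurableT_comp (f := @Num.sqrt R)).
  by apply: continuous_measurable_fun; exact: sqrt_continuous.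
by apply: measurable_funD; apply: measurable_funX; [exact: measurable_LPre|exact: measurable_LPim].
Qed.

(** The exponent relation raises the Bernstein factor (2^(j + 1))^N to the power 2 / N: in squared
    norms the loss is (2^(j + 1))^2, one derivative whatever N is. *)
Lemma Lnorm_bernstein (p : R) : (0 < N)%N -> (2 < p)%R -> ((p - 2) / p = 2 / N%:R)%R ->
  exists2 C : R, (0 <= C)%R & forall j (f : E -> R), utemp f -> LPsq chi phi j f < +oo ->
    Lnorm leb p%:E (fun x : borel_rV R N => (multiplier_abs (S j) f x)%:E) `^ 2 <=
    (C * (2 ^+ j.+1) ^+ 2)%:E * LPsq chi phi j f.
Proof.
move=> N0 p2 pN; have [Cb [Cb0 hCb]] := bernstein hLP.
have NR0 : (N%:R != 0 :> R)%R by rewrite pnatr_eq0 -lt0n.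
exists ((2 * Cb) `^ (2 / N%:R))%R; first exact: powR_ge0.
move=> j f uf fin; have mf := uf.1.
pose D := fine (LPsq chi phi j f).
have DE : LPsq chi phi j f = D%:E by rewrite fineK// ge0_fin_numE// LPsq_ge0.
have D0 : (0 <= D)%R by rewrite fine_ge0// LPsq_ge0.
pose K := (2 * Cb * (2 ^+ j.+1) ^+ N)%R.
have K0 : (0 <= K)%R by rewrite mulr_ge0 ?exprn_ge0// mulr_ge0.
have TB x : (0 <= multiplier_abs (S j) f x <= Num.sqrt (K * D))%R.
  apply/andP; split; first exact: sqrtr_ge0.
  rewrite multiplier_absE ler_sqrt ?mulr_ge0//.
  have [h1 h2] := hCb j f x uf; move: h1 h2; rewrite DE -!EFinM !lee_fin /K => h1 h2.
  by apply: (le_trans (lerD h1 h2)); rewrite le_eqVlt; apply/orP; left; apply/eqP; ring.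
have sT : sq (multiplier_abs (S j) f) <= D%:E by rewrite (sq_multiplier_abs hLP)// DE.
apply: (le_trans (Lnorm_interpolation p2 (measurable_multiplier_abs j mf) TB D0 sT)).
rewrite scaled_interpolation// DE -EFinM lee_fin pN /K powRM ?mulr_ge0 ?exprn_ge0//.
rewrite le_eqVlt; apply/orP; left; apply/eqP; congr (_ * _ * _)%R.
rewrite -powR_mulrn ?exprn_ge0// -powRrM -[RHS]powR_mulrn ?exprn_ge0//.
by congr (powR _ _); field.
Qed.

Variables (e e' M L I : R) (D : R -> \bar R) (f : R -> E -> R).
Hypotheses (e0 : (0 < e)%R) (ee' : (e' < e)%R) (M0 : (0 <= M)%R) (L0 : (0 < L)%R) (N0 : (0 < N)%N)
  (D0 : forall t, 0 <= D t)
  (DI : forall t, (0 <= t)%R -> \int[lebesgue_measure]_(tau in `[0%R, t]) D tau <= I%:E)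
  (tf : forall t, (0 <= t)%R -> tempered (f t))
  (cf : forall t, (0 <= t)%R -> continuous (f t))
  (fM : forall t, (0 <= t)%R -> sqnorm chi phi (sigma R N + e) (f t) <= M%:E)
  (fL : forall r t, (0 <= r)%R -> (r <= t)%R -> nrm2 (fun x => f t x - f r x)%R <= (L * (t - r))%:E).

Let mf t (t0 : (0 <= t)%R) := tempered_measurable (tf t0).

Lemma sqnorm_decay :
  (forall t, (0 <= t)%R -> sqnorm chi phi (sigma R N + e) (f t) <= D t) ->
  forall d, (0 < d)%R -> exists T : R, forall t, (T <= t)%R ->
    sqnorm chi phi (sigma R N + e') (f t) <= d%:E.
Proof.
move=> fD d d0.
have ss : (sigma R N + e' < sigma R N + e)%R by rewrite ltrD2l.
have [||T hT] := @weighted_tail R _ _ M (fun j t => LPsq chi phi j (f t)) ss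
  (fun j t => LPsq_ge0 chi phi j (f t)) _ _ d d0.
- by exists 0%R => t t0; rewrite -(sqnormE hLP)//; [exact: fM|exact: mf].
- move=> j d' d'0; have [T _ hT] := block_decay hLP L0 D0 DI tf fM fL j fD d'0.
  by exists T.
(* The absolute value ensures t >= 0, where the hypotheses on [f] apply. *)
exists `|T|%R => t ht; have t0 : (0 <= t)%R by exact: le_trans ht.
rewrite (sqnormE hLP); last exact: mf.
by apply: hT; rewrite (le_trans _ ht)// ler_norm.
Qed.

(** Interpolation enters twice. With the sup bound of Bernstein it gives an estimate at order sigma
    - 1 + e that is uniform in time and controls the high frequencies; with the decaying sup bound
    it makes each single block small. *)
Lemma besov_p_decay (p : R) (i : 'I_N) : (2 < p)%R -> ((p - 2) / p = 2 / N%:R)%R ->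
  (forall t x, (0 <= t)%R -> derivable (f t) x (delta_mx 0%R i)) ->
  (forall t, (0 <= t)%R -> continuous (partial i (f t))) ->
  (forall t, (0 <= t)%R -> sqnorm chi phi (sigma R N - 1 + e) (partial i (f t)) <= D t) ->
  forall d, (0 < d)%R -> exists T : R, forall t, (T <= t)%R ->
    besov_norm chi phi (sigma R N - 1 + e') p%:E 2 (f t) <= d%:E.
Proof.
move=> p2 pN df cp fD d d0.
have [C C0 hC] := Lnorm_bernstein N0 p2 pN.
have se0 : (0 < sigma R N + e)%R by rewrite addr_gt0// /sigma ltr_wpDr// divr_ge0.
have [Cs [Cs0 hCs]] := sq_le_sqnorm hLP se0.
have finS t : (0 <= t)%R -> sqnorm chi phi (sigma R N + e) (f t) < +oo.
  by move=> t0; exact: le_lt_trans (fM t0) (ltry _).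
have uf t : (0 <= t)%R -> utemp (f t).
  move=> t0; apply: utemp_L2; first exact: mf.
  apply: (le_lt_trans (hCs _ (tf t0) (cf t0))).
  by rewrite lte_mul_pinfty ?lee_fin// finS.
pose a j t := Lnorm leb p%:E (fun x : borel_rV R N => (multiplier_abs (S j) (f t) x)%:E) `^ 2.
have ss : (sigma R N - 1 + e' < sigma R N - 1 + e)%R by rewrite ltrD2l.
have d20 : (0 < d ^+ 2)%R by rewrite exprn_gt0.
have [||T hT] := @weighted_tail R _ _ (16 * C * M) a ss (fun j t => poweR_ge0 _ _) _ _ _ d20.
- exists 0%R => t t0.
  apply: (@le_trans _ _ (\sum_(0 <= j <oo) ((16 * C)%:E * ((lam (sigma R N + e) j)%:E * LPsq chi phi j (f t))))).
    apply: lee_nneseries => j; first by move=> _ _; rewrite mule_ge0 ?poweR_ge0// lee_fin ltW// lam_gt0.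
    move=> _; apply: (@le_trans _ _ ((lam (sigma R N - 1 + e) j)%:E *
        ((C * (2 ^+ j.+1) ^+ 2)%:E * LPsq chi phi j (f t)))).
      apply: lee_wpmul2l; first by rewrite lee_fin ltW// lam_gt0.
      by apply: hC; [exact: uf|exact: (LPsq_lty hLP _ (mf t0) (finS t t0))].
    rewrite !muleA -!EFinM le_eqVlt; apply/orP; left; apply/eqP; congr (_%:E * _).
    have -> : (sigma R N - 1 + e = (sigma R N + e) - 1)%R by ring.
    by rewrite mulrCA lam_sub1; ring.
  rewrite nneseriesZl; last first.
    by move=> j _; rewrite mule_ge0 ?LPsq_ge0// lee_fin ltW// lam_gt0.
  rewrite -(sqnormE hLP); last exact: mf.
  by rewrite (EFinM _ M); apply: lee_wpmul2l; [rewrite lee_fin mulr_ge0|exact: fM].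
- move=> j d' d'0; pose Mj := (M / lam (sigma R N + e) j)%R.
  have Mj0 : (0 <= Mj)%R by rewrite divr_ge0// ltW// lam_gt0.
  have [B B0 hB] := small_interpolation p2 Mj0 d'0.
  have [T T0 hT] := sup_decay hLP e0 M0 L0 N0 D0 DI tf cf fM fL j df cp fD B0.
  exists T => t Tt; have t0 : (0 <= t)%R by exact: le_trans Tt.
  have TB x : (0 <= multiplier_abs (S j) (f t) x <= B)%R by rewrite sqrtr_ge0/= hT.
  have sT : sq (multiplier_abs (S j) (f t)) <= Mj%:E.
    rewrite (sq_multiplier_abs hLP); last exact: mf.
    have h := le_trans (LPsq_le_sqnorm hLP (sigma R N + e) j (mf t0)) (fM t0).
    have fin := LPsq_lty hLP j (mf t0) (finS t t0).
    have p0 := LPsq_ge0 chi phi j (f t).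
    move: h fin p0; case: (LPsq chi phi j (f t)) => [r| |]// h _ _.
    by move: h; rewrite -EFinM !lee_fin /Mj ler_pdivlMr ?lam_gt0// mulrC.
  apply: (le_trans (Lnorm_interpolation p2 (measurable_multiplier_abs j (mf t0)) TB Mj0 sT)).
  by rewrite lee_fin.
exists T => t /hT h; rewrite /besov_norm.
under eq_eseriesr => j _ do rewrite besov_term.
have -> : d%:E = (d ^+ 2)%:E `^ 2^-1.
  by rewrite poweR_EFin powR12_sqrt ?sqr_ge0// sqrtr_sqr gtr0_norm.
apply: gt0_ler_poweR => //; rewrite ?in_itv/= ?leey ?andbT ?lee_fin ?sqr_ge0//.
by apply: nneseries_ge0 => j _ _; rewrite mule_ge0 ?poweR_ge0// lee_fin ltW// lam_gt0.
Qed.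

End besov_decay.

(** * The energy inequality and the limit at infinity *)

Section solution.
Context {R : realType} {N : nat}.
Local Notation E := 'rV[R]_N.

Lemma continuous_tx_section (f : R -> E -> R) t : continuous_tx f -> 0 <= t -> continuous (f t).
Proof.
move=> /subspace_continuousP cf t0 x.
have := cf (t, x) t0; apply: (cvg_comp (fun x' : E => (t, x'))) => P.
rewrite /within /= => h.
have [[A B] [/= tA xB] AB] := h.
apply: filterS xB => x' Bx'; apply: (AB (t, x')); last exact: t0.
by split => //=; exact: nbhs_singleton.
Qed.

Lemma ereal_cvg0 (F : R -> \bar R) : (forall t, (0 <= F t)%E) ->
  (forall d, 0 < d -> exists T : R, forall t, T <= t -> (F t <= d%:E)%E) ->
  F t @[t --> +oo] --> (0 : \bar R)%E.
Proof.
move=> F0 hF; apply/fine_cvgP; split.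
  have [T hT] := hF 1 ltr01; near=> t.
  rewrite ge0_fin_numE// (@le_lt_trans _ _ 1%:E)%E ?ltry//.
  by apply: hT; near: t; exact: (nbhs_pinfty_ge (num_real T)).
apply/cvgrPdist_le => d d0; have [T hT] := hF d d0; near=> t.
have h : (F t <= d%:E)%E by apply: hT; near: t; exact: (nbhs_pinfty_ge (num_real T)).
rewrite sub0r normrN ger0_norm ?fine_ge0//= -lee_fin fineK//.
by rewrite ge0_fin_numE// (le_lt_trans h)// ltry.
Unshelve. all: by end_near. Qed.

(** The difference quotients are equal, so the derivatives agree even where they take default
    values. *)
Lemma partial_subr (f : E -> R) (c : R) (i : 'I_N) :
  partial i (fun x => f x - c) = partial i f /\
  (forall x, derivable f x (delta_mx 0 i) -> derivable (fun x => f x - c) x (delta_mx 0 i)).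
Proof.
have q x : (fun h : R => h^-1 *: (((fun x => f x - c) \o shift x) (h *: delta_mx 0 i) - (f x - c))) =
    (fun h : R => h^-1 *: ((f \o shift x) (h *: delta_mx 0 i) - f x)).
  by apply/funext => h /=; congr (_ *: _); ring.
split=> [|x]; last by rewrite /derivable q.
by apply/funext => x; rewrite /partial /derive q.
Qed.

Lemma dt_subr (f : R -> E -> R) (c : R) : dt (fun t x => f t x - c) = dt f /\
  (forall t x, dt_derivable f t x -> dt_derivable (fun t x => f t x - c) t x).
Proof.
have q t x : dt_quot (fun t x => f t x - c) t x = dt_quot f t x.
  by apply/funext => tau; rewrite /dt_quot; congr (_ / _); ring.
split=> [|t x]; last by rewrite /dt_derivable q.
by apply/funext => t; apply/funext => x; rewrite /dt q.
Qed.

End solution.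

Section four_summands.
Context {R : realType}.
Local Open Scope ereal_scope.
Variables a b c d : \bar R.
Hypotheses (a0 : 0 <= a) (b0 : 0 <= b) (c0 : 0 <= c) (d0 : 0 <= d).

(** The bracketing is that of [energy]; [first_summands_le] follows that of [dissipation]. *)
Lemma summands_le : [/\ a <= a + b + (c + d), b <= a + b + (c + d),
  c <= a + b + (c + d) & d <= a + b + (c + d)].
Proof.
have cd := adde_ge0 c0 d0; have ab := adde_ge0 a0 b0.
split.
- by apply: (le_trans (leeDl _ b0)); exact: leeDl.
- by apply: (le_trans (leeDr _ a0)); exact: leeDl.
- by apply: (le_trans (leeDl _ d0)); exact: leeDr.
- by apply: (le_trans (leeDr _ c0)); exact: leeDr.
Qed.

Lemma first_summands_le : [/\ 0 <= a + (b + c + d), a <= a + (b + c + d) & b <= a + (b + c + d)].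
Proof.
have bc := adde_ge0 b0 c0; have bcd := adde_ge0 bc d0; split.
- exact: adde_ge0.
- exact: leeDl.
- apply: (le_trans (leeDl _ c0)); apply: (le_trans (leeDl _ d0)); exact: leeDr.
Qed.

End four_summands.

Section sqnorm_sums.
Context {R : realType} {N : nat}.
Local Notation E := 'rV[R]_N.
Local Open Scope ereal_scope.

Lemma sqnorm_ge0 (chi phi : E -> R) s f : 0 <= sqnorm chi phi s f.
Proof. exact: poweR_ge0. Qed.

Lemma sqnorm_vec_ge0 (chi phi : E -> R) s (v : E -> E) : 0 <= sqnorm_vec chi phi s v.
Proof. by apply: sume_ge0 => i _; exact: sqnorm_ge0. Qed.

Lemma sum_sqnorm_ge0 (chi phi : E -> R) s (v : 'I_N -> E -> R) :
  0 <= \sum_(i < N) sqnorm chi phi s (v i).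
Proof. by apply: sume_ge0 => i _; exact: sqnorm_ge0. Qed.

Lemma sqnorm_comp_le (chi phi : E -> R) s (v : E -> E) (i : 'I_N) :
  sqnorm chi phi s (Defs.comp v i) <= sqnorm_vec chi phi s v.
Proof. by rewrite /sqnorm_vec (bigD1 i)//= leeDl// sume_ge0// => k _; exact: sqnorm_ge0. Qed.

End sqnorm_sums.

Unset Implicit Arguments.

Theorem corollary1p1 (R : realType) (N : nat) (hN : (3 <= N)%N)
    (chi phi : 'rV[R]_N -> R) (hLP : LP_pair chi phi)
    (eps A a gam nbar : R) (heps : 0 < eps) (hA : 0 < A) (ha : 0 < a)
    (hgam : 1 <= gam) (hnbar : 0 < nbar)
    (delta0 mu0 : R)
    (hGE : global_existence_constants chi phi eps A a gam nbar delta0 mu0)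
    (n0 : 'rV[R]_N -> R) (u0 : 'rV[R]_N -> 'rV[R]_N)
    (hdata : small_data chi phi eps A a gam nbar delta0 n0 u0)
    (n : R -> 'rV[R]_N -> R) (u : R -> 'rV[R]_N -> 'rV[R]_N)
    (hsol : global_solution chi phi eps A a gam nbar n0 u0 n u)
    (eps' : R) (heps' : eps' < eps) :
  (besov_norm chi phi (sigma R N - 1 + eps')
      ((2 * N%:R) / (N%:R - 2))%:E 2 (fun x => n t x - nbar)
    @[t --> +oo] --> (0 : \bar R)%E) /\
  (besov22_norm_vec chi phi (sigma R N + eps') (u t)
    @[t --> +oo] --> (0 : \bar R)%E).
Proof.
have N0 : (0 < N)%N by exact: leq_trans hN.
have N3 : 3 <= N%:R :> R by rewrite ler_nat.
have s0 : 0 < sigma R N - 1 + eps.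
  have -> : sigma R N - 1 + eps = N%:R / 2 + eps by rewrite /sigma; ring.
  by rewrite ltr_wpDl// divr_ge0.
have [delta00 mu00 hex] := hGE.
have [n1 [u1 [gs en uniq]]] := hex n0 u0 hdata.
(* The energy inequality is stated for the solution that the existence result provides; uniqueness
   identifies it with the given one for t >= 0. *)
have eq1 := uniq n u hsol.
have en1 t : 0 <= t -> (energy chi phi eps nbar n1 u1 t + mu0%:E *
    \int[lebesgue_measure]_(tau in `[0%R, t]) dissipation chi phi eps n1 u1 tau <= delta0%:E)%E.
  by move=> t0; exact: le_trans (en t t0) hdata.2.
pose D := dissipation chi phi eps n1 u1.
have D3 t := first_summands_le (sqnorm_vec_ge0 chi phi (sigma R N + eps) (u1 t))
  (sum_sqnorm_ge0 chi phi (sigma R N - 1 + eps) (fun i => partial i (n1 t)))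
  (sqnorm_ge0 chi phi (sigma R N - 1 + eps) (dt n1 t))
  (sqnorm_vec_ge0 chi phi (sigma R N - 1 + eps) (dt_vec u1 t)).
have D0 t : (0 <= D t)%E by have [h _ _] := D3 t; exact: h.
have E4 t := summands_le (sqnorm_ge0 chi phi (sigma R N + eps) (fun x => n1 t x - nbar)%R)
  (sqnorm_vec_ge0 chi phi (sigma R N + eps) (u1 t))
  (sqnorm_ge0 chi phi (sigma R N - 1 + eps) (dt n1 t))
  (sqnorm_vec_ge0 chi phi (sigma R N - 1 + eps) (dt_vec u1 t)).
have ID0 t : (0 <= \int[lebesgue_measure]_(tau in `[0%R, t]) D tau)%E.
  by apply: integral_ge0 => tau _; exact: D0.
have M0 : 0 <= delta0 by exact: ltW.
have E0 t : (0 <= energy chi phi eps nbar n1 u1 t)%E.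
  by have [h _ _ _] := E4 t; apply: le_trans h; exact: sqnorm_ge0.
have DI t : 0 <= t -> (\int[lebesgue_measure]_(tau in `[0%R, t]) D tau <= (mu0^-1 * delta0)%:E)%E.
  move=> t0; have h : (mu0%:E * \int[lebesgue_measure]_(tau in `[0%R, t]) D tau <= delta0%:E)%E.
    by apply: le_trans (en1 t t0); rewrite leeDr.
  rewrite -[leLHS]mul1e -(mulVf (lt0r_neq0 mu00)) EFinM -muleA EFinM.
  by apply: lee_wpmul2l => //; rewrite lee_fin invr_ge0 ltW.
have enM t : 0 <= t -> (energy chi phi eps nbar n1 u1 t <= delta0%:E)%E.
  move=> t0; apply: le_trans (en1 t t0); rewrite leeDl// mule_ge0 ?ID0// lee_fin ltW//.
have en4 t : 0 <= t -> [/\ (sqnorm chi phi (sigma R N + eps) (fun x => n1 t x - nbar)%R <= delta0%:E)%E,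
    (sqnorm_vec chi phi (sigma R N + eps) (u1 t) <= delta0%:E)%E,
    (sqnorm chi phi (sigma R N - 1 + eps) (dt n1 t) <= delta0%:E)%E &
    (sqnorm_vec chi phi (sigma R N - 1 + eps) (dt_vec u1 t) <= delta0%:E)%E].
  move=> t0; have [h1 h2 h3 h4] := E4 t; have h := enM t t0.
  by split; [exact: le_trans h1 h|exact: le_trans h2 h|exact: le_trans h3 h|exact: le_trans h4 h].
split.
  pose f t x := n1 t x - nbar.
  have [cn ddn cdn pn] := gs_C1_n gs.
  have [dtE dtd] := dt_subr n1 nbar.
  have cf t : 0 <= t -> continuous (f t).
    move=> t0; apply: continuous_add; first exact: continuous_tx_section.
    by move=> x; exact: cst_continuous.
  have tf t : 0 <= t -> tempered (f t) by move=> t0; have [[]] := gs_C0B_n gs t0.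
  have [|||L [L0 hL]] := @time_lipschitz R N chi phi hLP (sigma R N - 1 + eps) delta0 f s0 (gs_C1B_n gs) cf.
  - by move=> t t0; rewrite dtE; exact: continuous_tx_section.
  - by move=> t x t0; apply: dtd; exact: ddn.
  - move=> t t0; rewrite dtE; have [_ _ h _] := en4 t t0; exact: h.
  (* A single coordinate direction is enough to detect the height of n - nbar. *)
  pose i0 : 'I_N := Ordinal N0.
  pose p : R := (2 * N%:R) / (N%:R - 2).
  have Nm2 : 0 < N%:R - 2 :> R by lra.
  (* Here p = 2 + 4 / (N - 2), hence 1 - 2 / p = 2 / N. *)
  have p2 : 2 < p by rewrite /p ltr_pdivlMr//; lra.
  have pN : (p - 2) / p = 2 / N%:R.
    by rewrite /p; field; rewrite !gt_eqF//; lra.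
  apply: ereal_cvg0 => [t|d d0]; first exact: poweR_ge0.
  have [||||T hT] := @besov_p_decay R N chi phi hLP eps eps' delta0 L (mu0^-1 * delta0) D f
    heps heps' M0 L0 N0 D0 DI tf cf _ hL p i0 p2 pN _ _ _ d d0.
  - move=> t t0; have [h _ _ _] := en4 t t0; exact: h.
  - by move=> t x t0; apply: (partial_subr _ _ _).2; apply: (pn i0).1.
  - move=> t t0; rewrite (partial_subr (n1 t) nbar i0).1.
    exact: (continuous_tx_section (pn i0).2 t0).
  - move=> t t0; rewrite (partial_subr (n1 t) nbar i0).1 /D /dissipation.
    apply: (@le_trans _ _ (\sum_(i < N) sqnorm chi phi (sigma R N - 1 + eps) (partial i (n1 t)))%E).
      rewrite (bigD1 i0)//=; apply: leeDl.
      by apply: sume_ge0 => k _; exact: sqnorm_ge0.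
    have [_ _ h] := D3 t; exact: h.
  exists `|T| => t ht; have t0 : 0 <= t by exact: le_trans ht.
  have -> : (fun x => n t x - nbar) = f t.
    by apply/funext => x; rewrite (eq1 t x t0).1.
  by apply: hT; rewrite (le_trans _ ht)// ler_norm.
have ui i d : 0 < d -> exists T : R, forall t, T <= t ->
    (sqnorm chi phi (sigma R N + eps') (Defs.comp (u1 t) i) <= d%:E)%E.
  pose f t := Defs.comp (u1 t) i.
  have [cu ddu cdu _] := gs_C1_u gs i.
  have cf t : 0 <= t -> continuous (f t) by move=> t0; exact: continuous_tx_section.
  have tf t : 0 <= t -> tempered (f t) by move=> t0; have [[]] := gs_C0B_u gs i t0.
  have [|||L [L0 hL]] := @time_lipschitz R N chi phi hLP (sigma R N - 1 + eps) delta0 f s0 (gs_C1B_u gs i) cf.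
  - by move=> t t0; exact: continuous_tx_section.
  - by move=> t x t0; exact: ddu.
  - move=> t t0; have [_ _ _ h] := en4 t t0; apply: le_trans h.
    have -> : dt f t = Defs.comp (dt_vec u1 t) i by apply/funext => x; rewrite /Defs.comp /dt_vec mxE.
    exact: sqnorm_comp_le.
  apply: (@sqnorm_decay R N chi phi hLP eps eps' delta0 L (mu0^-1 * delta0) D f
    heps' L0 D0 DI tf _ hL).
  - move=> t t0; have [_ h _ _] := en4 t t0; apply: le_trans h; exact: sqnorm_comp_le.
  - move=> t t0; have [_ h _] := D3 t; apply: le_trans h; exact: sqnorm_comp_le.
apply: ereal_cvg0 => [t|d d0]; first exact: poweR_ge0.
(* The target d for the norm means d^2 for its square, shared among the N components. *)
have d1 : 0 < d ^+ 2 / N%:R by rewrite divr_gt0 ?exprn_gt0// ltr0n.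
have [T hT] := choice (fun i => ui i _ d1).
(* An upper bound of all the [T i] that is also nonnegative. *)
exists (\sum_(i < N) `|T i|) => t ht.
have t0 : 0 <= t by rewrite (le_trans _ ht)// sumr_ge0.
have -> : u t = u1 t by apply/funext => x; rewrite (eq1 t x t0).2.
rewrite /besov22_norm_vec.
have -> : d%:E = ((d ^+ 2)%:E `^ 2^-1)%E.
  by rewrite poweR_EFin powR12_sqrt ?sqr_ge0// sqrtr_sqr gtr0_norm.
apply: gt0_ler_poweR => //.
- by rewrite in_itv/= leey sqnorm_vec_ge0.
- by rewrite in_itv/= leey lee_fin sqr_ge0.
rewrite /sqnorm_vec (@le_trans _ _ (\sum_(i < N) (d ^+ 2 / N%:R)%:E)%E)//.
  apply: lee_sum => i _; apply: hT; rewrite (le_trans (ler_norm _))// (le_trans _ ht)//.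
  by rewrite (bigD1 i)//= lerDl sumr_ge0.
rewrite sumEFin sumr_const card_ord lee_fin -[X in (X <= _)%R]mulr_natr divfK//.
by rewrite gt_eqF// ltr0n.
Qed.
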